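(* Let $M$ be a simple matroid of rank $r$ on $\binom{r+1}{2}$ elements such that every line of $M$ has $2$ or $3$ elements, every plane (rank-$3$ flat) has $3$, $4$, or $6$ elements, and for every $h$ with $4\le h\le r$, every rank-$h$ flat has at most $\binom{h+1}{2}$ elements. Then at most $\binom{r+1}{3}$ lines of $M$ have three elements. Furthermore, if exactly $\binom{r+1}{3}$ lines of $M$ have three elements, then $M$ is isomorphic to $M(K_{r+1})$. Thus $M(K_{r+1})$ is extremal.
   Context: All matroids are finite. $M(K_{r+1})$ is the cycle matroid of the complete graph on $r+1$ vertices. Extremal matroids: a cyclic flat of a matroid is a flat that is a union of circuits; a matroid is nested if its cyclic flats form a chain under inclusion. For a matroid $M$ on $[n]$, its base polytope $\mathcal{P}(M)\subseteq\mathbb{R}^n$ is the convex hull of the characteristic vectors of its bases. For $X\subseteq\mathbb{R}^n$ let $\mathbb{I}(X)(x_1,\ldots,x_n)=\frac{1}{n!}\sum_{\sigma\in S_n}\bar{\mathbb{I}}(X)(x_{\sigma(1)},\ldots,x_{\sigma(n)})$, where $\bar{\mathbb{I}}(X)$ is the indicator function of $X$. Up to isomorphism there are exactly $\binom{n}{r}$ nested matroids of rank $r$ on $n$ elements; fix representatives $N_1,\ldots,N_{\binom nr}$ on $[n]$. For each rank-$r$ matroid $M$ on $[n]$ there are unique integers $c_j$ with $\mathbb{I}(\mathcal{P}(M))=\sum_j c_j\,\mathbb{I}(\mathcal{P}(N_j))$, and the vector $(c_j)$ depends only on the isomorphism class of $M$. $\Omega_{r,n}$ is the convex hull of these vectors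 over all rank-$r$ matroids on $n$ elements; a matroid is extremal if its vector is a vertex of $\Omega_{r,n}$. *)

(* Defs.v *)
From HB Require Import structures.
From mathcomp Require Import all_boot all_order all_algebra all_fingroup.
From mathcomp Require Import all_classical all_reals numfun.

Set Implicit Arguments.
Unset Strict Implicit.
Unset Printing Implicit Defensive.

Import GRing.Theory Num.Theory.
Local Open Scope ring_scope.
Local Open Scope classical_set_scope.

Record matroid (E : finType) := Matroid {
  indep : {set {set E}};
  indep0 : finset.set0 \in indep;
  indepS : forall A B : {set E}, A \subset B -> B \in indep -> A \in indep;
  indep_aug : forall A B : {set E}, A \in indep -> B \in indep ->
    (#|A| < #|B|)%N -> exists2 x, x \in B :\: A & x |: A \in indep }.

Section MatroidNotions.
Variables (E : finType) (M : matroid E).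
Implicit Types A B C F G : {set E}.

Definition base B : bool := maxset (mem (indep M)) B.

Definition circuit C : bool := minset (fun A => A \notin indep M) C.

Definition rk A : nat := \max_(I in indep M | I \subset A) #|I|.

Definition rank : nat := rk [set: E]%SET.

Definition flat F : bool := [forall x, (x \notin F) ==> (rk F < rk (x |: F))%N].

Definition flat_of_rank (h : nat) F : bool := flat F && (rk F == h).

Definition line : {set E} -> bool := flat_of_rank 2.

Definition plane : {set E} -> bool := flat_of_rank 3.

(* loops are the 1-element circuits, parallel pairs the 2-element ones *)
Definition simple : Prop := forall C, circuit C -> (2 < #|C|)%N.

Definition cyclic_flat F : Prop :=
  flat F /\
  exists2 S : {set {set E}}, (forall C, C \in S -> circuit C) & F = finset.cover S.

Definition nested : Prop := forall F G,
  cyclic_flat F -> cyclic_flat G -> (F \subset G) || (G \subset F).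

End MatroidNotions.

Definition isomorphic (E E' : finType) (M : matroid E) (M' : matroid E') : Prop :=
  exists2 f : E -> E', bijective f &
    forall A : {set E}, (f @: A \in indep M') = (A \in indep M).

Definition complete_edge (V : finType) := {e : {set V} | #|e| == 2}.

Section CycleMatroid.
Variable V : finType.
Local Notation edge := (complete_edge V).
Implicit Types (A B : {set edge}) (e : edge) (x y : V).

Definition adj A x y : bool := [exists e in A, val e == [set x; y]%SET].

(* [p] lists, in cyclic order, the distinct vertices of a cycle of the graph
   whose edge set is [A] *)
Definition graph_cycle A (p : seq V) : Prop :=
  [/\ uniq p, (2 < size p)%N & path.cycle (adj A) p].

Definition forests : {set {set edge}} :=
  [set A : {set edge} | `[< ~ exists p, graph_cycle A p >]]%SET.

Lemma forestsP A : reflect (~ exists p, graph_cycle A p) (A \in forests).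
Proof. by rewrite inE; apply: asboolP. Qed.

Lemma adjP A x y :
  reflect (exists2 e, e \in A & val e = [set x; y]%SET) (adj A x y).
Proof.
by apply: (iffP exists_inP) => -[e eA /eqP]; exists e => //; apply/eqP.
Qed.

Lemma adj_sym A : symmetric (adj A).
Proof. by move=> x y; apply: eq_existsb => e; rewrite finset.setUC. Qed.

Lemma adjS A B : A \subset B -> subrel (adj A) (adj B).
Proof.
by move=> /fintype.subsetP AB x y /adjP[e /AB eB ve]; apply/adjP; exists e.
Qed.

Lemma edgeE e : exists x y, x != y /\ val e = [set x; y]%SET.
Proof. by have /cards2P[x [y [xy ve]]] := valP e; exists x, y. Qed.

Lemma forests0 : finset.set0 \in forests.
Proof.
apply/forestsP => -[[|x [|y p]] [_ // _]] /= /andP[/adjP[e]].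
by rewrite inE.
Qed.

Lemma forestsS A B : A \subset B -> B \in forests -> A \in forests.
Proof.
move=> AB /forestsP nB; apply/forestsP => -[p [up sp cp]]; apply: nB; exists p.
by split=> //; apply: sub_cycle cp; apply: adjS.
Qed.

Lemma forest_bridge A e x y : A \in forests -> e \in A ->
  val e = [set x; y]%SET -> x != y -> ~~ connect (adj (A :\ e)) x y.
Proof.
move=> /forestsP nA eA ve xy; apply/negP => /connectP[p0 p0P yE].
case/shortenP: p0P yE => p pP up _ yE; apply: nA; exists (x :: p); split=> //.
  case: p pP up yE => [|z [|z' p]] //=; first by move=> _ _ yx; rewrite yx eqxx in xy.
  move=> /andP[/adjP[e' + ve'] _] _ yz; subst z.
  by rewrite !inE => /andP[/eqP + _]; case; apply: val_inj; rewrite ve ve'.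
rewrite /= rcons_path -yE; apply/andP; split.
  by apply: sub_path pP; apply: adjS; apply: subD1set.
by apply/adjP; exists e; rewrite // finset.setUC.
Qed.

Lemma nonforest_connect A e x y : A \in forests -> e |: A \notin forests ->
  val e = [set x; y]%SET -> connect (adj A) x y.
Proof.
move=> /forestsP nA /forestsP eA ve; apply: contrapT => ncon; apply: eA => -[p].
move=> [up sp cp]; apply: nA; exists p; split=> //.
apply: cycle_from_next => // u up'.
case: (rot_to up') => i q pE.
have nE : next p u = next (u :: q) u by rewrite -pE next_rot.
have {cp}cp : path.cycle (adj (e |: A)) (u :: q) by rewrite -pE rot_cycle.
have {}sp : (2 < size (u :: q))%N by rewrite -pE size_rot.
have {up' up pE}up : uniq (u :: q) by rewrite -pE rot_uniq.
rewrite {}nE; apply: contrapT => nuw; apply: ncon.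
case: q => [//|w [//|v q]] in cp sp up nuw *.
move: nuw; rewrite /= eqxx => nuw.
move: cp => /= /andP[/adjP[e' + ve']] /andP[wv vq].
rewrite inE => /orP[|e'A]; last by case: nuw; apply/adjP; exists e'.
rewrite inE => /eqP e'e; subst e'.
have adjA a b : a \notin [set u; w]%SET \/ b \notin [set u; w]%SET ->
    adj (e |: A) a b -> adj A a b.
  move=> ab /adjP[e' + vab]; rewrite inE => /orP[|e'A]; last first.
    by apply/adjP; exists e'.
  rewrite inE => /eqP e'e; move: ab; rewrite -ve' -e'e vab !inE !eqxx orbT.
  by case.
have vin z : z \in v :: q -> z \notin [set u; w]%SET.
  move=> zq; rewrite !inE; apply/negP => /orP[] /eqP zE; subst z.
    by move: up => /= /andP[]; rewrite inE zq orbT.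
  by move: up => /= /and3P[_]; rewrite zq.
have cwu : connect (adj A) w u.
  apply/connectP; exists (v :: rcons q u); last by rewrite /= last_rcons.
  rewrite /= adjA //=; last by right; apply: vin; rewrite mem_head.
  move: vq; rewrite !rcons_path => /andP[vq lu]; apply/andP; split; last first.
    by apply: adjA lu; left; apply: vin; apply: mem_last.
  apply: (sub_in_path (P := [in v :: q])) vq; last exact/allP.
  by move=> a b aq _; apply: adjA; left; apply: vin.
have sA := sym_connect_sym (@adj_sym A).
have : x \in [set u; w]%SET by rewrite -ve' ve !inE eqxx.
have : y \in [set u; w]%SET by rewrite -ve' ve !inE eqxx orbT.
by rewrite !inE => /orP[] /eqP-> /orP[] /eqP->; rewrite ?connect0 // sA.
Qed.

(* A forest has linearly independent incidence vectors over the field with two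
   elements; the augmentation axiom follows by comparing dimensions. *)
Let inc e : {ffun V -> ('F_2)^o} := [ffun x => (x \in val e)%:R].

Let incE e x y : x != y -> val e = [set x; y]%SET ->
  inc e = [ffun z => (z == x)%:R + (z == y)%:R].
Proof.
move=> xy ve; apply/ffunP => z; rewrite !ffunE ve !inE.
by case: eqVneq => [->|_]; rewrite ?(negPf xy) ?addr0 ?add0r.
Qed.

Let forest_free (s : seq edge) : uniq s ->
  finset [in s] \in forests -> free (map inc s).
Proof.
elim: s => [|e s IHs]; first by rewrite nil_free.
move=> /= /andP[es us] fs; rewrite free_cons IHs ?andbT //; last first.
  apply: forestsS fs; apply/fintype.subsetP => z.
  by rewrite !inE => ->; rewrite orbT.
have [x [y [xy ve]]] := edgeE e.
have es' : e \in finset [in e :: s] by rewrite !inE eqxx.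
have ncon := forest_bridge fs es' ve xy.
set a := adj _ in ncon.
have sa := sym_connect_sym (@adj_sym (finset [in e :: s] :\ e)).
pose phi (f : {ffun V -> ('F_2)^o}) : ('F_2)^o := \sum_(z | connect a x z) f z.
have phiL : linear phi.
  move=> c f g; rewrite /phi scaler_sumr -big_split; apply: eq_bigr => z _.
  by rewrite !ffunE.
pose phiM := GRing.isLinear.Build _ _ _ _ phi phiL.
pose phi' : {linear {ffun V -> ('F_2)^o} -> ('F_2)^o} := HB.pack phi phiM.
have phiE e' u v : u != v -> val e' = [set u; v]%SET ->
    phi (inc e') = (connect a x u)%:R + (connect a x v)%:R.
  move=> uv ve'; rewrite (incE uv ve') /phi.
  under eq_bigr do rewrite ffunE.
  have h w : \sum_(z | connect a x z) (z == w)%:R = (connect a x w)%:R :> 'F_2.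
    rewrite big_mkcond (bigD1 w) //= eqxx big1 ?addr0; first by case: ifP.
    by move=> z /negPf->; case: ifP.
  by rewrite big_split /= !h.
have sub : (<<map inc s>> <= lker (linfun phi'))%VS.
  apply/span_subvP => _ /mapP[e' e's ->]; rewrite memv_ker lfunE /=.
  have [u [v [uv ve']]] := edgeE e'.
  have auv : a u v.
    apply/adjP; exists e' => //; rewrite !inE e's orbT andbT.
    by apply: contraNneq es => <-.
  have -> : phi (inc e') = (connect a x u)%:R + (connect a x v)%:R by exact: phiE.
  rewrite (same_connect_r sa (connect1 auv)).
  by case: (connect a x v); rewrite ?addr0.
apply/negP => es1.
have := subvP sub _ es1; rewrite memv_ker lfunE /=.
have -> : phi (inc e) = (connect a x x)%:R + (connect a x y)%:R by exact: phiE.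
by rewrite connect0 (negPf ncon) addr0 oner_eq0.
Qed.

Let forest_card A B : B \in forests ->
  (forall e x y, e \in B -> val e = [set x; y]%SET -> connect (adj A) x y) ->
  (#|B| <= #|A|)%N.
Proof.
move=> fB BA.
have freeB : free (map inc (enum B)).
  apply: forest_free; first exact: enum_uniq.
  by rewrite (_ : finset _ = B) //; apply/setP => e; rewrite inE mem_enum.
have sub : (<<map inc (enum B)>> <= <<map inc (enum A)>>)%VS.
  apply/span_subvP => _ /mapP[e + ->]; rewrite mem_enum => eB.
  have [x [y [xy ve]]] := edgeE e.
  rewrite (incE xy ve); have /connectP[p pP ->] := BA e x y eB ve.
  elim: p x pP {xy ve} => [|z p IHp] x /=.
    move=> _; rewrite (_ : [ffun _ => _] = 0) ?mem0v //.
    by apply/ffunP => z; rewrite !ffunE; case: (z == x); apply: val_inj.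
  move=> /andP[/adjP[e' e'A ve'] /IHp zp].
  have xz : x != z.
    by have := valP e'; rewrite /= ve' cards2; case: (x != z).
  rewrite (_ : [ffun _ => _] =
      inc e' + [ffun w => (w == z)%:R + (w == last z p)%:R]).
    by apply: memvD zp; apply: memv_span; apply: map_f; rewrite mem_enum.
  rewrite (incE xz ve'); apply/ffunP => w; rewrite !ffunE -addrA; congr (_ + _).
  rewrite addrA (_ : (w == z)%:R + (w == z)%:R = 0) ?add0r //.
  by case: (w == z); apply: val_inj.
have := dimvS sub; rewrite (eqP freeB) size_map -cardE => /leq_trans; apply.
by rewrite (leq_trans (dim_span _)) // size_map -cardE.
Qed.

Lemma forests_aug A B : A \in forests -> B \in forests -> (#|A| < #|B|)%N ->
  exists2 e, e \in B :\: A & e |: A \in forests.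
Proof.
move=> fA fB; rewrite ltnNge => /negP nAB; apply: contrapT => nex; apply: nAB.
apply: forest_card => // e x y eB ve.
have [eA|eA] := boolP (e \in A).
  by apply: connect1; apply/adjP; exists e.
apply: nonforest_connect ve => //; apply/negP => eAf; apply: nex; exists e => //.
by rewrite inE eA.
Qed.

Definition cycle_matroid_complete : matroid edge :=
  Matroid forests0 forestsS forests_aug.

End CycleMatroid.

Definition M_K (n : nat) : matroid (complete_edge 'I_n) :=
  cycle_matroid_complete 'I_n.

Section Polytopes.
Variable R : realType.

Definition conv_hull (n : nat) (S : set 'rV[R]_n) : set 'rV[R]_n :=
  [set x | exists k (v : 'I_k -> 'rV[R]_n) (a : 'I_k -> R),
     [/\ forall i, S (v i), forall i, 0 <= a i, \sum_i a i = 1 &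
         x = \sum_i a i *: v i]].

(* a vertex of a polytope is a face with a single point: the only point where
   some linear functional [x |-> \sum_i u_i x_i] attains its maximum *)
Definition vertex (n : nat) (P : set 'rV[R]_n) (v : 'rV[R]_n) : Prop :=
  P v /\ exists u : 'rV[R]_n, forall x, P x -> x != v ->
    \sum_i u 0 i * x 0 i < \sum_i u 0 i * v 0 i.

Variable n : nat.
Implicit Types M : matroid 'I_n.

Definition base_polytope M : set 'rV[R]_n :=
  conv_hull [set \row_i (i \in B)%:R | B in [set B | base M B]].

Definition sym_indic (X : set 'rV[R]_n) (x : 'rV[R]_n) : R :=
  n`!%:R^-1 * \sum_(s : 'S_n) \1_X (\row_i x 0 (s i)).

(* The number [m] of representatives is not prescribed: it is necessarily
   ['C(n, r)]. *)
Definition nested_representatives (r m : nat) (N : 'I_m -> matroid 'I_n) : Prop :=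
  [/\ forall j, nested (N j) /\ rank (N j) = r,
      forall i j, isomorphic (N i) (N j) -> i = j &
      forall M, nested M -> rank M = r -> exists j, isomorphic M (N j)].

(* The integer vector [c] with I(P(M)) = \sum_j c_j I(P(N_j)), which exists and
   is unique when [N] is a system of representatives of the nested matroids of
   the same rank as [M]. *)
Definition nested_coords (m : nat) (N : 'I_m -> matroid 'I_n) M : 'rV[int]_m :=
  xget 0 [set c : 'rV[int]_m | forall x : 'rV[R]_n,
    sym_indic (base_polytope M) x =
    \sum_j (c 0 j)%:~R * sym_indic (base_polytope (N j)) x].

Definition nested_vector (m : nat) (N : 'I_m -> matroid 'I_n) M : 'rV[R]_m :=
  map_mx intr (nested_coords N M).

Definition Omega (r m : nat) (N : 'I_m -> matroid 'I_n) : set 'rV[R]_m :=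
  conv_hull [set nested_vector N M | M in [set M | rank M = r]].

End Polytopes.

(* The ground set is identified with [n] through an arbitrary relabelling [M'];
   neither the choice of [M'] nor that of the representatives matters. *)
Definition extremal (R : realType) (E : finType) (M : matroid E) : Prop :=
  forall (m : nat) (N : 'I_m -> matroid 'I_#|E|) (M' : matroid 'I_#|E|),
    nested_representatives (rank M) N -> isomorphic M M' ->
    vertex (Omega (rank M) N) (nested_vector R N M').

(* Main.v *)
Require Import Defs.
From mathcomp Require Import all_boot all_order all_algebra all_fingroup.
From mathcomp Require Import reals.
From mathcomp Require boolp classical_sets numfun.
From mathcomp Require Import zify ring lra.

Set Implicit Arguments.
Unset Strict Implicit.
Unset Printing Implicit Defensive.

Import Order.TTheory GRing.Theory Num.Theory.

(** * Rank and closure *)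

(** Call a matroid sparse when every set of rank k has at most C(k+1,2) elements. The hypotheses on
    flats say that M is sparse and has no five-point plane ([sparse_of_flats],
    [no5planes_of_planes]). Fix a point e; its mates are the other points of the three-point lines
    through e. Let A be a maximal set of mates with e ∪ A independent. Each point x of F = cl(e ∪ A)
    has a smallest support S ⊆ A with x in cl(e ∪ S). The empty support belongs to e alone, a
    support {a} to two points (the line through e and a has three points), and a support {a,b} to
    one point, because the plane on e, a, b has at least five points, hence six. These add up to
    C(|A|+2,2), the most that a set of rank |A|+1 can hold, so no other supports occur
    ([card_fibE]). It follows that e has exactly 2|A| ≤ 2(r-1) mates, and summing over e counts each
    three-point line six times ([card_triples]).

    In the case of equality every point has 2(r-1) mates and F is the whole ground set. Now e is an
    edge, the two points with support {a} join a vertex a to the ends of e, and the point with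
    support {a,b} joins a and b. The exact number of mates at the other points forces all triangles
    to be lines ([mate_of_line], [pair_points_collinear], [line_transitive], [labelling]), and a
    matroid of the right rank and size with these triangles is the cycle matroid ([recognition]).

    Extremality needs a linear functional on the coordinates that is maximal over rank-r matroids
    only at the class of M(K_{r+1}). The number of s-element sets of rank at most h extends to such
    a functional: A has rank at least k exactly when the base polytope has a point of weight at
    least k on A, and linear relations between indicators of compact convex sets survive taking
    Euler characteristics ([euler_convex], [valuative]). The invariant [functional] counts the
    triples of rank at most 2 and subtracts large penalties for failing to be sparse or for
    five-point planes, so the first part of the theorem identifies its unique maximum
    ([functional_max]).

    The coordinates exist because the indicator of a base polytope is a signed sum over chains of
    violated rank inequalities ([polytope_cells]), and each term expands into polytopes of nested
    matroids defined by chains ([nested_comb_cell]). *)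

Section Rank.
Variables (E : finType) (M : matroid E).
Implicit Types (A B C I J X : {set E}) (x y z : E).
Local Notation rk := (rk M).
Local Notation indep := (indep M).

Lemma rk_max I A : I \in indep -> I \subset A -> #|I| <= rk A.
Proof.
by move=> iI IA; apply: (@leq_bigmax_cond _ _ (fun J => #|J|)); rewrite iI.
Qed.

Lemma rk_basis_ext J A : J \in indep -> J \subset A ->
  exists I, [/\ I \in indep, J \subset I, I \subset A & #|I| = rk A].
Proof.
move=> iJ JA.
pose P I := [&& I \in indep, J \subset I & I \subset A].
have PJ : P J by rewrite /P iJ JA subxx.
have [I /maxsetP[/and3P[iI JI IA] maxI] _] := maxset_exists PJ.
exists I; split=> //; apply/eqP; rewrite eqn_leq rk_max //=.
apply/bigmax_leqP => K /andP[iK KA]; rewrite leqNgt; apply/negP.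
move=> /(indep_aug iI iK)[x]; rewrite inE => /andP[xI xK] ixI.
have PxI : P (x |: I).
  by rewrite /P ixI (subset_trans JI) ?subsetUr //= subUset sub1set (subsetP KA).
by have := setU11 x I; rewrite (maxI _ PxI (subsetUr _ _)) (negPf xI).
Qed.

Lemma rk_basis A : exists I, [/\ I \in indep, I \subset A & #|I| = rk A].
Proof.
by have [I [iI _ IA cI]] := rk_basis_ext (indep0 M) (sub0set A); exists I.
Qed.

Lemma rkS A B : A \subset B -> rk A <= rk B.
Proof.
move=> AB; have [I [iI IA <-]] := rk_basis A.
by apply: rk_max => //; apply: subset_trans AB.
Qed.

Lemma rk_card A : rk A <= #|A|.
Proof. by have [I [_ IA <-]] := rk_basis A; apply: subset_leq_card. Qed.

Lemma rk0 : rk set0 = 0.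
Proof. by apply/eqP; rewrite -leqn0 (leq_trans (rk_card _)) ?cards0. Qed.

Lemma rk_le_rank A : rk A <= rank M.
Proof. exact/rkS/subsetT. Qed.

Lemma indepE A : (A \in indep) = (rk A == #|A|).
Proof.
apply/idP/eqP => [iA|cA].
  by apply/eqP; rewrite eqn_leq rk_card rk_max.
have [I [iI IA cI]] := rk_basis A.
by have /eqP <- // : I == A by rewrite eqEcard IA cI cA /=.
Qed.

Lemma rk_indep A : A \in indep -> rk A = #|A|.
Proof. by rewrite indepE => /eqP. Qed.

(** A basis of [A :&: B] extends to a basis [J] of [A :|: B]. The traces of [J] on [A] and on [B]
    are independent, and inclusion-exclusion on their sizes gives the inequality. *)
Lemma rk_submod A B : rk (A :|: B) + rk (A :&: B) <= rk A + rk B.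
Proof.
have [I [iI IAB cI]] := rk_basis (A :&: B).
have IAU : I \subset A :|: B.
  by apply: subset_trans IAB _; rewrite subIset // subsetUl.
have [J [iJ IJ JAB cJ]] := rk_basis_ext iI IAU.
have iJA : J :&: A \in indep by apply: indepS iJ; apply: subsetIl.
have iJB : J :&: B \in indep by apply: indepS iJ; apply: subsetIl.
have cA := rk_max iJA (subsetIr _ _); have cB := rk_max iJB (subsetIr _ _).
apply: leq_trans (leq_add cA cB).
rewrite -cardsUI -setIUr -cJ (setIidPl JAB) leq_add2l -cI -setIIr.
by apply: subset_leq_card; rewrite subsetI IJ.
Qed.

Lemma rkU1 x A : rk (x |: A) <= (rk A).+1.
Proof.
have := rk_submod [set x] A; have := rk_card [set x]; rewrite cards1; lia.
Qed.

Definition cl A := [set x | rk (x |: A) == rk A].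

Lemma in_cl x A : (x \in cl A) = (rk (x |: A) <= rk A).
Proof. by rewrite inE eqn_leq (rkS (subsetUr _ _)) andbT. Qed.

(** A basis of [A] remains maximal in [cl A]: an element augmenting it would raise the rank of [A],
    against membership in the closure. *)
Lemma rk_cl A : rk (cl A) = rk A.
Proof.
have [I [iI IA cI]] := rk_basis A.
have sA : A \subset cl A.
  by apply/subsetP => x xA; rewrite in_cl (setUidPr _) ?sub1set.
apply/eqP; rewrite eqn_leq (rkS sA) andbT.
have [J [iJ IJ JA <-]] := rk_basis_ext iI (subset_trans IA sA).
rewrite -cI leqNgt; apply/negP => /(indep_aug iI iJ)[x].
rewrite inE => /andP[xI xJ] ixI.
have := subsetP JA _ xJ; rewrite in_cl -cI; apply/negP; rewrite -ltnNge.
have := rk_max ixI (setUS [set x] IA); rewrite cardsU1 xI; lia.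
Qed.

Lemma sub_cl A : A \subset cl A.
Proof. by apply/subsetP => x xA; rewrite in_cl (setUidPr _) ?sub1set. Qed.

Lemma clS A B : A \subset B -> cl A \subset cl B.
Proof.
move=> AB; apply/subsetP => x; rewrite !in_cl => xA.
have [xB|xB] := boolP (x \in B); first by rewrite (setUidPr _) ?sub1set.
have := rk_submod (x |: A) B; rewrite -setUA (setUidPr AB).
have : rk A <= rk ((x |: A) :&: B) by rewrite rkS // subsetI subsetUr.
lia.
Qed.

Lemma cl_id A : cl (cl A) = cl A.
Proof.
apply/eqP; rewrite eqEsubset sub_cl andbT; apply/subsetP => x.
rewrite !in_cl rk_cl; apply: leq_trans; apply: rkS; apply: setUS; exact: sub_cl.
Qed.

Lemma sub_clP A B : A \subset cl B -> cl A \subset cl B.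
Proof. by move=> /clS; rewrite cl_id. Qed.

Lemma sub_cl_rk A B : A \subset cl B -> rk A <= rk B.
Proof. by move=> /rkS; rewrite rk_cl. Qed.

Lemma cl_rk A B : A \subset B -> rk B <= rk A -> B \subset cl A.
Proof.
move=> AB rBA; apply/subsetP => x xB; rewrite in_cl (leq_trans _ rBA) // rkS //.
by rewrite subUset sub1set xB.
Qed.

Lemma cl_full A : rk A = rank M -> cl A = setT.
Proof.
by move=> rA; apply/eqP; rewrite -subTset cl_rk ?subsetT // rA.
Qed.

Lemma cl_exchange x y A : y \in cl (x |: A) -> y \notin cl A -> x \in cl (y |: A).
Proof.
rewrite !in_cl setUCA => yxA; rewrite -ltnNge => yA.
have := rkU1 x A; lia.
Qed.

Lemma indepU1 x A : A \in indep -> (x |: A \in indep) = (x \in A) || (x \notin cl A).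
Proof.
move=> iA; have [xA|xA] := boolP (x \in A).
  by rewrite (setUidPr _) ?sub1set.
rewrite in_cl indepE cardsU1 xA (rk_indep iA) -ltnNge /=.
have := rkU1 x A; rewrite (rk_indep iA); lia.
Qed.

(** Submodularity for [x |: A] and [x |: B]: their union has rank at least [#|A :|: B|], which
    leaves [x |: (A :&: B)] no more than the rank of [A :&: B]. *)
Lemma cl_indepI A B : A :|: B \in indep -> cl A :&: cl B \subset cl (A :&: B).
Proof.
move=> iAB; apply/subsetP => x; rewrite inE !in_cl => /andP[xA xB].
have := rk_submod (x |: A) (x |: B).
have -> : (x |: A) :&: (x |: B) = x |: (A :&: B) by rewrite -setUIr.
have : rk (A :|: B) <= rk ((x |: A) :|: (x |: B)).
  by rewrite rkS // setUSS ?subsetUr.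
have iA := indepS (subsetUl A B) iAB; have iB := indepS (subsetUr A B) iAB.
have iI : A :&: B \in indep by apply: indepS iA; exact: subsetIl.
move: xA xB; rewrite (rk_indep iA) (rk_indep iB) (rk_indep iI) (rk_indep iAB).
have := cardsUI A B; lia.
Qed.

End Rank.

(** * Three-point lines of sparse matroids *)

(** The bounds for ranks 0, 1, 2, 3 are 0, 1, 3, 6, so one inequality covers the absence of loops
    and parallel pairs as well as the bounds on lines, planes and higher flats. *)
Definition sparse (E : finType) (M : matroid E) : Prop :=
  forall A : {set E}, #|A| <= 'C((rk M A).+1, 2).

(** Together with [sparse] it makes the closure of such a set a plane of exactly six points. *)
Definition no5planes (E : finType) (M : matroid E) : Prop :=
  forall A : {set E}, #|A| = 5 -> rk M A = 3 -> exists2 x, x \notin A & x \in cl M A.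

Definition collinear (E : finType) (M : matroid E) (x y z : E) : bool :=
  [&& x != y, x != z, y != z & rk M [set x; y; z] <= 2].

Definition mates (E : finType) (M : matroid E) (x : E) : {set E} :=
  [set y | [exists z, collinear M x y z]].

(** In a sparse matroid these are the three-point lines ([long_lines_triples]); phrased by size and
    rank, their number makes sense for every matroid and is valuative. *)
Definition triples (E : finType) (M : matroid E) : {set {set E}} :=
  [set A : {set E} | (#|A| == 3) && (rk M A <= 2)].

Lemma cards3 (T : finType) (x y z : T) :
  x != y -> x != z -> y != z -> #|[set x; y; z]| = 3.
Proof.
by move=> xy xz yz; rewrite setUC cardsU1 cards2 xy !inE negb_or ![z == _]eq_sym xz yz.
Qed.

Lemma cards3P (T : finType) (A : {set T}) : #|A| = 3 ->
  exists x y z, [/\ x != y, x != z, y != z & A = [set x; y; z]].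
Proof.
move=> cA; have /set0Pn[x xA] : A != set0 by rewrite -card_gt0 cA.
have /eqP/cards2P[y [z [yz AE]]] : #|A :\ x| = 2 by have := cardsD1 x A; rewrite xA cA; lia.
have : y \in A :\ x by rewrite AE !inE eqxx.
have : z \in A :\ x by rewrite AE !inE eqxx orbT.
rewrite !inE => /andP[zx _] /andP[yx _]; exists x, y, z.
by rewrite eq_sym yx eq_sym zx yz -(setD1K xA) AE setUA.
Qed.

Section Sparse.
Variables (E : finType) (M : matroid E).
Hypothesis sparseM : sparse M.
Implicit Types (A B S T : {set E}) (x y z : E).
Local Notation rk := (rk M).
Local Notation cl := (cl M).
Local Notation col := (collinear M).

Lemma sparse_le A k : rk A <= k -> #|A| <= 'C(k.+1, 2).
Proof. by move=> rA; apply: leq_trans (sparseM A) _; apply: leq_bin2l. Qed.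

Lemma rk_pair x y : x != y -> rk [set x; y] = 2.
Proof.
move=> xy; apply/eqP; rewrite eqn_leq (leq_trans (rk_card M _)) ?cards2 ?xy //=.
rewrite ltnNge; apply/negP => /sparse_le; rewrite cards2 xy; by [].
Qed.

Lemma cl1 x : cl [set x] = [set x].
Proof.
apply/eqP; rewrite eq_sym eqEcard sub1set (subsetP (sub_cl M _)) ?set11 //= cards1.
by apply: (@sparse_le _ 1); rewrite rk_cl (leq_trans (rk_card M _)) ?cards1.
Qed.

Lemma card_line x y : #|cl [set x; y]| <= 3.
Proof.
apply: (@sparse_le _ 2); rewrite rk_cl (leq_trans (rk_card M _)) // cards2.
by case: (_ != _).
Qed.

Lemma collinear_swap x y z : col x y z = col y x z.
Proof. by rewrite /collinear (eq_sym x y) (setUC [set x]); bool_congr; rewrite andbCA. Qed.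

Lemma collinear_rot x y z : col x y z = col y z x.
Proof.
rewrite /collinear (_ : [set y; z; x] = [set x; y; z]); last by rewrite setUC setUA.
rewrite (eq_sym y x) (eq_sym z x).
by case: (x != y); case: (x != z); rewrite ?andbF.
Qed.

Lemma collinear_swapr x y z : col x y z = col x z y.
Proof. by rewrite collinear_rot collinear_swap -collinear_rot. Qed.

Lemma collinear_neq x y z : col x y z -> [/\ x != y, x != z & y != z].
Proof. by case/and4P. Qed.

Lemma collinear_cl x y z : col x y z -> z \in cl [set x; y].
Proof. by case/and4P=> xy _ _ r2; rewrite in_cl setUC rk_pair. Qed.

Lemma collinearP x y z : x != y -> z \in cl [set x; y] -> z != x -> z != y -> col x y z.
Proof.
move=> xy zc zx zy; rewrite /collinear xy eq_sym zx eq_sym zy /=.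
by rewrite -(rk_pair xy) setUC -in_cl.
Qed.

Lemma cl_collinear x y z : col x y z -> cl [set x; y] = [set x; y; z].
Proof.
move=> cxyz; have [xy xz yz] := collinear_neq cxyz.
apply/esym/eqP; rewrite eqEcard subUset sub_cl sub1set (collinear_cl cxyz) /=.
by rewrite (leq_trans (card_line x y)) // cards3 //; case/and4P: cxyz.
Qed.

Lemma collinear_uniq x y z z' : col x y z -> col x y z' -> z = z'.
Proof.
move=> cz cz'; have [_ xz' yz'] := collinear_neq cz'.
have := collinear_cl cz'; rewrite (cl_collinear cz) !inE.
by rewrite ![z' == _]eq_sym (negPf xz') (negPf yz') => /eqP.
Qed.

Lemma matesP x y : reflect (exists z, col x y z) (y \in mates M x).
Proof. by rewrite inE; apply: existsP. Qed.

Lemma mates_neq x y : y \in mates M x -> x != y.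
Proof. by case/matesP => z /and4P[]. Qed.

Lemma mates_sym x y : (y \in mates M x) = (x \in mates M y).
Proof. by apply/matesP/matesP => -[z c]; exists z; rewrite collinear_swap. Qed.

(* Every three-point line carries six ordered pairs of distinct points. *)
Lemma mates_triples : \sum_x #|mates M x| = 6 * #|triples M|.
Proof.
have -> : \sum_x #|mates M x| = \sum_x \sum_y \sum_(T in triples M) ((x != y) && (x \in T) && (y \in T)).
  apply: eq_bigr => x _; rewrite -sum1_card big_mkcond; apply: eq_bigr => y _.
  case: (matesP x y) => [[z c]|nc]; last first.
    rewrite big1 // => T; rewrite inE => /andP[/eqP cT r2].
    apply/eqP; rewrite eqb0; apply/negP => /andP[/andP[xy xT] yT].
    have /set0Pn[z] : T :\: [set x; y] != set0.
      by rewrite -card_gt0 cardsD (setIidPr _) ?subUset ?sub1set ?xT // cT cards2 xy.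
    rewrite inE => /andP[znxy zT]; apply: nc; exists z.
    move: znxy; rewrite !inE negb_or => /andP[zx zy].
    apply: collinearP => //; rewrite in_cl rk_pair //.
    by apply: leq_trans (rkS M _) r2; rewrite !subUset !sub1set xT yT zT.
  have [xy xz yz] := collinear_neq c.
  rewrite (bigD1 [set x; y; z]) /=; last first.
    by rewrite inE cards3 //=; case/and4P: c.
  rewrite xy !inE !eqxx orbT /= big1 // => T /andP[].
  rewrite inE => /andP[/eqP cT r2] Tn; apply/eqP; rewrite eqb0; apply/negP => /andP[xT yT].
  case/negP: Tn; rewrite eqEcard cT cards3 // andbT.
  rewrite -(cl_collinear c) cl_rk ?rk_pair // subUset !sub1set xT //.
under eq_bigr do rewrite exchange_big /=.
rewrite exchange_big /= [RHS]mulnC -sum_nat_const.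
apply: eq_bigr => T; rewrite inE => /andP[/eqP cT _].
rewrite (eq_bigr (fun x => (x \in T) * 2)); last first.
  move=> x _; case xT: (x \in T); last by rewrite big1 // => y _; rewrite andbF.
  rewrite mul1n -[2]/(3.-1) -cT (cardsD1 x T) xT /= -sum1_card [RHS]big_mkcond /=.
  by apply: eq_bigr => y _; rewrite !inE andbT [y == x]eq_sym; case: (_ && _).
by rewrite -big_distrl /= -big_mkcond sum1_card cT.
Qed.

End Sparse.

(** Vandermonde's identity. The weights C(2,|S|) are 1, 2, 1, 0, 0, ..., the numbers of points that
    a support [S] of each size turns out to carry. *)
Lemma sum_bin2_powerset (T : finType) (A : {set T}) :
  \sum_(S : {set T} | S \subset A) 'C(2, #|S|) = 'C(#|A|.+2, 2).
Proof.
rewrite (eq_bigr (fun S : {set T} => (#|S| == 0) + ((#|S| == 1) + (#|S| == 1)) + (#|S| == 2))); last first.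
  by move=> S _; case: #|S| => [|[|[|k]]].
have cnt k : \sum_(S : {set T} | S \subset A) (#|S| == k : nat) = 'C(#|A|, k).
  rewrite -cards_draws -sum1_card big_mkcond [RHS]big_mkcond.
  by apply: eq_bigr => S _; rewrite inE; case: (S \subset A); case: (_ == _).
rewrite !big_split /= !cnt bin0 bin1.
rewrite ![in RHS]binS !bin1 !bin0; lia.
Qed.

(** * Points spanned by the three-point lines through a fixed point *)

Section Frame.
Variables (E : finType) (M : matroid E).
Hypotheses (sparseM : sparse M) (planeM : no5planes M).
Variables (e : E) (A : {set E}).
Hypotheses (eA : e \notin A) (indA : e |: A \in indep M).
Hypotheses (Amates : A \subset mates M e) (matesA : mates M e \subset cl M (e |: A)).
Implicit Types (S T : {set E}) (x y z a b c : E).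
Local Notation rk := (rk M).
Local Notation cl := (cl M).
Local Notation col := (collinear M).

Definition fspan T := cl (e |: T).
Local Notation F := (fspan A).

(** For [x] in [F], the smallest subset of [A] that together with [e] spans [x]. Intersecting with
    [A] lets [T] range over all sets. *)
Definition supp x := \bigcap_(T : {set E} | x \in fspan (T :&: A)) T.

Lemma fspanS S T : S \subset T -> fspan S \subset fspan T.
Proof. by move=> ST; apply/clS/setUS. Qed.

Lemma fspanI S T : S \subset A -> T \subset A ->
  fspan S :&: fspan T \subset fspan (S :&: T).
Proof.
move=> SA TA; have := @cl_indepI _ M (e |: S) (e |: T); rewrite -setUIr; apply.
by apply: indepS indA; rewrite -setUUr setUS // subUset SA.
Qed.

Lemma rk_fspan T : T \subset A -> rk (fspan T) = #|T|.+1.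
Proof.
move=> TA; rewrite rk_cl rk_indep ?(indepS (setUS _ TA)) //.
by rewrite cardsU1 (contraNN (subsetP TA e)).
Qed.

Lemma mem_fspan T x : x \in T -> x \in fspan T.
Proof. by move=> xT; apply: (subsetP (sub_cl M _)); rewrite inE xT orbT. Qed.

Lemma e_fspan T : e \in fspan T.
Proof. by apply: (subsetP (sub_cl M _)); rewrite !inE eqxx. Qed.

(** By [fspanI] the sets whose span contains [x] are closed under intersection, so [supp x] is
    itself one of them. *)
Lemma suppP x T : x \in F -> T \subset A -> (supp x \subset T) = (x \in fspan T).
Proof.
move=> xF TA; apply/idP/idP => [sT|xT]; last first.
  by apply: bigcap_inf; rewrite (setIidPl TA).
apply: (subsetP (fspanS sT)).
suff: x \in fspan (supp x :&: A) by apply: (subsetP (fspanS (subsetIl _ _))).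
rewrite /supp; elim/big_ind: _ => [|S S' xS xS'|//]; first by rewrite setTI.
have := subsetP (fspanI (subsetIr S A) (subsetIr S' A)) x.
by rewrite inE xS xS' setIACA setIid => /(_ isT).
Qed.

Lemma supp_sub x : x \in F -> supp x \subset A.
Proof. by move=> xF; rewrite suppP. Qed.

Lemma fspan_supp x : x \in F -> x \in fspan (supp x).
Proof. by move=> xF; rewrite -suppP // supp_sub. Qed.

Lemma fspan_sub T x : T \subset A -> x \in fspan T -> x \in F.
Proof. by move=> TA; apply: (subsetP (fspanS TA)). Qed.

Lemma cl_fspan T x y : x \in fspan T -> y \in fspan T -> cl [set x; y] \subset fspan T.
Proof. by move=> xT yT; apply: sub_clP; rewrite subUset !sub1set xT yT. Qed.

Lemma collinear_F x y z : x \in F -> y \in F -> col x y z -> z \in F.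
Proof. by move=> xF yF /(collinear_cl sparseM); apply/subsetP/cl_fspan. Qed.

Lemma supp_collinear x y z : x \in F -> y \in F -> col x y z ->
  supp z \subset supp x :|: supp y.
Proof.
move=> xF yF cz; have zF := collinear_F xF yF cz.
rewrite suppP ?subUset ?supp_sub //.
apply: (subsetP (cl_fspan _ _) z (collinear_cl sparseM cz)).
  by apply: (subsetP (fspanS (subsetUl _ _))); apply: fspan_supp.
by apply: (subsetP (fspanS (subsetUr _ _))); apply: fspan_supp.
Qed.

Definition fib S := [set x in F | supp x == S].

Lemma in_fib x S : (x \in fib S) = (x \in F) && (supp x == S).
Proof. exact: in_set. Qed.

Lemma card_fspan T : T \subset A ->
  #|fspan T| = \sum_(S : {set E} | S \subset T) #|fib S|.
Proof.
move=> TA; rewrite -sum1_card (partition_big supp (fun S : {set E} => S \subset T)) /=.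
  apply: eq_bigr => S ST; rewrite -sum1_card; apply: eq_bigl => x.
  rewrite in_fib; apply/andP/andP => -[xT /eqP sx]; rewrite -sx eqxx; split=> //.
    exact: fspan_sub xT.
  by rewrite -suppP // sx.
by move=> x xT; rewrite suppP // (fspan_sub TA xT).
Qed.

Lemma fib0 : fib set0 = [set e].
Proof.
have f0 : fspan set0 = [set e] by rewrite /fspan setU0 cl1.
apply/setP => x; rewrite in_fib; apply/andP/idP => [[xF /eqP sx]|].
  by rewrite -f0 -sx fspan_supp.
move=> xe; rewrite -f0 in xe; rewrite (fspan_sub _ xe) ?sub0set //.
by split=> //; rewrite -subset0 suppP ?sub0set // (fspan_sub _ xe) ?sub0set.
Qed.

Lemma supp_e : supp e = set0.
Proof. by have := set11 e; rewrite -fib0 in_fib => /andP[_ /eqP]. Qed.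

Lemma fspan1 a : fspan [set a] = cl [set e; a].
Proof. by []. Qed.

Lemma card_fspan1 a : a \in A -> #|fspan [set a]| = 3.
Proof.
move=> aA; have /matesP[z c] := subsetP Amates _ aA.
have [? ? ?] := collinear_neq c.
by rewrite fspan1 (cl_collinear sparseM c) cards3.
Qed.

Lemma subset1_sum (f : {set E} -> nat) a :
  \sum_(S : {set E} | S \subset [set a]) f S = f set0 + f [set a].
Proof.
rewrite (bigD1 set0) ?sub0set //= (bigD1 [set a]) /=; last first.
  by rewrite subxx -card_gt0 cards1.
rewrite big1 ?addn0 // => S; rewrite subset1 -andbA => /and3P[/orP[/eqP->|/eqP->]];
  by rewrite eqxx ?andbF.
Qed.

Lemma card_fib1 a : a \in A -> #|fib [set a]| = 2.
Proof.
move=> aA; have := card_fspan1 aA; rewrite card_fspan ?sub1set //.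
by rewrite subset1_sum fib0 cards1; lia.
Qed.

Lemma powerset2 a b S : (S \subset [set a; b]) =
  [|| S == set0, S == [set a], S == [set b] | S == [set a; b]].
Proof.
apply/idP/idP => [Sab|/or4P[]/eqP->]; rewrite ?sub0set ?subxx ?subsetUl ?subsetUr //.
have [aS|aS] := boolP (a \in S); have [bS|bS] := boolP (b \in S).
- by rewrite [S == [set a; b]]eqEsubset Sab subUset !sub1set aS bS !orbT.
- rewrite [S == [set a]]eqEsubset sub1set aS andbT.
  suff -> : S \subset [set a] by rewrite orbT.
  apply/subsetP => x xS; have := subsetP Sab x xS; rewrite !inE => /orP[//|/eqP xb].
  by rewrite -xb xS in bS.
- rewrite [S == [set b]]eqEsubset sub1set bS andbT.
  suff -> : S \subset [set b] by rewrite !orbT.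
  apply/subsetP => x xS; have := subsetP Sab x xS; rewrite !inE => /orP[/eqP xa|//].
  by rewrite -xa xS in aS.
rewrite -subset0; apply/orP; left; apply/subsetP => x xS.
have := subsetP Sab x xS; rewrite !inE => /orP[]/eqP xE.
  by rewrite -xE xS in aS.
by rewrite -xE xS in bS.
Qed.

Lemma subset2_sum (f : {set E} -> nat) a b : a != b ->
  \sum_(S : {set E} | S \subset [set a; b]) f S =
    f set0 + f [set a] + f [set b] + f [set a; b].
Proof.
move=> ab; have ba : b != a by rewrite eq_sym.
have n0 x : [set x] != set0 :> {set E} by rewrite -card_gt0 cards1.
have n2 : [set a; b] != set0 by rewrite -card_gt0 cards2.
have n1 x : [set a; b] != [set x].
  by apply/eqP => /(congr1 (fun S : {set E} => #|S|)); rewrite cards1 cards2 ab.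
have nab : [set b] != [set a] by apply/eqP => /set1_inj/eqP; rewrite (negPf ba).
rewrite (eq_bigl _ _ (powerset2 a b)) (bigD1 set0) ?eqxx //=.
rewrite (bigD1 [set a]) /=; last by rewrite eqxx n0 orbT.
rewrite (bigD1 [set b]) /=; last by rewrite eqxx n0 nab !orbT.
rewrite (bigD1 [set a; b]) /=; last by rewrite eqxx n2 !n1 !orbT.
rewrite big1 ?addn0 ?addnA // => S; rewrite -!andbA.
by do 4!case: eqP => //.
Qed.

(** The plane on [e], [a], [b] has 1 + 2 + 2 points of smaller support. Sparsity allows at most six
    points and [no5planes] rules out five, so exactly one has full support. *)
Lemma card_fib2 a b : a \in A -> b \in A -> a != b -> #|fib [set a; b]| = 1.
Proof.
move=> aA bA ab; have abA : [set a; b] \subset A by rewrite subUset !sub1set aA bA.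
have cE := card_fspan abA.
rewrite subset2_sum // fib0 cards1 !card_fib1 // in cE.
have rE : rk (fspan [set a; b]) = 3 by rewrite rk_fspan // cards2 ab.
have := sparse_le sparseM (eq_leq rE); rewrite cE => le6.
suff : #|fspan [set a; b]| != 5 by move: le6; rewrite cE (_ : 'C(4, 2) = 6) //; lia.
apply/eqP => c5; have [x nx] := planeM c5 rE.
by rewrite {1}/fspan cl_id; apply/negP.
Qed.

Lemma card_fib_ge S : S \subset A -> 'C(2, #|S|) <= #|fib S|.
Proof.
move=> SA; case sS: #|S| => [|[|[|//]]].
- by move/eqP: sS; rewrite cards_eq0 => /eqP->; rewrite fib0 cards1.
- by move/eqP: sS SA => /cards1P[a ->]; rewrite sub1set => /card_fib1->.
move/eqP: sS SA => /cards2P[a [b [ab ->]]].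
by rewrite subUset !sub1set => /andP[aA bA]; rewrite card_fib2.
Qed.

(** The lower bounds [card_fib_ge] sum to C(|A|+2,2), which is also the sparsity bound on [F], of
    rank |A|+1. Hence each of them is an equality, and supports of three or more elements do not
    occur. *)
Lemma card_fibE S : S \subset A -> #|fib S| = 'C(2, #|S|).
Proof.
have le T : T \subset A -> 'C(2, #|T|) <= #|fib T| ?= iff ('C(2, #|T|) == #|fib T|).
  by move=> /card_fib_ge leT; split.
move=> SA; have := (leqif_sum le).2; rewrite sum_bin2_powerset -card_fspan //.
have -> : 'C(#|A|.+2, 2) == #|F|.
  have leF : #|F| <= 'C(#|A|.+2, 2) by apply: (sparse_le sparseM); rewrite rk_fspan.
  rewrite eqn_leq leF andbT.
  by rewrite -sum_bin2_powerset card_fspan // leq_sum // => T /card_fib_ge.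
by move/esym/forallP/(_ S); rewrite SA => /eqP.
Qed.

Lemma card_supp x : x \in F -> #|supp x| <= 2.
Proof.
move=> xF; have := card_fibE (supp_sub xF); rewrite leqNgt; case: ltnP => // s2.
rewrite bin_small // => /eqP; rewrite cards_eq0 => /eqP/setP/(_ x).
by rewrite in_fib xF eqxx in_set0.
Qed.

Lemma fib_uniq2 a b x y : a \in A -> b \in A -> a != b ->
  x \in F -> y \in F -> supp x = [set a; b] -> supp y = [set a; b] -> x = y.
Proof.
move=> aA bA ab xF yF sx sy; have /eqP/cards1P[z fz] := card_fib2 aA bA ab.
have : x \in fib [set a; b] by rewrite in_fib xF sx eqxx.
have : y \in fib [set a; b] by rewrite in_fib yF sy eqxx.
by rewrite fz !inE => /eqP-> /eqP->.
Qed.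

(** Since [e] has empty support, the two other points of a three-point line through [e] have equal
    supports. A two-element support belongs to a single point, so mates have singleton supports;
    conversely the points with support {a} lie on the line through [e] and [a]. *)
Lemma mates_e x : (x \in mates M e) = (x \in F) && (#|supp x| == 1).
Proof.
apply/idP/andP => [xm|[xF /cards1P[a sx]]]; last first.
  have aA : a \in A by have := supp_sub xF; rewrite sx sub1set.
  have ea : e != a by apply: contraNneq eA => ->.
  have xe : x != e.
    by apply: contra_eq_neq sx => ->; rewrite supp_e eq_sym -card_gt0 cards1.
  have /matesP[z c] := subsetP Amates _ aA.
  have : x \in fspan [set a] by rewrite -sx fspan_supp.
  rewrite fspan1 (cl_collinear sparseM c) => xc; apply/matesP.
  move: xc; rewrite !inE (negPf xe) /= => /orP[]/eqP->; first by exists z.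
  by exists a; rewrite collinear_rot collinear_swap -collinear_rot.
have xF : x \in F by exact: subsetP matesA x xm.
have eF : e \in F by exact: e_fspan.
split=> //; have ex := mates_neq xm.
have s0 : supp x != set0.
  apply/eqP => sx; have : x \in fib set0 by rewrite in_fib xF sx eqxx.
  by rewrite fib0 inE eq_sym (negPf ex).
have := card_supp xF; rewrite leq_eqVlt ltnS => /orP[|s1]; last first.
  by rewrite eqn_leq s1 card_gt0.
move=> /cards2P[a [b [ab sx]]]; case/matesP: xm => y c.
have [_ ey xy] := collinear_neq c.
have yF := collinear_F eF xF c.
have := supp_sub xF; rewrite sx subUset !sub1set => /andP[aA bA].
have sxy : supp x = supp y.
  have c' : col e y x by rewrite collinear_swapr.
  have := supp_collinear eF xF c; have := supp_collinear eF yF c'.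
  by rewrite supp_e !set0U => s1 s2; apply/eqP; rewrite eqEsubset s1.
by move/eqP: xy; case; apply: (fib_uniq2 aA bA ab xF yF sx); rewrite -sxy.
Qed.

Lemma card_mates_e : #|mates M e| = 2 * #|A|.
Proof.
rewrite -sum1_card (partition_big supp (fun S => (S \subset A) && (#|S| == 1))); last first.
  by move=> x; rewrite mates_e => /andP[xF ->]; rewrite supp_sub.
rewrite (eq_bigr (fun=> 2)); last first.
  move=> S /andP[SA /eqP S1]; have <- : #|fib S| = 2 by rewrite card_fibE // S1.
  rewrite -sum1_card.
  apply: eq_bigl => x; rewrite in_fib mates_e; case: (x \in F) => //=.
  by case: (supp x =P S) => [->|]; rewrite ?andbF // S1.
rewrite sum_nat_const mulnC; congr (_ * _); rewrite -[RHS]bin1 -cards_draws.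
by apply: eq_card => S; rewrite inE.
Qed.

Lemma card_mates_e_le : #|mates M e| <= 2 * (rank M).-1.
Proof.
rewrite card_mates_e leq_mul2l /=.
by have := rk_le_rank M F; rewrite rk_fspan //; lia.
Qed.

End Frame.

Section Bound.
Variables (E : finType) (M : matroid E).
Hypotheses (sparseM : sparse M) (planeM : no5planes M).

Definition frame (e : E) (A : {set E}) : Prop :=
  [/\ e \notin A, e |: A \in indep M, A \subset mates M e & mates M e \subset cl M (e |: A)].

(** A maximal [A] works: a mate outside the closure of [e |: A] could be added to it. *)
Lemma frame_exists e : exists A, frame e A.
Proof.
pose P (A : {set E}) := (A \subset mates M e) && (e |: A \in indep M).
have P0 : P set0.
  rewrite /P sub0set setU0 indepE cards1 eqn_leq.
  rewrite (leq_trans (rk_card M _)) ?cards1 //= lt0n; apply/negP => /eqP r0.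
  by have := sparseM [set e]; rewrite r0 cards1.
have [A /maxsetP[/andP[Am iA] maxA] _] := maxset_exists P0.
exists A; split=> //.
  by apply/negP => /(subsetP Am)/(mates_neq); rewrite eqxx.
apply/subsetP => x xm; apply: contraT => xA.
have Px : P (x |: A).
  by rewrite /P subUset sub1set xm Am /= setUCA indepU1 // xA orbT.
have := setU11 x A; rewrite (maxA _ Px (subsetUr _ _)) => xA'.
by case/negP: xA; apply: (subsetP (sub_cl M _)); rewrite inE xA' orbT.
Qed.

Lemma card_mates e : #|mates M e| <= 2 * (rank M).-1.
Proof.
by have [A [eA iA Am mA]] := frame_exists e; apply: (card_mates_e_le _ _ eA iA).
Qed.

Hypothesis cardE : #|E| = 'C((rank M).+1, 2).

(** Sum [card_mates] over all points, using C(r+1,2) · 2(r-1) = 6 C(r+1,3). *)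
Lemma card_triples : #|triples M| <= 'C((rank M).+1, 3).
Proof.
rewrite -(leq_pmul2l (isT : 0 < 6)) -mates_triples //.
have -> : 6 * 'C((rank M).+1, 3) = \sum_(e : E) (2 * (rank M).-1).
  rewrite sum_nat_const cardE; case: (rank M) => // r.
  have := bin_ffact r.+2 3; have := bin_ffact r.+2 2.
  rewrite !ffactnS !ffactn0 /= !factS fact0; lia.
by apply: leq_sum => e _; apply: card_mates.
Qed.

Lemma card_mates_eq : #|triples M| = 'C((rank M).+1, 3) ->
  forall e, #|mates M e| = 2 * (rank M).-1.
Proof.
move=> tE e; have := (leqif_sum (fun e (_ : true) =>
  @leqif_eq (#|mates M e|) (2 * (rank M).-1) (card_mates e))).2.
rewrite (mates_triples sparseM) tE.
have -> : 6 * 'C((rank M).+1, 3) = \sum_(e : E) (2 * (rank M).-1).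
  rewrite sum_nat_const cardE; case: (rank M) => // r.
  have := bin_ffact r.+2 3; have := bin_ffact r.+2 2.
  rewrite !ffactnS !ffactn0 /= !factS fact0; lia.
by rewrite eqxx => /esym/forallP/(_ e)/eqP.
Qed.

End Bound.

(** The equality case of the pigeonhole bound. It turns an exact number of mates into the existence
    of mates over every element of the frame. *)
Lemma fibers_full (T : finType) (h : T -> T) (X A : {set T}) m :
  {in X, forall y, h y \in A} -> {in A, forall b, #|[set y in X | h y == b]| <= m} ->
  #|X| = m * #|A| -> {in A, forall b, #|[set y in X | h y == b]| = m}.
Proof.
move=> hA le cX b bA.
have cXE : #|X| = \sum_(b in A) #|[set y in X | h y == b]|.
  rewrite -sum1_card (partition_big h (mem A)) //; apply: eq_bigr => c _.
  by rewrite -sum1_card; apply: eq_bigl => y; rewrite inE.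
have := (leqif_sum (fun b (bA : b \in A) => leqif_eq (le b bA))).2.
rewrite -cXE cX sum_nat_const mulnC eqxx => /esym/forallP/(_ b).
by rewrite bA => /eqP.
Qed.

(** * Equality case: the points as edges of a complete graph *)

Section Extremal.
Variables (E : finType) (M : matroid E).
Hypotheses (sparseM : sparse M) (planeM : no5planes M).
Variables (e : E) (A : {set E}).
Hypotheses (eA : e \notin A) (indA : e |: A \in indep M).
Hypotheses (Amates : A \subset mates M e) (matesA : mates M e \subset cl M (e |: A)).
Hypotheses (spanA : cl M (e |: A) = setT) (full : forall x, #|mates M x| = 2 * #|A|).
Implicit Types (S T : {set E}) (x y z a b c : E).
Local Notation rk := (rk M).
Local Notation cl := (cl M).
Local Notation col := (collinear M).
Local Notation supp := (supp M e A).
Local Notation fib := (fib M e A).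

Let inF x : x \in fspan M e A.
Proof. by rewrite /fspan spanA inE. Qed.

Let suppA x : supp x \subset A.
Proof. exact: supp_sub (inF x). Qed.

Let supp2 x : #|supp x| <= 2.
Proof. exact: card_supp (inF x). Qed.

Let suppC x y z : col x y z -> supp z \subset supp x :|: supp y.
Proof. exact: supp_collinear (inF x) (inF y). Qed.

Let fibE x S : (x \in fib S) = (supp x == S).
Proof. by rewrite in_fib inF. Qed.

Let uniq2 x y a b : a != b -> supp x = [set a; b] -> supp y = [set a; b] -> x = y.
Proof.
move=> ab sx sy; have := suppA x; rewrite sx subUset !sub1set => /andP[aA bA].
exact: (fib_uniq2 sparseM planeM eA indA Amates matesA aA bA ab (inF x) (inF y)).
Qed.

Let suppT x T : T \subset A -> (supp x \subset T) = (x \in fspan M e T).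
Proof. exact: suppP (inF x). Qed.

Lemma supp_eq2 x a b : a != b -> a \in supp x -> b \in supp x -> supp x = [set a; b].
Proof.
move=> ab ax bx; apply/esym/eqP; rewrite eqEcard subUset !sub1set ax bx /=.
by rewrite cards2 ab supp2.
Qed.

Lemma supp_no3 x a b c : a != b -> a != c -> b != c ->
  a \in supp x -> b \in supp x -> c \in supp x -> False.
Proof.
move=> ab ac bc ax bx; rewrite (supp_eq2 ab ax bx) !inE.
by rewrite ![c == _]eq_sym (negPf ac) (negPf bc).
Qed.

Lemma supp_neq0 x : x != e -> supp x != set0.
Proof.
move=> xe; rewrite -fibE (fib0 sparseM) ?inE //.
Qed.

Lemma col3 x y z : col x y z -> [/\ supp z \subset supp x :|: supp y,
  supp y \subset supp x :|: supp z & supp x \subset supp y :|: supp z].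
Proof.
move=> c; split; apply: suppC => //.
  by rewrite collinear_swapr.
by rewrite -collinear_rot.
Qed.

(** Distribute the mates of [x] over [A] by the element of their support other than [a]. At most two
    fall over each element, and there are 2|A| of them, so two fall over [b]; a line through [x] and
    such a mate has supports {a}, {b}, {a,b}. *)
Lemma mate_of_line x a b : supp x = [set a] -> b \in A -> a != b ->
  exists y p, [/\ supp y = [set b], supp p = [set a; b] & col x y p].
Proof.
move=> sx bA ab; have ba : b != a by rewrite eq_sym.
have aA : a \in A by have := suppA x; rewrite sx sub1set.
(* The default [a] collects the mates whose support is contained in {a}. *)
pose h y := if [pick c in supp y :\ a] is Some c then c else a.
have hP y c : c != a -> h y = c -> c \in supp y.
  rewrite /h; case: pickP => [d|_ ca ac]; last by rewrite ac eqxx in ca.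
  by rewrite !inE => /andP[_ dy] _ <-.
(* Both [y] and the third point [z] carry [c], and one of them also carries [a]. That one is the
   only point with support {a,c}, so the other must have support {c}. *)
have key y c : y \in mates M x -> h y = c -> c != a ->
  exists y' p, [/\ supp y' = [set c], supp p = [set a; c], col x y' p & y \in [set y'; p]].
  case/matesP => z xyz hy ca; have ac : a != c by rewrite eq_sym.
  have [sz sy] := col3 xyz; rewrite sx sub1set inE => aS.
  have [_ xz yz] := collinear_neq xyz.
  have cy := hP _ _ ca hy.
  have cz : c \in supp z.
    by have := subsetP sy _ cy; rewrite sx !inE (negPf ca).
  have xzy : col x z y by rewrite collinear_swapr.
  have single u v : c \in supp u -> col x u v -> supp v = [set a; c] -> u != v ->
      supp u = [set c].
    move=> cu xuv sv uv; have [_ su _] := col3 xuv.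
    have au : a \notin supp u.
      by apply: contraNN uv => au; apply/eqP/(uniq2 ac (supp_eq2 ac au cu) sv).
    apply/eqP; rewrite eqEsubset sub1set cu andbT; apply/subsetP => d du.
    have := subsetP su _ du; rewrite sx sv !inE.
    by case: eqP => // dE; rewrite -dE du in au.
  case/orP: aS => [ay|az].
    have syE := supp_eq2 ac ay cy; exists z, y; split=> //; last by rewrite !inE eqxx orbT.
    by apply: single xzy syE _; rewrite // eq_sym.
  have szE := supp_eq2 ac az cz; exists y, z; split=> //; last by rewrite !inE eqxx.
  exact: single xyz szE _.
have hA : {in mates M x, forall y, h y \in A}.
  move=> y _; rewrite /h; case: pickP => [d|//]; rewrite !inE => /andP[_].
  exact: (subsetP (suppA y)).
have le2 : {in A, forall c, #|[set y in mates M x | h y == c]| <= 2}.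
  move=> c cA; have [->|ca] := eqVneq c a.
    have : #|fspan M e [set a] :\ x| <= 2.
      have := cardsD1 x (fspan M e [set a]); rewrite (card_fspan1 sparseM Amates aA).
      by rewrite -suppT ?sub1set // sx subxx; lia.
    apply: leq_trans; apply: subset_leq_card; apply/subsetP => y.
    rewrite inE => /andP[/mates_neq xy /eqP hy]; rewrite in_setD1 eq_sym xy /=.
    have : y \in fspan M e [set a].
      rewrite -suppT ?sub1set //; apply/subsetP => d dy; rewrite inE.
      move: hy; rewrite /h; case: pickP => [f|/(_ d)]; first by rewrite !inE => /andP[/eqP].
      by rewrite !inE dy andbT => /negbFE.
    by [].
  have [->|[y0]] := set_0Vmem [set y in mates M x | h y == c]; first by rewrite cards0.
  rewrite inE => /andP[/key k0 /eqP /k0/(_ ca)[y [p [sy sp xyp _]]]].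
  apply: (@leq_trans #|[set y; p]|); last by rewrite cards2; case: (_ != _).
  apply: subset_leq_card; apply/subsetP => z; rewrite inE => /andP[/key kz /eqP /kz/(_ ca)].
  case=> y' [p' [sy' sp' xyp' zyp]].
  have ac : a != c by rewrite eq_sym.
  have pp : p' = p by apply: (uniq2 ac).
  rewrite pp in xyp' zyp.
  have c1 : col x p y by rewrite collinear_swapr.
  have c2 : col x p y' by rewrite collinear_swapr.
  by rewrite (collinear_uniq sparseM c1 c2).
have := fibers_full hA le2 (full x) bA.
have [->|[y]] := set_0Vmem [set y in mates M x | h y == b]; first by rewrite cards0.
rewrite inE => /andP[/key k /eqP /k/(_ ba)[y' [p [sy sp c _]]]] _.
by exists y', p.
Qed.

(** The same count at [p]. Over [d] outside {a,b} only the two points with supports {a,d} and {b,d}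
    can be mates of [p]; over [a] or [b] only the two points with that singleton support. Both
    possible mates must occur over [c], and they lie on one line with [p]. *)
Lemma pair_points_collinear p q s a b c : a != b -> a != c -> b != c ->
  supp p = [set a; b] -> supp q = [set a; c] -> supp s = [set b; c] -> col p q s.
Proof.
move=> ab ac bc sp sq ss.
have aA : a \in A by apply: (subsetP (suppA p)); rewrite sp !inE eqxx.
have bA : b \in A by apply: (subsetP (suppA p)); rewrite sp !inE eqxx orbT.
have cA : c \in A by apply: (subsetP (suppA q)); rewrite sq !inE eqxx orbT.
(* Mates with support inside {a,b} are sent to [a] or [b], the others to an element of their support
   outside it. *)
pose h y := if [pick d in supp y :\ a :\ b] is Some d then d
            else if a \in supp y then a else b.
have hP y d : d != a -> d != b -> h y = d -> d \in supp y.
  rewrite /h; case: pickP => [f|_ da db]; last first.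
    by case: ifP => _ dE; rewrite -dE eqxx in da db.
  by rewrite !inE => /and3P[_ _ dy] _ _ <-.
have key y d : y \in mates M p -> h y = d -> d != a -> d != b ->
  exists z, col p y z /\ ((supp y = [set a; d] /\ supp z = [set b; d])
    \/ (supp y = [set b; d] /\ supp z = [set a; d])).
  move=> /matesP[z c1] hy da db; exists z; split=> //.
  have [sz sy spz] := col3 c1; have dy := hP _ _ da db hy.
  have dz : d \in supp z.
    by have := subsetP sy _ dy; rewrite sp !inE (negPf da) (negPf db).
  rewrite eq_sym in da; rewrite eq_sym in db.
  have := subsetP spz a; have := subsetP spz b; rewrite sp !inE !eqxx orbT.
  move=> /(_ isT)/orP[bY|bZ] /(_ isT)/orP[aY|aZ].
  - by case: (supp_no3 ab da db aY bY dy).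
  - by right; split; apply: supp_eq2.
  - by left; split; apply: supp_eq2.
  - by case: (supp_no3 ab da db aZ bZ dz).
have low y d : y \in mates M p -> h y = d -> (d == a) || (d == b) -> supp y = [set d].
  move=> ym hy dab; have sub : supp y \subset [set a; b].
    move: hy; rewrite /h; case: pickP => [f|no _].
      by rewrite !inE => /and3P[fb fa _] fd; rewrite -fd (negPf fa) (negPf fb) in dab.
    by apply/subsetP => g gy; have := no g; rewrite !inE gy andbT; do 2!case: eqP.
  have [z c1] := matesP _ _ _ ym; have [py pz yz] := collinear_neq c1.
  have [sz sy spz] := col3 c1.
  have nab : supp y != [set a; b].
    by apply: contraNneq py => syE; apply/eqP/(uniq2 ab).
  have n0 : supp y != set0.
    apply/eqP => s0; rewrite s0 set0U in spz.
    case/eqP: pz; apply: (uniq2 ab) => //; apply/esym/eqP.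
    by rewrite eqEcard -sp spz sp cards2 ab supp2.
  have := powerset2 a b (supp y); rewrite sub (negPf n0) (negPf nab) orbF /=.
  move/esym => /orP[] /eqP syE; rewrite syE; congr [set _]; move: hy; rewrite /h.
    case: pickP => [f|no]; last by rewrite syE set11.
    by rewrite syE !inE => /and3P[_ /negPf->].
  case: pickP => [f|no]; last by rewrite syE inE (negPf ab).
  by rewrite syE !inE => /and3P[/negPf->].
have hA : {in mates M p, forall y, h y \in A}.
  move=> y _; rewrite /h; case: pickP => [d|_]; last by case: ifP.
  by rewrite !inE => /and3P[_ _]; apply: (subsetP (suppA y)).
have le2 : {in A, forall d, #|[set y in mates M p | h y == d]| <= 2}.
  move=> d dA; have [dab|/norP[da db]] := boolP ((d == a) || (d == b)).
    rewrite -(card_fib1 sparseM eA indA Amates matesA dA) subset_leq_card //.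
    apply/subsetP => y; rewrite inE fibE => /andP[ym /eqP hy].
    by rewrite (low y d).
  rewrite eq_sym in da; rewrite eq_sym in db.
  have dAA x : x \in A -> [set x; d] \subset A by move=> xA; rewrite subUset !sub1set xA dA.
  have f1 : #|fib [set a; d]| = 1.
    exact: (card_fib2 sparseM planeM eA indA Amates matesA aA dA da).
  have f2 : #|fib [set b; d]| = 1.
    exact: (card_fib2 sparseM planeM eA indA Amates matesA bA dA db).
  apply: (@leq_trans #|fib [set a; d] :|: fib [set b; d]|); last first.
    by rewrite cardsU f1 f2 leq_subr.
  apply: subset_leq_card; apply/subsetP => y; rewrite inE => /andP[ym /eqP hy].
  rewrite in_setU !fibE.
  rewrite eq_sym in da; rewrite eq_sym in db.
  by have [z [_ [[-> _]|[-> _]]]] := key y d ym hy da db; rewrite eqxx ?orbT.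
have := fibers_full hA le2 (full p) cA.
have [->|[y]] := set_0Vmem [set y in mates M p | h y == c]; first by rewrite cards0.
rewrite inE eq_sym in ac *; rewrite eq_sym in bc.
move=> /andP[ym /eqP hy] _; have [z [pyz sE]] := key y c ym hy ac bc.
rewrite eq_sym in ac; rewrite eq_sym in bc.
case: sE pyz => -[sy sz].
  by rewrite (uniq2 ac sy sq) (uniq2 bc sz ss).
by rewrite collinear_swapr (uniq2 bc sy ss) (uniq2 ac sz sq).
Qed.

(** If the mate [z'] of [x] over [c] were not [z], the line through [z] and [z'] would contain [e].
    The span [Q] of [x], [y], [z] contains [p] and [s], hence [q], then [z'], then [e], and finally
    [a], [b], [c]: a set of rank 4 spanned by three points. *)
Lemma line_transitive x y z a b c p q s : a != b -> a != c -> b != c ->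
  supp x = [set a] -> supp y = [set b] -> supp z = [set c] ->
  supp p = [set a; b] -> supp q = [set a; c] -> supp s = [set b; c] ->
  col x y p -> col y z s -> col x z q.
Proof.
move=> ab ac bc sx sy sz sp sq ss xyp yzs.
have aA : a \in A by have := suppA x; rewrite sx sub1set.
have bA : b \in A by have := suppA y; rewrite sy sub1set.
have cA : c \in A by have := suppA z; rewrite sz sub1set.
have [z' [q' [sz' sq' xzq]]] := mate_of_line sx cA ac.
rewrite (uniq2 ac sq' sq) in xzq.
have [<-//|zz] := eqVneq z' z.
pose Q := cl [set x; y; z].
have line u v w : u \in Q -> v \in Q -> col u v w -> w \in Q.
  move=> uQ vQ /(collinear_cl sparseM); apply/subsetP.
  by apply: sub_clP; rewrite subUset !sub1set uQ vQ.
have xQ : x \in Q by apply: (subsetP (sub_cl M _)); rewrite !inE eqxx.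
have yQ : y \in Q by apply: (subsetP (sub_cl M _)); rewrite !inE eqxx orbT.
have zQ : z \in Q by apply: (subsetP (sub_cl M _)); rewrite !inE eqxx !orbT.
have pQ := line _ _ _ xQ yQ xyp; have sQ := line _ _ _ yQ zQ yzs.
have qQ : q \in Q.
  by apply: (line p s) => //; rewrite collinear_swapr (pair_points_collinear ab ac bc).
have zQ' : z' \in Q by apply: (line x q) => //; rewrite collinear_swapr.
have spanl u d : supp u = [set d] -> u \in fspan M e [set d].
  by move=> su; rewrite -suppT ?su ?subxx // -su suppA.
have ne u d : supp u = [set d] -> u != e.
  by move=> su; apply: contra_eq_neq su => ->; rewrite supp_e // eq_sym -card_gt0 cards1.
have third u v d : supp u = [set d] -> supp v = [set d] -> u != v -> col u v e.
  move=> su sv uv; have dA : d \in A by have := suppA u; rewrite su sub1set.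
  have [eu ev] := (ne _ _ su, ne _ _ sv).
  apply: collinearP; rewrite // 1?eq_sym //.
  suff -> : cl [set u; v] = fspan M e [set d] by apply: e_fspan.
  have uvS : [set u; v] \subset fspan M e [set d] by rewrite subUset !sub1set !spanl.
  apply/eqP; rewrite eqEsubset sub_clP //=.
  by rewrite cl_rk // (rk_fspan eA indA) ?sub1set // cards1 rk_pair.
have eQ : e \in Q by apply: (line z' z) => //; apply: (third _ _ c).
have inQ u d : supp u = [set d] -> u \in Q -> d \in Q.
  move=> su uQ; have dA : d \in A by have := suppA u; rewrite su sub1set.
  have [->//|nd] := eqVneq d u.
  have sd : supp d = [set d].
    apply/eqP; rewrite eqEcard cards1 suppT ?sub1set ?mem_fspan ?set11 //=.
    by rewrite card_gt0 supp_neq0 //; apply: contraNneq eA => <-.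
  by apply: (line e u) => //; rewrite collinear_rot (third _ _ d) // eq_sym.
have TA : [set a; b; c] \subset A by rewrite !subUset !sub1set aA bA cA.
have : rk (fspan M e [set a; b; c]) <= rk [set x; y; z].
  rewrite -(rk_cl M [set x; y; z]) rkS // sub_clP // subUset sub1set eQ /=.
  by rewrite !subUset !sub1set (inQ _ _ sx xQ) (inQ _ _ sy yQ) (inQ _ _ sz zQ).
rewrite (rk_fspan eA indA TA) cards3 // => r4.
have := leq_trans r4 (rk_card M _); rewrite setUC cardsU1 cards2.
by case: (_ \notin _); case: (_ != _).
Qed.

(* The vertices of the complete graph are [None], [Some None] and the elements
   of [A]; the edge joining the first two is [e]. *)
Lemma labelling : exists g : option (option {a | a \in A}) -> option (option {a | a \in A}) -> E,
  [/\ forall u v, g u v = g v u,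
      forall u v w, u != v -> u != w -> v != w -> rk [set g u v; g u w; g v w] <= 2 &
      forall x, exists u v, u != v /\ g u v = x].
Proof.
pose P a b := odflt e [pick x in fib [set a; b]].
have PP a b : a \in A -> b \in A -> a != b -> supp (P a b) = [set a; b].
  move=> aA bA ab; apply/eqP; rewrite -fibE /P.
  case: pickP => [x//|no]; have := card_fib2 sparseM planeM eA indA Amates matesA aA bA ab.
  by rewrite eq_card0.
have PC a b : P a b = P b a by rewrite /P setUC.
have f2 a : a \in A -> #|fib [set a]| = 2 by exact: card_fib1.
(* [X a] and [Y a] are to be the edges from [a] to the two ends of [e]. One point [x0] over [a0]
   fixes which end belongs to [X]; lines through [x0] carry the choice to all of [A], and
   [line_transitive] shows it is coherent. *)
have [X [Y [sX sY XY colX]]] : exists X Y : E -> E,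
  [/\ {in A, forall a, supp (X a) = [set a]}, {in A, forall a, supp (Y a) = [set a]},
      {in A, forall a, X a != Y a} &
      {in A &, forall a b, a != b -> col (X a) (X b) (P a b)}].
  have [A0|[a0 a0A]] := set_0Vmem A.
    by exists id, id; split=> a; rewrite A0 inE.
  have /card_gt0P[x0] : 0 < #|fib [set a0]| by rewrite f2.
  rewrite fibE => /eqP sx0.
  pose X b := if b == a0 then x0 else odflt e [pick y in fib [set b] | col x0 y (P a0 b)].
  have XP b : b \in A -> b != a0 -> supp (X b) = [set b] /\ col x0 (X b) (P a0 b).
    move=> bA ba; rewrite /X (negPf ba); rewrite eq_sym in ba.
    case: pickP => [y|no]; first by rewrite fibE => /andP[/eqP].
    have [y [p [sy sp c]]] := mate_of_line sx0 bA ba.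
    by have := no y; rewrite fibE sy eqxx -(uniq2 ba sp (PP _ _ a0A bA ba)) c.
  have X0 : X a0 = x0 by rewrite /X eqxx.
  have sX : {in A, forall a, supp (X a) = [set a]}.
    by move=> a aA; have [->|aa] := eqVneq a a0; [rewrite X0|case: (XP a aA aa)].
  pose Y a := odflt e [pick y in fib [set a] :\ X a].
  have YP a : a \in A -> Y a \in fib [set a] :\ X a.
    move=> aA; rewrite /Y; case: pickP => [y//|no].
    have := cardsD1 (X a) (fib [set a]); rewrite f2 // fibE sX // eqxx eq_card0 //.
  exists X, Y; split=> //.
  - by move=> a /YP; rewrite in_setD1 fibE => /andP[_ /eqP].
  - by move=> a /YP; rewrite in_setD1 eq_sym => /andP[].
  move=> a b aA bA ab; have [aE|aa] := eqVneq a a0.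
    by rewrite aE X0; apply: (XP b bA _).2; rewrite -aE eq_sym.
  have [bE|ba] := eqVneq b a0.
    by rewrite bE X0 PC collinear_swap; apply: (XP a aA aa).2.
  have c1 := (XP a aA aa).2; have c2 := (XP b bA ba).2.
  have aa' : a0 != a by rewrite eq_sym.
  have ba' : a0 != b by rewrite eq_sym.
  rewrite collinear_swap PC in c1.
  exact: (line_transitive aa ab ba' (sX _ aA) sx0 (sX _ bA) (PP _ _ aA a0A aa)
           (PP _ _ aA bA ab) (PP _ _ a0A bA ba') c1 c2).
have XYE a x : a \in A -> supp x = [set a] -> x = X a \/ x = Y a.
  move=> aA sx; have : fib [set a] = [set X a; Y a].
    apply/esym/eqP; rewrite eqEcard subUset !sub1set !fibE sX // sY // eqxx f2 //.
    by rewrite cards2 XY.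
  move/setP/(_ x); rewrite fibE sx eqxx !inE => /esym/orP[]/eqP->; [by left|by right].
(* The mate of [Y a] over [b] is not [X b], because the line through [X b] and [P a b] already has
   [X a] as its third point. *)
have colY : {in A &, forall a b, a != b -> col (Y a) (Y b) (P a b)}.
  move=> a b aA bA ab; have [y [p [sy sp c]]] := mate_of_line (sY _ aA) bA ab.
  rewrite (uniq2 ab sp (PP _ _ aA bA ab)) in c.
  case: (XYE _ _ bA sy) => yE; rewrite yE in c; last by [].
  have c1 := colX _ _ aA bA ab; rewrite collinear_rot in c1; rewrite collinear_rot in c.
  by case/eqP: (XY _ aA); exact: (collinear_uniq sparseM c1 c).
have colXY a : a \in A -> rk [set e; X a; Y a] <= 2.
  move=> aA; rewrite -[2]/(1.+1) -(cards1 a) -(rk_fspan eA indA) ?sub1set //.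
  rewrite rkS // !subUset !sub1set e_fspan -!suppT ?sX ?sY ?sub1set ?set11 //.
pose g (u v : option (option {a | a \in A})) := match u, v with
  | None, Some None | Some None, None => e
  | None, Some (Some a) | Some (Some a), None => X (sval a)
  | Some None, Some (Some a) | Some (Some a), Some None => Y (sval a)
  | Some (Some a), Some (Some b) => P (sval a) (sval b)
  | _, _ => e end.
have P3 a b c : a \in A -> b \in A -> c \in A -> a != b -> a != c -> b != c ->
    rk [set P a b; P a c; P b c] <= 2.
  move=> aA bA cA ab ac bc.
  by have /and4P[] := pair_points_collinear ab ac bc (PP _ _ aA bA ab) (PP _ _ aA cA ac) (PP _ _ bA cA bc).
have perm x y z x' y' z' : [set x; y; z] = [set x'; y'; z'] ->
    rk [set x'; y'; z'] <= 2 -> rk [set x; y; z] <= 2 by move=> ->.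
have s213 x y z : [set x; y; z] = [set y; x; z] :> {set E} by rewrite (setUC [set x]).
have s132 x y z : [set x; y; z] = [set x; z; y] :> {set E} by rewrite setUAC.
have s231 x y z : [set x; y; z] = [set y; z; x] :> {set E} by rewrite s213 s132.
have s312 x y z : [set x; y; z] = [set z; x; y] :> {set E} by rewrite s132 s213.
have s321 x y z : [set x; y; z] = [set z; y; x] :> {set E} by rewrite s213 s312.
have colr x y z : col x y z -> rk [set x; y; z] <= 2 by case/and4P.
have neq (a b : {a | a \in A}) : Some (Some a) != Some (Some b) -> sval a != sval b.
  by apply: contra_neq => /val_inj->.
have colX' a b : a \in A -> b \in A -> a != b -> rk [set X a; X b; P a b] <= 2.
  by move=> aA bA ab; apply/colr/colX.
have colY' a b : a \in A -> b \in A -> a != b -> rk [set Y a; Y b; P a b] <= 2.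
  by move=> aA bA ab; apply/colr/colY.
exists g; split.
- by move=> [[a|]|] [[b|]|] //=; rewrite PC.
- move=> [[[a aA]|]|] [[[b bA]|]|] [[[c cA]|]|] //= =>
    [/neq ab /neq ac /neq bc|/neq ab _ _|/neq ab _ _|_ /neq ab _|_ _ _|_ /neq ab _|_ _ _|
     _ _ /neq ab|_ _ _|_ _ _|_ _ /neq ab|_ _ _|_ _ _].
  + exact: P3.
  + by rewrite s231; exact: colY'.
  + by rewrite s231; exact: colX'.
  + by rewrite s132; exact: colY'.
  + by rewrite s321; exact: colXY.
  + by rewrite s132; exact: colX'.
  + by rewrite s312; exact: colXY.
  + exact: colY'.
  + by rewrite s231; exact: colXY.
  + by rewrite s132; exact: colXY.
  + exact: colX'.
  + by rewrite s213; exact: colXY.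
  + exact: colXY.
move=> x; have := powerset2; case sx: #|supp x| => [|[|[|k]]].
- move/eqP: sx; rewrite cards_eq0 -fibE fib0 // inE => /eqP-> _.
  by exists None, (Some None).
- move/eqP: sx => /cards1P[a sx] _.
  have aA : a \in A by have := suppA x; rewrite sx sub1set.
  case: (XYE _ _ aA sx) => ->.
    by exists None, (Some (Some (exist _ a aA))).
  by exists (Some None), (Some (Some (exist _ a aA))).
- move/eqP: sx => /cards2P[a [b [ab sx]]] _.
  have := suppA x; rewrite sx subUset !sub1set => /andP[aA bA].
  exists (Some (Some (exist _ a aA))), (Some (Some (exist _ b bA))); split.
    by apply: contra_neq ab => -[].
  by apply/esym/(uniq2 ab) => //; exact: PP.
by have := supp2 x; rewrite sx.
Qed.

End Extremal.

(** * The cycle matroid of a complete graph *)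

Section CompleteGraph.
Variable V : finType.
Local Notation edge := (complete_edge V).
Local Notation K := (cycle_matroid_complete V).
Implicit Types (A B S : {set edge}) (e : edge) (u v w x y z : V).

Lemma edge_neq e x y : val e = [set x; y] -> x != y.
Proof. by have := valP e => /= + ve; rewrite ve cards2; case: (x != y). Qed.

Lemma edge_exists x y : x != y -> exists e, val e = [set x; y].
Proof.
move=> xy; have c2 : #|[set x; y]| == 2 by rewrite cards2 xy.
by exists (exist (fun e : {set V} => #|e| == 2) _ c2).
Qed.

Lemma edge_at e v : v \in val e -> exists2 y, v != y & val e = [set v; y].
Proof.
have [x [y [xy ve]]] := edgeE e; rewrite ve !inE => /orP[]/eqP->.
  by exists y.
by exists x; rewrite 1?eq_sym // setUC.
Qed.

Lemma val_inj_edge : injective (val : edge -> {set V}).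
Proof. exact: val_inj. Qed.

Lemma card_edges (W : {set V}) : #|[set e : edge | val e \subset W]| = 'C(#|W|, 2).
Proof.
rewrite -cards_draws -(card_imset _ val_inj_edge); apply: eq_card => S.
rewrite inE; apply/imsetP/andP => [[e + ->]|[SW c2]].
  by rewrite inE => ->; split=> //; exact: (valP e).
by exists (exist (fun e : {set V} => #|e| == 2) S c2); rewrite ?inE.
Qed.

Lemma card_edge : #|{: edge}| = 'C(#|V|, 2).
Proof.
rewrite -[#|V|]cardsT -card_edges -cardsT; apply: eq_card => e.
by rewrite !inE subsetT.
Qed.

Lemma triangle_rk e1 e2 e3 x y z : x != y -> x != z -> y != z ->
  val e1 = [set x; y] -> val e2 = [set x; z] -> val e3 = [set y; z] ->
  rk K [set e1; e2; e3] <= 2.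
Proof.
move=> xy xz yz v1 v2 v3; rewrite leqNgt; apply/negP => r3.
have : [set e1; e2; e3] \in indep K.
  rewrite indepE eqn_leq rk_card (leq_trans _ r3) //.
  by rewrite setUC cardsU1 cards2; case: (_ \notin _); case: (_ != _).
move=> /forestsP; apply; exists [:: x; y; z]; split=> //=.
  by rewrite !inE negb_or xy xz yz.
apply/and4P; split=> //; apply/adjP.
- by exists e1; rewrite // !inE eqxx.
- by exists e3; rewrite // !inE eqxx !orbT.
by exists e2; rewrite ?v2 1?setUC // !inE eqxx !orbT.
Qed.

(** No edge of [A] meets [v], so [v] is not connected in [A] to the other end of [e], and adding [e]
    closes no cycle. *)
Lemma pendant_forest A e v : A \in forests V -> {in A, forall a : edge, v \notin val a} ->
  v \in val e -> e |: A \in forests V.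
Proof.
move=> fA nv /edge_at[y vy ve]; apply: contraT => nf.
have /connectP[[|z p] /=] := nonforest_connect fA nf ve.
  by move=> _ yv; rewrite yv eqxx in vy.
by move=> /andP[/adjP[a /nv + va] _]; rewrite va !inE eqxx.
Qed.

Definition star v A := [set e in A | v \in val e].

Lemma starD v A : {in A :\: star v A, forall a : edge, v \notin val a}.
Proof. by move=> a; rewrite !inE => /andP[+ aA]; rewrite aA. Qed.

(** Induction on the size: the end of [e] other than [v] lies on no other edge, so [e] is pendant
    there. *)
Lemma star_forest v A : {in A, forall a : edge, v \in val a} -> A \in forests V.
Proof.
have [n] := ubnP #|A|; elim: n A => // n IHn A ltAn vA.
have [->|[e eA]] := set_0Vmem A; first exact: forests0.
rewrite -(setD1K eA); have [y vy ve] := edge_at (vA e eA).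
apply: (@pendant_forest _ _ y); last by rewrite ve !inE eqxx orbT.
  apply: IHn; last by move=> a; rewrite !inE => /andP[_ /vA].
  by rewrite (cardsD1 e) eA ltnS in ltAn.
move=> a; rewrite !inE => /andP[ae aA]; have [z vz va] := edge_at (vA a aA).
rewrite va !inE eq_sym (negPf vy) /=; apply: contraNneq ae => yz.
by apply/eqP/val_inj; rewrite /= ve va yz.
Qed.

Lemma card_star v A : #|star v A| <= rk K A.
Proof.
apply: rk_max; last by apply/subsetP => a; rewrite inE => /andP[].
by apply: (@star_forest v) => a; rewrite inE => /andP[].
Qed.

(** A basis of the remaining edges avoids [v], so [e] can be added to it. *)
Lemma rk_starD v e A : e \in A -> v \in val e -> rk K (A :\: star v A) < rk K A.
Proof.
move=> eA ve; have [I [iI IA <-]] := rk_basis K (A :\: star v A).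
have vI : {in I, forall a : edge, v \notin val a} by move=> a /(subsetP IA)/starD.
have eI : e \notin I by apply: contraL ve; apply: vI.
have := rk_max (pendant_forest iI vI ve : e |: I \in indep K).
rewrite cardsU1 eI; apply; rewrite subUset sub1set eA /=.
by apply: subset_trans IA _; apply: subsetDl.
Qed.

Lemma card_starD v A : #|A| = #|star v A| + #|A :\: star v A|.
Proof. by rewrite -(cardsID (star v A)) (setIidPr _) //; apply/subsetP => a; rewrite inE => /andP[]. Qed.

(* Deleting the [d <= rk A] edges of [A] at a vertex lowers the rank. *)
Lemma sparse_complete : sparse K.
Proof.
move=> A; have [n] := ubnP #|A|; elim: n A => // n IHn A ltAn.
have [->|[e eA]] := set_0Vmem A; first by rewrite cards0.
have [v [w [_ ve]]] := edgeE e.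
have vve : v \in val e by rewrite ve !inE eqxx.
have lt := rk_starD eA vve; have le := card_star v A.
have s0 : 0 < #|star v A| by apply/card_gt0P; exists e; rewrite inE eA.
rewrite (card_starD v) in ltAn *.
have /IHn le2 : #|A :\: star v A| < n by lia.
case: (rk K A) lt le => // h lt le; rewrite binS bin1 addnC leq_add //.
by apply: leq_trans le2 _; apply: leq_bin2l.
Qed.

(** The star of a vertex spans, since any other edge closes a triangle with two of its edges, and it
    has at most |V|-1 edges. Conversely sparsity does not allow C(|V|,2) edges in a smaller rank. *)
Lemma rank_complete : rank K = #|V|.-1.
Proof.
apply/eqP; rewrite eqn_leq; apply/andP; split; last first.
  have := sparse_complete setT; rewrite cardsT card_edge -/(rank K).
  case: #|V| => [//|[//|m]]; rewrite leqNgt; apply: contraNT; rewrite -ltnNge /= => lt.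
  apply: leq_ltn_trans (leq_bin2l 2 (lt : (rank K).+1 <= m.+1)) _.
  by rewrite [X in _ < X]binS bin1; lia.
have [V0|[v _]] := set_0Vmem [set: V].
  rewrite (leq_trans (rk_card K _)) // cardsT card_edge -cardsT V0 cards0 //.
pose S := star v setT.
have SP e : (e \in S) = (v \in val e) by rewrite !inE.
have -> : rank K = rk K S.
  apply/eqP; rewrite eqn_leq rk_le_rank andbT; apply: (@sub_cl_rk _ K setT).
  apply/subsetP => e _; have [vse|vse] := boolP (v \in val e).
    by apply: (subsetP (sub_cl _ _)); rewrite SP.
  have [x [y [xy ve]]] := edgeE e; rewrite ve !inE negb_or in vse.
  have /andP[vx vy] := vse.
  have [f1 v1] := edge_exists vx; have [f2 v2] := edge_exists vy.
  have sub : [set f1; f2] \subset S.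
    by rewrite subUset !sub1set !SP v1 v2 !inE eqxx.
  apply: (subsetP (clS K sub)).
  rewrite in_cl (leq_trans (_ : _ <= 2)) //.
    by rewrite setUC; apply: triangle_rk v1 v2 ve.
  rewrite (rk_pair sparse_complete) //; apply: contraNneq xy => f12.
  have : y \in [set v; x] by rewrite -v1 f12 v2 !inE eqxx orbT.
  by rewrite !inE eq_sym (negPf vy) /= eq_sym => ->.
apply: leq_trans (rk_card K S) _.
pose other e := odflt v [pick y in val e :\ v].
have otherP e : e \in S -> val e = [set v; other e] /\ other e != v.
  rewrite SP => /edge_at[y vy ve]; rewrite /other; case: pickP => [z|no] /=.
    by rewrite ve !inE => /andP[zv]; rewrite (negPf zv) /= => /eqP <-.
  by have := no y; rewrite ve !inE eqxx orbT eq_sym vy.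
rewrite -(card_in_imset (f := other)); last first.
  move=> e f eS fS ef; apply: val_inj; rewrite /=.
  by have [-> _] := otherP e eS; have [-> _] := otherP f fS; rewrite ef.
rewrite -[#|V|]cardsT (cardsD1 v [set: V]) inE /=; apply: subset_leq_card.
by apply/subsetP => y /imsetP[e /otherP[_ oe] ->]; rewrite !inE oe.
Qed.

Lemma star_uniq v w (e f : edge) : v != w -> v \in val e -> w \in val e ->
  v \in val f -> w \in val f -> e = f.
Proof.
move=> vw ve we vf wf; have wv : w != v by rewrite eq_sym.
have [y _ eE] := edge_at ve; have [z _ fE] := edge_at vf.
move: we wf; rewrite eE fE !inE (negPf wv) /= => /eqP wy /eqP wz.
by apply: val_inj; rewrite /= eE fE -wy -wz.
Qed.

(** By [rk_starD] and sparsity every vertex on an edge of [A] has degree at least 2, and [card_star]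
    bounds degrees by 3. Some vertex has degree 3; the three edges joining its neighbours lie in the
    closure, and if all were in [A] there would be six edges. *)
Lemma no5planes_complete : no5planes K.
Proof.
move=> A A5 r3.
have deg v e : e \in A -> v \in val e -> 2 <= #|star v A|.
  move=> eA ve; have := rk_starD eA ve; rewrite r3 ltnS => /(sparse_le sparse_complete).
  by have := card_starD v A; rewrite A5 (_ : 'C(3, 2) = 3) //; lia.
have [e0 e0A] : exists e, e \in A by apply/set0Pn; rewrite -card_gt0 A5.
have [v [w [vw ve0]]] := edgeE e0.
have [v0 w0] : v \in val e0 /\ w \in val e0 by rewrite ve0 !inE !eqxx orbT.
have [u c3|no] := pickP (fun u => 2 < #|star u A|); last first.
  have le2 u : #|star u A| <= 2 by rewrite leqNgt no.
  (* With all degrees at most 2, at least three edges avoid [v]. Deleting from them the star of [w]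
     leaves rank at most 1, so at most one edge, and that star contains at most one edge besides
     [e0]: two edges in all, a contradiction. *)
  pose A1 := A :\: star v A.
  have r1 : rk K A1 <= 2 by have := rk_starD e0A v0; rewrite r3.
  have c1 : 3 <= #|A1| by have := card_starD v A; have := le2 v; rewrite -/A1 A5; lia.
  have [f] : exists f, f \in star w A :\ e0.
    apply/set0Pn; rewrite -card_gt0; have := deg w e0 e0A w0.
    by rewrite (cardsD1 e0 (star w A)) [e0 \in star w A]inE e0A w0.
  rewrite !inE => /and3P[fe0 fA wf].
  have fA1 : f \in A1.
    rewrite !inE fA /= andbT; apply: contraNN fe0 => vf.
    by apply/eqP/(star_uniq vw).
  have r2 := rk_starD fA1 wf.
  have c2 : #|A1 :\: star w A1| <= 1.
    by apply: (@sparse_le _ _ sparse_complete _ 1); lia.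
  have : #|star w A1| <= #|star w A :\ e0|.
    apply: subset_leq_card; apply/subsetP => a; rewrite !inE.
    by case: eqVneq => [->|_] /=; rewrite ?v0 ?e0A //= => /andP[/andP[_ ->] ->].
  have := le2 w; rewrite (cardsD1 e0 (star w A)) [e0 \in star w A]inE e0A w0 add1n ltnS => l1 l2.
  by have := leq_add (leq_trans l2 l1) c2; rewrite -card_starD => /(leq_trans c1).
have cB : #|star u A| = 3 by apply/eqP; rewrite eqn_leq c3 -r3 card_star.
have [e1 [e2 [e3 [e12 e13 e23 BE]]]] := cards3P cB.
have [u1 u2 u3] : [/\ u \in val e1, u \in val e2 & u \in val e3].
  have sP e : e \in star u A -> u \in val e by rewrite inE => /andP[].
  by split; apply: sP; rewrite BE !inE eqxx ?orbT.
have [w1 uw1 v1] := edge_at u1; have [w2 uw2 v2] := edge_at u2.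
have [w3 uw3 v3] := edge_at u3.
have nw (e f : edge) x y : val e = [set u; x] -> val f = [set u; y] -> e != f -> x != y.
  by move=> ve vf; apply: contra_neq => xy; apply: val_inj; rewrite /= ve vf xy.
have w12 := nw _ _ _ _ v1 v2 e12; have w13 := nw _ _ _ _ v1 v3 e13.
have w23 := nw _ _ _ _ v2 v3 e23.
have [f1 vf1] := edge_exists w12; have [f2 vf2] := edge_exists w13.
have [f3 vf3] := edge_exists w23.
have BA : star u A \subset A by apply/subsetP => a; rewrite inE => /andP[].
have in_clB a b f x y : val a = [set u; x] -> val b = [set u; y] -> val f = [set x; y] ->
    u != x -> u != y -> x != y -> a != b -> a \in star u A -> b \in star u A -> f \in cl K A.
  move=> va vb vf ux uy xy ab aB bB; apply: (subsetP (clS K BA)).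
  have sub : [set a; b] \subset star u A by rewrite subUset !sub1set aB bB.
  apply: (subsetP (clS K sub)); rewrite in_cl (rk_pair sparse_complete) //.
  by rewrite setUC; apply: triangle_rk va vb vf.
have [g1 g2 g3] : [/\ f1 \in cl K A, f2 \in cl K A & f3 \in cl K A].
  split; [apply: (in_clB e1 e2 _ w1 w2)|apply: (in_clB e1 e3 _ w1 w3)|apply: (in_clB e2 e3 _ w2 w3)];
    by rewrite // BE !inE eqxx ?orbT.
have FB : [set f1; f2; f3] \subset cl K A by rewrite !subUset !sub1set g1 g2 g3.
have [FA|/subsetPn[f fF fA]] := boolP ([set f1; f2; f3] \subset A); last first.
  by exists f => //; apply: (subsetP FB).
have nval (e f : edge) x : x \in val e -> x \notin val f -> e != f.
  by move=> xe; apply: contraNneq => <-.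
have cF : #|[set f1; f2; f3]| = 3.
  rewrite cards3 //; [apply: (nval _ _ w2)|apply: (nval _ _ w1)|apply: (nval _ _ w1)];
    rewrite ?vf1 ?vf2 ?vf3 !inE ?eqxx ?orbT //; rewrite negb_or ?w12 ?w13 ?w23 //.
  by rewrite eq_sym w12.
have /subset_leq_card : [set f1; f2; f3] \subset A :\: star u A.
  rewrite subsetD FA /= disjoint_subset; apply/subsetP => f.
  rewrite !inE negb_and -orbA => /or3P[]/eqP->; rewrite ?vf1 ?vf2 ?vf3 !inE negb_or.
  - by rewrite uw1 uw2 orbT.
  - by rewrite uw1 uw3 orbT.
  by rewrite uw2 uw3 orbT.
have cD : #|A :\: star u A| = 2 by apply/eqP; rewrite -(eqn_add2l 3) -{1}cB -card_starD A5.
by rewrite cD cF.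
Qed.

(** Induction along a path: the chord [g u v] closes a triangle with the first edge [g u w] and the
    chord [g w v], which is already in the closure. *)
Lemma edge_connect_cl (E : finType) (M : matroid E) (g : V -> V -> E) (h : edge -> E) B u v :
  (forall u v, g u v = g v u) ->
  (forall u v w, u != v -> u != w -> v != w -> rk M [set g u v; g u w; g v w] <= 2) ->
  sparse M -> injective h -> (forall e u v, val e = [set u; v] -> h e = g u v) ->
  u != v -> connect (adj B) u v -> g u v \in cl M (h @: B).
Proof.
move=> gC g3 sM hI hE uv /connectP[p pP vE].
elim: p u uv pP vE => [|w p IHp] u uv /=; first by move=> _ vu; rewrite vu eqxx in uv.
move=> /andP[/adjP[e eB ve] wp] vE.
have guw : g u w \in h @: B by apply/imsetP; exists e => //; rewrite (hE e u w).
have [->|vw] := eqVneq v w; first exact: (subsetP (sub_cl M _)).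
have gwv : g w v \in cl M (h @: B) by apply: IHp => //; rewrite eq_sym.
have uw := edge_neq ve.
have [f vf] : exists f : edge, val f = [set w; v] by apply: edge_exists; rewrite eq_sym.
have sub : cl M [set g u w; g w v] \subset cl M (h @: B).
  by rewrite sub_clP // subUset !sub1set gwv (subsetP (sub_cl M _)).
apply: (subsetP sub); rewrite in_cl rk_pair //.
  apply: leq_trans (g3 u w v _ _ _) => //; last by rewrite eq_sym.
  by apply: rkS; rewrite !subUset !sub1set !inE !eqxx ?orbT.
rewrite -(hE e u w) // -(hE f w v) //; apply: contra_neq uv => /hI ef.
have : v \in [set u; w] by rewrite -ve ef vf !inE eqxx orbT.
by rewrite !inE (negPf vw) orbF => /eqP.
Qed.

(** Counting makes [g] a bijection [h] on edges. A forest extends to a spanning tree; its image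
    spans [M] by [edge_connect_cl] and has [rank M] elements, so it is independent. Conversely, if
    [B] is not a forest, some edge of [B] has its ends connected by a basis of [B], so the image of
    [B] is dependent. *)
Lemma recognition (E : finType) (M : matroid E) (g : V -> V -> E) :
  sparse M -> rank M = #|V|.-1 -> #|E| = 'C(#|V|, 2) ->
  (forall u v, g u v = g v u) ->
  (forall u v w, u != v -> u != w -> v != w -> rk M [set g u v; g u w; g v w] <= 2) ->
  (forall x : E, exists u v, u != v /\ g u v = x) ->
  isomorphic M K.
Proof.
move=> sM rM cE gC g3 gS.
have /fin_all_exists[h hE0] : forall e : edge, exists x : E, forall u v, val e = [set u; v] -> x = g u v.
  move=> e; have [x [y [xy ve]]] := edgeE e; exists (g x y) => u v; rewrite ve => xE.
  have : u \in [set x; y] by rewrite xE !inE eqxx.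
  have : v \in [set x; y] by rewrite xE !inE eqxx orbT.
  have := edge_neq (etrans ve xE).
  by rewrite !inE => uv /orP[]/eqP vE /orP[]/eqP uE; move: uv; rewrite uE vE ?eqxx // => _.
have hE e u v : val e = [set u; v] -> h e = g u v by exact: hE0.
have hS (x : E) : exists e, h e = x.
  have [u [v [/edge_exists[e ve] <-]]] := gS x; by exists e; exact: hE.
have hI : injective h.
  have hT : h @: setT = setT.
    by apply/setP => x; rewrite inE; have [e <-] := hS x; rewrite imset_f.
  have /imset_injP hI : #|h @: setT| == #|[set: edge]|.
    by rewrite hT !cardsT card_edge cE.
  by move=> e f; apply: hI; rewrite inE.
have hB : bijective h by apply: inj_card_bij; rewrite // card_edge cE.
have [f hK fK] := hB.
exists f; first by exists h.
move=> A; have <- : h @: (f @: A) = A.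
  by rewrite -imset_comp (eq_imset _ fK) imset_id.
rewrite -imset_comp (eq_imset _ hK) imset_id; move: (f @: A) => {A} B.
apply/idP/idP => [fB|iB].
  have [I [fI BI _ cI]] := rk_basis_ext fB (subsetT B).
  apply: indepS (imsetS h BI) _; rewrite indepE card_imset // cI -/(rank K).
  rewrite rank_complete -rM eqn_leq rk_le_rank; apply: (@sub_cl_rk _ M setT).
  apply/subsetP => x _; have [u [v [uv <-]]] := gS x.
  apply: (edge_connect_cl gC g3 sM hI hE uv).
  have [e ve] := edge_exists uv; have [eI|eI] := boolP (e \in I).
    by apply: connect1; apply/adjP; exists e.
  apply: nonforest_connect fI _ ve; apply/negP => feI.
  have := rk_max (feI : e |: I \in indep K) (subsetT _).
  by rewrite cardsU1 eI cI add1n ltnn.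
have [I [fI IB cI]] := rk_basis K B.
suff -> : B = I by [].
apply/eqP; rewrite eqEsubset IB andbT; apply/subsetP => e eB; apply: contraT => eI.
have [u [v [uv ve]]] := edgeE e.
have nf : e |: I \notin forests V.
  apply/negP => feI; have eIB : e |: I \subset B by rewrite subUset sub1set eB.
  by have := rk_max (feI : e |: I \in indep K) eIB; rewrite cardsU1 eI cI add1n ltnn.
have heI := edge_connect_cl gC g3 sM hI hE uv (nonforest_connect fI nf ve).
rewrite -(hE e) // in heI.
have iI : h @: I \in indep M by apply: indepS iB; apply: imsetS.
have := indepU1 (h e) iI; rewrite mem_imset // (negPf eI) heI /= => /negbT/negP; case.
by apply: indepS iB; rewrite subUset sub1set imset_f ?imsetS.
Qed.

(** Each vertex triple [W] gives the triangle [tau W], and [W] is recovered from it because each of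
    its vertices lies on one of those edges. *)
Lemma card_triples_complete : 'C(#|V|, 3) <= #|triples K|.
Proof.
pose tau (W : {set V}) := [set e : edge | val e \subset W].
rewrite -[#|V|]cardsT -cards_draws -(card_in_imset (f := tau)).
  apply: subset_leq_card; apply/subsetP => T /imsetP[W + ->].
  rewrite inE => /andP[_ /eqP cW]; rewrite inE card_edges cW eqxx /=.
  have [x [y [z [xy xz yz WE]]]] := cards3P cW.
  have [e1 v1] := edge_exists xy; have [e2 v2] := edge_exists xz.
  have [e3 v3] := edge_exists yz.
  apply: leq_trans (triangle_rk xy xz yz v1 v2 v3); apply: rkS.
  apply/subsetP => e; rewrite inE WE => eW; have [u [v [uv ve]]] := edgeE e.
  move: eW; rewrite ve subUset !sub1set !inE -!orbA.
  have eqe (f : edge) : (e == f) = (val e == val f) by [].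
  rewrite !eqe ve v1 v2 v3.
  by case/andP=> /or3P[]/eqP uE /or3P[]/eqP vE; move: uv; rewrite uE vE ?eqxx // => _;
    rewrite ?eqxx ?orbT // (setUC [set _]) ?eqxx ?orbT.
suff le (W W' : {set V}) : #|W| = 3 -> tau W = tau W' -> W \subset W'.
  move=> W W'; rewrite !inE => /andP[_ /eqP cW] /andP[_ /eqP cW'] tE.
  by apply/eqP; rewrite eqEsubset !le.
move=> cW tE; apply/subsetP => x xW.
have [y yW] : exists y, y \in W :\ x.
  by apply/set0Pn; rewrite -card_gt0; have := cardsD1 x W; rewrite xW cW; lia.
move: yW; rewrite !inE => /andP[yx yW]; have [e ve] := edge_exists yx.
have : e \in tau W by rewrite inE ve subUset !sub1set xW yW.
by rewrite tE inE ve subUset !sub1set => /andP[].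
Qed.

End CompleteGraph.

(** * The bounds on flats, and [M_K] from the number of triples *)

Section Characterization.
Variables (E : finType) (M : matroid E).
Hypothesis cardE : #|E| = 'C((rank M).+1, 2).
Implicit Types (A L : {set E}).

(** Equality gives every point 2(r-1) mates, so a frame at any point has r-1 elements and spans.
    [labelling] then provides the triangles for [recognition], with vertices renamed as ordinals. An
    empty ground set offers no starting point and is treated apart. *)
Lemma complete_of_triples : sparse M -> no5planes M ->
  #|triples M| = 'C((rank M).+1, 3) -> isomorphic M (M_K (rank M).+1).
Proof.
move=> sM pM tM; have [E0|[e _]] := set_0Vmem [set: E].
  have nE (x : E) : False by have := in_setT x; rewrite E0 inE.
  have r0 : rank M = 0 by rewrite /rank E0 rk0.
  have nK (x : complete_edge 'I_(rank M).+1) : False.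
    have : x \in [set: complete_edge 'I_(rank M).+1] by rewrite inE.
    suff -> : [set: complete_edge 'I_(rank M).+1] = set0 by rewrite inE.
    by apply/eqP; rewrite -cards_eq0 cardsT card_edge card_ord r0.
  exists (fun x => False_rect _ (nE x)); first by exists (fun x => False_rect _ (nK x)) => x; [case: (nE x)|case: (nK x)].
  move=> A; have -> : A = set0 by apply/setP => x; case: (nE x).
  by rewrite imset0 !indep0.
have r_gt0 : 0 < rank M.
  rewrite lt0n; apply/negP => /eqP r0; have : 0 < #|E| by apply/card_gt0P; exists e.
  by rewrite cardE r0.
have full := card_mates_eq sM pM cardE tM.
have [A [eA iA Am mA]] := frame_exists sM e.
have cA : #|A|.+1 = rank M.
  have := full e; rewrite (card_mates_e sM pM eA iA Am mA) => /eqP.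
  by rewrite eqn_mul2l /= => /eqP->; rewrite prednK.
have fullA x : #|mates M x| = 2 * #|A| by rewrite full -cA.
have spanA : cl M (e |: A) = setT by apply: cl_full; rewrite rk_indep // cardsU1 eA.
have [g [gC g3 gS]] := labelling sM pM eA iA Am mA spanA fullA.
set V := option (option {a | a \in A}) in g gC g3 gS.
have cV : #|{: V}| = (rank M).+1.
  by rewrite !card_option card_sig -cA; congr _.+2; apply: eq_card => x; rewrite inE.
pose phi (i : 'I_(rank M).+1) : V := enum_val (cast_ord (esym cV) i).
have phiI : injective phi by move=> i j /enum_val_inj/cast_ord_inj.
have phiS v : exists i, phi i = v.
  by exists (cast_ord cV (enum_rank v)); rewrite /phi cast_ordK enum_rankK.
apply: (@recognition _ E M (fun i j => g (phi i) (phi j)) sM); rewrite ?card_ord //.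
  by move=> u v w uv uw vw; apply: g3; rewrite (inj_eq phiI).
move=> x; have [u [v [uv <-]]] := gS x.
have [i iE] := phiS u; have [j jE] := phiS v; exists i, j; rewrite iE jE; split=> //.
by apply: contra_neq uv => ij; rewrite -iE -jE ij.
Qed.

Lemma flat_cl A : flat M (cl M A).
Proof.
apply/forallP => x; apply/implyP => xA; rewrite ltnNge -in_cl cl_id //.
Qed.

Lemma simple_indep A : simple M -> #|A| <= 2 -> A \in indep M.
Proof.
move=> sM A2; apply: contraT => /(minset_exists (P := fun B => B \notin indep M))[C cC CA].
have := sM C cC; rewrite ltnNge; case/negP.
by apply: leq_trans A2; apply: subset_leq_card.
Qed.

(** Passing to the closure keeps the rank and gives a flat, to which the hypotheses apply; ranks 0
    and 1 are settled by simplicity. *)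
Lemma sparse_of_flats : simple M ->
  (forall L, line M L -> #|L| \in [:: 2; 3]) ->
  (forall P : {set E}, plane M P -> #|P| \in [:: 3; 4; 6]) ->
  (forall (h : nat) (F : {set E}), 4 <= h <= rank M -> flat_of_rank M h F ->
     #|F| <= 'C(h.+1, 2)) -> sparse M.
Proof.
move=> sM lM pM hM A; apply: leq_trans (subset_leq_card (sub_cl M A)) _.
have fA h : rk M A = h -> flat_of_rank M h (cl M A).
  by move=> <-; rewrite /flat_of_rank flat_cl rk_cl eqxx.
have small k : k <= 2 -> rk M A < k -> #|cl M A| < k.
  move=> k2 rk_lt; rewrite ltnNge; apply/negP => /card_geqP[s [us ss sA]].
  have cB : #|[set x in s]| = k by rewrite cardsE (card_uniqP us).
  have BA : [set x in s] \subset cl M A by apply/subsetP => x; rewrite inE => /sA.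
  have iB : [set x in s] \in indep M by apply: simple_indep; rewrite ?cB.
  by have := rk_max iB BA; rewrite cB rk_cl leqNgt rk_lt.
case rA: (rk M A) => [|[|[|[|h]]]].
- by apply: (small 1); rewrite ?rA.
- by apply: (small 2); rewrite ?rA.
- by have := lM _ (fA _ rA); rewrite !inE => /orP[]/eqP->.
- by have := pM _ (fA _ rA); rewrite !inE => /or3P[]/eqP->.
by apply: hM (fA _ rA); rewrite -rA rk_le_rank rA.
Qed.

Lemma no5planes_of_planes :
  (forall P : {set E}, plane M P -> #|P| \in [:: 3; 4; 6]) -> no5planes M.
Proof.
move=> pM A A5 r3; have := pM (cl M A).
rewrite /plane /flat_of_rank flat_cl rk_cl r3 eqxx => /(_ isT) c346.
have [cA|/subsetPn[x xc xA]] := boolP (cl M A \subset A); last by exists x.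
have cE : cl M A = A by apply/eqP; rewrite eqEsubset cA sub_cl.
by rewrite cE A5 in c346.
Qed.

(** A triple of rank at most 2 has rank exactly 2 and is closed, as sparsity allows neither three
    points in rank 1 nor four in rank 2. *)
Lemma long_lines_triples : sparse M ->
  [set L : {set E} | line M L & #|L| == 3] = triples M.
Proof.
move=> sM; apply/setP => L; rewrite !inE andbC; case: eqP => //= cL.
rewrite /line /flat_of_rank; apply/andP/idP => [[_ /eqP->]//|r2].
have rL : rk M L = 2.
  apply/eqP; rewrite eqn_leq r2 ltnNge; apply/negP => /(sparse_le sM).
  by rewrite cL.
split; last by rewrite rL.
apply/forallP => x; apply/implyP => xL; rewrite ltnNge rL; apply/negP => /(sparse_le sM).
by rewrite cardsU1 xL cL.
Qed.

End Characterization.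

Section Isomorphism.
Variables (E E' : finType) (M : matroid E) (M' : matroid E').

Lemma isomorphic_sym : isomorphic M M' -> isomorphic M' M.
Proof.
move=> [f [g gK fK] fM]; exists g; first by exists f.
by move=> A; rewrite -fM -imset_comp (eq_imset _ fK) imset_id.
Qed.

Lemma isomorphic_trans (E'' : finType) (M'' : matroid E'') :
  isomorphic M M' -> isomorphic M' M'' -> isomorphic M M''.
Proof.
move=> [f bf fM] [g bg gM]; exists (g \o f); first exact: bij_comp.
by move=> A; rewrite imset_comp gM fM.
Qed.

Lemma isomorphic_rk (f : E -> E') : bijective f ->
  (forall A : {set E}, (f @: A \in indep M') = (A \in indep M)) ->
  forall A : {set E}, rk M' (f @: A) = rk M A.
Proof.
move=> [g gK fK] fM A; have fI := can_inj gK; apply/eqP; rewrite eqn_leq; apply/andP; split.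
  have [I [iI IA <-]] := rk_basis M' (f @: A).
  have IE : I = f @: (g @: I) by rewrite -imset_comp (eq_imset _ fK) imset_id.
  rewrite IE card_imset //; apply: rk_max; first by rewrite -fM -IE.
  have -> : A = g @: (f @: A) by rewrite -imset_comp (eq_imset _ gK) imset_id.
  exact: imsetS.
have [I [iI IA <-]] := rk_basis M A.
by rewrite -(card_imset _ fI); apply: rk_max; rewrite ?fM ?imsetS.
Qed.

Lemma isomorphic_rank : isomorphic M M' -> rank M = rank M'.
Proof.
move=> [f bf fM]; rewrite /rank -(isomorphic_rk bf fM); congr (rk M' _).
apply/setP => y; rewrite !inE; have [g _ fK] := bf.
by apply/imsetP; exists (g y).
Qed.

End Isomorphism.

(** * Sets of small rank *)

(** Counts with a lower bound on the rank are the ones to which the Euler characteristic argument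
    applies; the sets of low rank are counted as differences of these. *)
Definition rank_count (E : finType) (M : matroid E) (k s : nat) : nat :=
  #|[set A : {set E} | (#|A| == s) && (k <= rk M A)]|.

Section LowSets.
Variables (E : finType) (M : matroid E).
Implicit Types (A B : {set E}).

Definition low_sets h s : {set {set E}} := [set A : {set E} | (#|A| == s) && (rk M A <= h)].

Lemma low_setsE h s : #|low_sets h s| = rank_count M 0 s - rank_count M h.+1 s.
Proof.
have -> : low_sets h s = [set A : {set E} | (#|A| == s) && (0 <= rk M A)] :\:
    [set A : {set E} | (#|A| == s) && (h < rk M A)].
  apply/setP => A; rewrite !inE; case: (_ == _) => //=; by rewrite andbT -leqNgt.
rewrite cardsD (setIidPr _) //; apply/subsetP => A; rewrite !inE => /andP[->//].
Qed.

Lemma rank_count_le k s : rank_count M k s <= rank_count M 0 s.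
Proof.
by apply: subset_leq_card; apply/subsetP => A; rewrite !inE => /andP[->//].
Qed.

Lemma low_sets_sparse h s : sparse M -> 'C(h.+1, 2) < s -> low_sets h s = set0.
Proof.
move=> sM hs; apply/setP => A; rewrite !inE; apply/negP => /andP[/eqP cA /(sparse_le sM)].
by rewrite leqNgt cA hs.
Qed.

(** A set violating sparsity has a subset one element above the bound. The hypothesis starts at rank
    1; a loop is caught by pairing it with any other element, which gives two elements of rank at
    most 1. *)
Lemma sparse_low_sets : #|E| = 'C((rank M).+1, 2) ->
  (forall h, h < rank M -> low_sets h.+1 'C(h.+2, 2).+1 = set0) -> sparse M.
Proof.
move=> cE low0 A; rewrite leqNgt; apply/negP => /card_geqP[s [us ss sA]].
have BA : [set x in s] \subset A by apply/subsetP => x; rewrite inE => /sA.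
have cB : #|[set x in s]| = 'C((rk M A).+1, 2).+1 by rewrite cardsE (card_uniqP us).
have rB := rkS M BA; have rA := rk_le_rank M A.
case rAE: (rk M A) => [|h] in cB rB rA.
  have /cards1P[x xE] : #|[set x in s]| == 1 by rewrite cB.
  rewrite xE leqn0 in rB.
  have [/set0Pn[y]|] := boolP ([set: E] :\ x != set0).
    rewrite !inE andbT => yx.
    have r1 : 0 < rank M.
      rewrite lt0n; apply/negP => /eqP r0; have := cE; rewrite r0 => /eqP.
      by rewrite -cardsT cards_eq0 => /eqP/setP/(_ x); rewrite !inE.
    have := low0 0 r1 => /setP/(_ (y |: [set x])).
    rewrite !inE cards2 yx eqxx /=; have := rkU1 M y [set x]; rewrite (eqP rB) => ->.
    by [].
  rewrite negbK setD_eq0 subTset => /eqP Ex.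
  have := cE; rewrite -cardsT -Ex cards1 /rank -Ex (eqP rB) //.
have := low0 h rA => /setP/(_ [set x in s]); rewrite !inE cB eqxx rB //.
Qed.

Lemma card_subsets_of_card (B : {set E}) s :
  #|[set A : {set E} | (A \subset B) && (#|A| == s)]| = 'C(#|B|, s).
Proof. by rewrite -cards_draws; apply: eq_card => A; rewrite !inE. Qed.

(** Count pairs of a five-set inside a six-set, both of rank at most 3. A six-set contains six
    five-sets, and a five-set lies in at most one six-set because its closure has at most six
    elements. Equality means that every five-set extends. *)
Lemma low_sets_planes : sparse M ->
  6 * #|low_sets 3 6| <= #|low_sets 3 5| /\
  (6 * #|low_sets 3 6| = #|low_sets 3 5| <-> no5planes M).
Proof.
move=> sM.
have r3 A : A \in low_sets 3 5 -> #|A| = 5 /\ rk M A = 3.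
  rewrite inE => /andP[/eqP cA le3]; split=> //; apply/eqP.
  rewrite eqn_leq le3 ltnNge; apply/negP => /(sparse_le sM).
  by rewrite cA.
pose ext A := [set B in low_sets 3 6 | A \subset B].
have ext1 A : A \in low_sets 3 5 -> #|ext A| <= 1.
  move=> /r3[cA rA]; apply/card_le1_eqP => B B'.
  rewrite !inE => /andP[/andP[/eqP cB rB] AB] /andP[/andP[/eqP cB' rB'] AB'].
  have BU : B :|: B' \subset cl M A.
    by rewrite -rA in rB rB'; rewrite subUset (cl_rk AB rB) (cl_rk AB' rB').
  have := subset_leq_card BU => /leq_trans/(_ (sM (cl M A))).
  rewrite rk_cl rA => c6.
  have eqU (C : {set E}) : #|C| = 6 -> C \subset B :|: B' -> C = B :|: B'.
    by move=> cC CU; apply/eqP; rewrite eqEcard CU cC.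
  by rewrite (eqU B) ?subsetUl // -(eqU B') ?subsetUr.
have sumE : 6 * #|low_sets 3 6| = \sum_(A in low_sets 3 5) #|ext A|.
  rewrite mulnC -sum_nat_const.
  rewrite (eq_bigr (fun B => \sum_(A in low_sets 3 5) (A \subset B))); last first.
    move=> B; rewrite inE => /andP[/eqP cB rB].
    rewrite -[LHS]/'C(6, 5) -cB -card_subsets_of_card -sum1_card big_mkcond [RHS]big_mkcond.
    apply: eq_bigr => A _; rewrite !inE andbC; case: (_ == _) => //=.
    have [AB|] := boolP (A \subset B); last by case: ifP.
    by rewrite (leq_trans (rkS M AB) rB).
  rewrite exchange_big /=; apply: eq_bigr => A _.
  rewrite -sum1_card big_mkcond [RHS]big_mkcond; apply: eq_bigr => B _.
  by rewrite !inE; case: (_ && _).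
have := leqif_sum (fun A (AL : A \in low_sets 3 5) => leqif_eq (ext1 A AL)).
rewrite -sumE sum1_card => -[le eqE]; split=> //; split.
  move=> /eqP; rewrite eqE => /forallP h A cA rA.
  have AL : A \in low_sets 3 5 by rewrite inE cA rA eqxx.
  have := h A; rewrite AL => /cards1P[B] /setP/(_ B); rewrite !inE eqxx.
  move=> /andP[/andP[/eqP cB rB] AB].
  have /subsetPn[x xB xA] : ~~ (B \subset A).
    by apply/negP => /subset_leq_card; rewrite cA cB.
  by exists x => //; have := @cl_rk _ M _ _ AB; rewrite rA => /(_ rB)/subsetP/(_ x xB).
move=> pM; apply/eqP; rewrite eqE; apply/forallP => A; apply/implyP => AL.
rewrite eqn_leq ext1 //=; have [cA rA] := r3 A AL.
have [x xA xc] := pM A cA rA; apply/card_gt0P; exists (x |: A).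
by rewrite !inE cardsU1 xA cA eqxx subsetUr andbT -rA -in_cl.
Qed.

End LowSets.

Lemma low_sets_iso (E E' : finType) (M : matroid E) (M' : matroid E') h s :
  isomorphic M M' -> #|low_sets M h s| = #|low_sets M' h s|.
Proof.
move=> [f bf fM]; have fI := bij_inj bf; have [g gK fK] := bf.
have im_inj : injective (fun A : {set E} => f @: A) by apply: imset_inj.
rewrite -(card_imset _ im_inj); apply: eq_card => B; rewrite inE.
have BE : B = f @: (g @: B) by rewrite -imset_comp (eq_imset _ fK) imset_id.
rewrite [in RHS]BE card_imset // (isomorphic_rk bf fM).
apply/imsetP/idP => [[A + AE]|BL].
  by rewrite inE AE -imset_comp (eq_imset _ gK) imset_id.
by exists (g @: B); rewrite ?inE.
Qed.

(** * Matroid base polytopes *)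

Local Open Scope ring_scope.

Section ConvexHull.
Variables (R : realType) (n : nat) (S : 'rV[R]_n -> Prop).

Lemma conv_hull1 x : S x -> conv_hull S x.
Proof.
move=> Sx; exists 1%N, (fun=> x), (fun=> 1); split=> //.
  by rewrite big_ord1.
by rewrite big_ord1 scale1r.
Qed.

Lemma conv_hull_convex x y (t : R) : 0 <= t <= 1 ->
  conv_hull S x -> conv_hull S y -> conv_hull S (t *: x + (1 - t) *: y).
Proof.
move=> /andP[t0 t1] [k [v [a [vS a0 a1 ->]]]] [l [w [b [wS b0 b1 ->]]]].
exists (k + l)%N, (fun i => match split i with inl j => v j | inr j => w j end).
exists (fun i => match split i with inl j => t * a j | inr j => (1 - t) * b j end).
have sl i : split (lshift l i) = inl i by exact: (unsplitK (inl i)).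
have sr i : split (rshift k i) = inr i by exact: (unsplitK (inr i)).
split.
- by move=> i; case: (split i).
- by move=> i; case: (split i) => j; rewrite mulr_ge0 // subr_ge0.
- rewrite big_split_ord /= -[RHS](subrK t) addrC; congr (_ + _).
    under eq_bigr do rewrite sr.
    by rewrite -mulr_sumr b1 mulr1.
  under eq_bigr do rewrite sl.
  by rewrite -mulr_sumr a1 mulr1.
rewrite big_split_ord /= !scaler_sumr; congr (_ + _); apply: eq_bigr => i _.
  by rewrite sl scalerA.
by rewrite sr scalerA.
Qed.

End ConvexHull.

Section Weight.
Variables (R : realType) (n : nat).
Implicit Types (x y : 'rV[R]_n) (A B : {set 'I_n}).

Definition weight x A : R := \sum_(i in A) x 0 i.

Lemma weightUI x A B : weight x (A :|: B) + weight x (A :&: B) = weight x A + weight x B.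
Proof.
have w C : weight x C = \sum_i (i \in C)%:R * x 0 i.
  by rewrite /weight big_mkcond; apply: eq_bigr => i _; case: (_ \in _); rewrite ?mul1r ?mul0r.
rewrite !w -!big_split /=; apply: eq_bigr => i _; rewrite !inE.
by case: (i \in A); case: (i \in B) => /=; ring.
Qed.

Lemma weight_linear k (v : 'I_k -> 'rV[R]_n) (a : 'I_k -> R) A :
  weight (\sum_i a i *: v i) A = \sum_i a i * weight (v i) A.
Proof.
rewrite /weight; under [RHS]eq_bigr do rewrite mulr_sumr.
rewrite exchange_big /=; apply: eq_bigr => i _; rewrite summxE.
by apply: eq_bigr => j _; rewrite mxE.
Qed.

Lemma weight_set1 x i : weight x [set i] = x 0 i.
Proof. by rewrite /weight big_set1. Qed.

Lemma weight_indic A B : weight (\row_i (i \in B)%:R) A = #|B :&: A|%:R.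
Proof.
rewrite /weight -sum1_card natr_sum big_mkcond [RHS]big_mkcond /=.
by apply: eq_bigr => i _; rewrite mxE inE; case: (i \in A); case: (i \in B).
Qed.

Lemma weight_shift x i j t A : weight (x + t *: (delta_mx 0 i - delta_mx 0 j)) A =
  weight x A + t * ((i \in A)%:R - (j \in A)%:R).
Proof.
have wd k : \sum_(l in A) (delta_mx 0 k : 'rV[R]_n) 0 l = (k \in A)%:R.
  rewrite big_mkcond (bigD1 k) //= big1 ?addr0; first by rewrite mxE !eqxx; case: ifP.
  by move=> l lk; rewrite mxE (negPf lk) andbF if_same.
rewrite /weight -!wd mulrBr !mulr_sumr -sumrB -big_split; apply: eq_bigr => l _.
by rewrite !mxE mulrBr.
Qed.

End Weight.

(** * Edmonds' inequalities for the base polytope *)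

Section Edmonds.
Variables (R : realType) (n : nat) (M : matroid 'I_n).
Implicit Types (x y : 'rV[R]_n) (A B : {set 'I_n}).
Local Notation rk := (rk M).

Definition in_polytope x : Prop := [/\ forall i, 0 <= x 0 i,
  forall A, weight x A <= (rk A)%:R & weight x setT = (rank M)%:R].

Lemma baseP B : base M B <-> B \in indep M /\ #|B| = rank M.
Proof.
split=> [/maxsetP[iB mB]|[iB cB]].
  split=> //; have [I [iI BI _ cI]] := rk_basis_ext iB (subsetT B).
  by rewrite -(mB I iI BI); exact: cI.
apply/maxsetP; split=> // I iI BI; apply/esym/eqP; rewrite eqEcard BI cB.
by rewrite rk_max.
Qed.

Lemma base_polytope_sub x : base_polytope M x -> in_polytope x.
Proof.
move=> [k [v [a [vS a0 a1 ->]]]].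
have vP i : exists2 B, base M B & v i = \row_l (l \in B)%:R.
  by have [B bB <-] := vS i; exists B.
split=> [l|A|].
- rewrite summxE sumr_ge0 // => i _; have [B _ ->] := vP i.
  by rewrite !mxE mulr_ge0.
- rewrite weight_linear -[leRHS]mul1r -[X in _ <= X * _]a1 mulr_suml ler_sum // => i _.
  apply: ler_wpM2l => //; have [B /baseP[iB _] ->] := vP i.
  rewrite weight_indic ler_nat rk_max ?subsetIr // (indepS _ iB) ?subsetIl //.
rewrite weight_linear -[RHS]mul1r -[X in _ = X * _]a1 mulr_suml; apply: eq_bigr => i _.
by have [B /baseP[_ cB] ->] := vP i; rewrite weight_indic setIT cB.
Qed.

(** The induction measure for [base_polytopeP]: an exchange step makes a further rank inequality
    tight or a further coordinate zero. *)
Definition slack x := addn #|[set A | weight x A < (rk A)%:R]| #|[set i | 0 < x 0 i]|.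

(** Tight sets contain both or neither of [i] and [j], so they stay tight when weight moves from [j]
    to [i]. The largest possible step ends when a set containing [i] but not [j] becomes tight or
    the coordinate [j] vanishes. *)
Lemma exchange_step x i j : in_polytope x -> i != j -> 0 < x 0 i -> 0 < x 0 j ->
  (forall A, weight x A = (rk A)%:R -> (i \in A) = (j \in A)) ->
  exists t : R, let y := x + t *: (delta_mx 0 i - delta_mx 0 j) in
    [/\ 0 < t, in_polytope y & (slack y < slack x)%N].
Proof.
move=> [x0 xA xT] ij xi xj tight.
(* [None] stands for the limit set by coordinate [j], [Some A] for the limit set by the inequality
   of [A]. *)
pose F (o : option {set 'I_n}) := if o is Some A then (rk A)%:R - weight x A else x 0 j.
pose P (o : option {set 'I_n}) := if o is Some A then (i \in A) && (j \notin A) else true.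
case: (Order.TotalTheory.arg_minP (i0 := None) (P := P) F isT) => o Po minF.
exists (F o) => y.
have strict A : i \in A -> j \notin A -> weight x A < (rk A)%:R.
  move=> iA jA; rewrite lt_neqAle xA andbT; apply/negP => /eqP /tight.
  by rewrite iA (negPf jA).
have t0 : 0 < F o.
  by case: (o) Po => [A /andP[iA jA]|//] /=; rewrite subr_gt0 strict.
have wy A : weight y A = weight x A + F o * ((i \in A)%:R - (j \in A)%:R).
  exact: weight_shift.
have yE k : y 0 k = x 0 k + F o * ((k == i)%:R - (k == j)%:R).
  by rewrite -!weight_set1 wy !inE ![_ == k]eq_sym.
have tj : F o <= x 0 j by exact: (minF None).
have leA A : weight y A <= (rk A)%:R.
  rewrite wy; case iA: (i \in A); case jA: (j \in A) => /=; rewrite ?subrr ?mulr0 ?addr0 //.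
    rewrite subr0 mulr1 -lerBrDl; apply: (minF (Some A)); by rewrite /P iA jA.
  by rewrite sub0r mulrN1 (le_trans _ (xA A)) // gerBl ltW.
split=> //.
- split=> //.
    move=> k; rewrite yE; have [->|ki] := eqVneq k i.
      by rewrite (negPf ij) subr0 mulr1 addr_ge0 // ltW.
    by case: eqVneq => [->|_]; rewrite ?subrr ?mulr0 ?addr0 // sub0r mulrN1 subr_ge0.
  by rewrite wy !inE subrr mulr0 addr0.
have s1 : [set A | weight y A < (rk A)%:R] \subset [set A | weight x A < (rk A)%:R].
  apply/subsetP => A; rewrite !inE => yA; rewrite lt_neqAle xA andbT.
  by apply: contraTneq yA => tA; rewrite wy (tight _ tA) subrr mulr0 addr0 tA ltxx.
have s2 : [set k | 0 < y 0 k] \subset [set k | 0 < x 0 k].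
  apply/subsetP => k; rewrite !inE yE; have [->//|ki] := eqVneq k i.
  by have [->//|kj] := eqVneq k j; rewrite subrr mulr0 addr0.
have [l1 l2] := (subset_leq_card s1, subset_leq_card s2).
move: wy yE; rewrite /slack; case: (o) Po => [A /andP[iA jA]|_] wy yE.
  rewrite -addSn leq_add // proper_card // properE s1; apply/subsetPn.
  exists A; rewrite !inE ?strict // wy iA (negPf jA) subr0 mulr1 /= addrC subrK.
  by rewrite ltxx.
rewrite -addnS leq_add // proper_card // properE s2; apply/subsetPn.
exists j; rewrite !inE // yE eq_sym (negPf ij) eqxx sub0r mulrN1 subrr.
by rewrite ltxx.
Qed.

(** By submodularity tight sets are closed under intersection. So a minimal tight set among those
    with a fractional coordinate lies inside every tight set that meets it in a fractional
    coordinate. *)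
Lemma minimal_tight x i : in_polytope x -> 0 < x 0 i < 1 ->
  exists A k, [/\ weight x A = (rk A)%:R, k \in A, 0 < x 0 k < 1 &
    forall l B, l \in A -> 0 < x 0 l < 1 -> weight x B = (rk B)%:R -> l \in B -> A \subset B].
Proof.
move=> [x0 xA xT] xi.
pose P A := (weight x A == (rk A)%:R) && [exists k in A, 0 < x 0 k < 1].
have PT : P setT by rewrite /P xT eqxx; apply/exists_inP; exists i; rewrite ?inE.
have [A /minsetP[/andP[/eqP tA /exists_inP[k kA xk]] minA] _] := minset_exists PT.
exists A, k; split=> // l B lA xl tB lB.
suff PAB : P (A :&: B) by rewrite -(minA _ PAB (subsetIl _ _)) subsetIr.
rewrite /P; apply/andP; split; last by apply/exists_inP; exists l; rewrite // inE lA.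
have := weightUI x A B; rewrite tA tB; have := xA (A :|: B); have := xA (A :&: B).
have : (rk (A :|: B) + rk (A :&: B))%:R <= (rk A + rk B)%:R :> R by rewrite ler_nat rk_submod.
rewrite !natrD; lra.
Qed.

Lemma polytope_le1 x i : in_polytope x -> x 0 i <= 1.
Proof.
move=> [_ xA _]; rewrite -weight_set1 (le_trans (xA _)) //.
by rewrite -[1]/(1%:R) ler_nat (leq_trans (rk_card M _)) ?cards1.
Qed.

(** A tight set has integral weight, so it cannot contain exactly one fractional coordinate. *)
Lemma fractional_partner x A k : in_polytope x -> weight x A = (rk A)%:R -> k \in A ->
  0 < x 0 k < 1 -> exists2 l, l \in A :\ k & 0 < x 0 l < 1.
Proof.
move=> xP tA kA /andP[xk0 xk1]; apply/exists_inP; apply: contraT => /exists_inPn no.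
have frac l : l \in A :\ k -> x 0 l = (x 0 l == 1)%:R.
  move=> /no; rewrite negb_and -!leNgt => lx; case: xP (polytope_le1 l xP) => x0 _ _ l1.
  have := x0 l; case: eqP lx => //= ne /orP[]; lra.
move: tA; rewrite /weight (big_setD1 k) //= (eq_bigr _ frac) -natr_sum.
set m := (\sum_(_ in _) _)%N => tA.
have : (m < rk A)%N by rewrite -(ltr_nat R) -tA; lra.
have : (rk A < m.+1)%N by rewrite -(ltr_nat R) -tA -natr1; lra.
lia.
Qed.

(** Two fractional coordinates of a minimal tight set lie in the same tight sets, so [x] is between
    two points of smaller slack obtained by moving in opposite directions. Without fractional
    coordinates [x] is the indicator of a base. *)
Lemma base_polytopeP x : base_polytope M x <-> in_polytope x.
Proof.
split; first exact: base_polytope_sub.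
have [m] := ubnP (slack x); elim: m x => // m IHm x ltx xP.
have [x0 xA xT] := xP.
have [/existsP[i xi]|/existsPn no] := boolP [exists i, 0 < x 0 i < 1].
  have [A [k [tA kA xk minA]]] := minimal_tight xP xi.
  have [l] := fractional_partner xP tA kA xk; rewrite !inE => /andP[lk lA] xl.
  have same B : weight x B = (rk B)%:R -> (k \in B) = (l \in B).
    move=> tB; apply/idP/idP => H; first exact: (subsetP (minA _ _ kA xk tB H)).
    exact: (subsetP (minA _ _ lA xl tB H)).
  have [xk0 _] := andP xk; have [xl0 _] := andP xl.
  have kl : k != l by rewrite eq_sym.
  have [t [t0 yP lty]] := exchange_step xP kl xk0 xl0 same.
  have [s [s0 zP ltz]] := exchange_step xP lk xl0 xk0 (fun B tB => esym (same B tB)).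
  set y := x + _ in yP lty; set z := x + _ in zP ltz.
  have yC := IHm y (leq_trans lty ltx) yP; have zC := IHm z (leq_trans ltz ltx) zP.
  have st0 : 0 < s + t by exact: addr_gt0.
  (* The displacements of [y] and [z] are [t] and [- s] times one vector, so weights proportional to
     [s] and [t] cancel them. *)
  have -> : x = (s / (s + t)) *: y + (1 - s / (s + t)) *: z.
    by apply/rowP => j; rewrite !mxE; field; rewrite lt0r_neq0.
  apply: conv_hull_convex => //.
  by apply/andP; split; [rewrite divr_ge0 ?ltW|rewrite ler_pdivrMr // mul1r lerDl ltW].
have x01 i : x 0 i = (x 0 i == 1)%:R.
  have := no i; rewrite negb_and -!leNgt; have := polytope_le1 i xP; have := x0 i.
  by case: eqP => //= ne; lra.
apply: conv_hull1; exists [set i | x 0 i == 1]; last first.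
  by apply/rowP => i; rewrite mxE inE -x01.
have xE : x = \row_i (i \in [set i | x 0 i == 1])%:R.
  by apply/rowP => i; rewrite mxE inE -x01.
set B := [set i | _] in xE *.
have cB : #|B| = rank M.
  by apply/eqP; rewrite -(eqr_nat R) -xT xE weight_indic setIT.
apply/baseP; split=> //; rewrite indepE eqn_leq rk_card /= -(ler_nat R).
by have := xA B; rewrite {1}xE weight_indic setIid.
Qed.

End Edmonds.

(** * Decomposition into nested matroids *)

Section Chains.
Variable E : finType.
Implicit Types (A B I J V : {set E}) (C D T : {set {set E}}).

Definition is_chain C : bool :=
  [forall A in C, forall B in C, (A \subset B) || (B \subset A)].

Lemma chainP C :
  reflect {in C &, forall A B, (A \subset B) || (B \subset A)} (is_chain C).
Proof.
apply: (iffP forall_inP) => [h A B AC BC|h A AC].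
  exact: (forall_inP (h A AC)).
by apply/forall_inP => B BC; apply: h.
Qed.

Lemma chainS C D : C \subset D -> is_chain D -> is_chain C.
Proof.
move=> CD /chainP h; apply/chainP => A B AC BC.
by apply: h; apply: (subsetP CD).
Qed.

Lemma chainU1 C A : is_chain C -> {in C, forall B, (A \subset B) || (B \subset A)} ->
  is_chain (A |: C).
Proof.
move=> /chainP h hA; apply/chainP => X Y.
rewrite !inE => /orP[/eqP->|XC] /orP[/eqP->|YC]; rewrite ?subxx //.
- exact: hA.
- by rewrite orbC hA.
exact: h.
Qed.

Lemma chain_cover C : is_chain C -> C != set0 -> cover C \in C.
Proof.
move=> /chainP h /set0Pn[A0 A0C].
case: (arg_maxnP (fun A : {set E} => #|A|) A0C) => A AC maxA.
suff -> : cover C = A by [].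
apply/eqP; rewrite eqEsubset [A \subset _]bigcup_sup // andbT.
apply/bigcupsP => B BC; have /orP[//|AB] := h B A BC AC.
by rewrite (_ : A = B) //; apply/eqP; rewrite eqEcard AB; exact: maxA.
Qed.

Lemma chain_bigcap C : is_chain C -> C != set0 -> \bigcap_(A in C) A \in C.
Proof.
move=> /chainP h /set0Pn[A0 A0C].
case: (arg_minnP (fun A : {set E} => #|A|) A0C) => A AC minA.
suff -> : \bigcap_(B in C) B = A by [].
apply/eqP; rewrite eqEsubset [X in X && _]bigcap_inf //=.
apply/bigcapsP => B BC; have /orP[//|BA] := h A B AC BC.
by rewrite (_ : B = A) //; apply/eqP; rewrite eqEcard BA; exact: minA.
Qed.

End Chains.

Section ChainEuler.
Variables (E : finType) (R : numDomainType).
Implicit Types (A B : {set E}) (D V : {set {set E}}).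

Lemma sum_chains_set0 : \sum_(D : {set {set E}} | is_chain D && (D \subset set0)) (-1) ^+ #|D| = 1 :> R.
Proof.
rewrite (bigD1 set0) /=; last first.
  by rewrite sub0set andbT; apply/chainP => A B; rewrite inE.
rewrite cards0 expr0 big1 ?addr0 // => D /andP[/andP[_]].
by rewrite subset0 => /eqP->; rewrite eqxx.
Qed.

(* [A |-> A :&: A0] contracts the poset [V]: toggling in a chain [D] the
   intersection of [A0] with the smallest member of [D] not below [A0] is a
   sign-reversing involution. *)
Lemma sum_chains_contractible V A0 : A0 \in V -> {in V, forall A, A :&: A0 \in V} ->
  \sum_(D : {set {set E}} | is_chain D && (D \subset V)) (-1) ^+ #|D| = 0 :> R.
Proof.
move=> A0V capV.
pose up D := [set A in D | ~~ (A \subset A0)].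
pose t D := \bigcap_(A in up D) A :&: A0.
pose tau D := if t D \in D then D :\ t D else t D |: D.
have tA0 D : t D \subset A0 by apply: subsetIr.
have t_eq D D' : up D = up D' -> t D = t D' by rewrite /t => ->.
have tt D : t (tau D) = t D.
  apply: t_eq; apply/setP => A; rewrite !inE /tau.
  have [->|At] := eqVneq A (t D); first by rewrite tA0 !andbF.
  by case: ifP => _; rewrite !inE (negPf At).
have tauK : involutive tau.
  move=> D; rewrite {1}/tau tt; have [tD|tD] := boolP (t D \in D).
    have -> : tau D = D :\ t D by rewrite /tau tD.
    by rewrite !inE eqxx /= setD1K.
  have -> : tau D = t D |: D by rewrite /tau (negPf tD).
  by rewrite setU11 setU1K.
have PtauW D : is_chain D && (D \subset V) -> is_chain (tau D) && (tau D \subset V).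
  move=> /andP[cD DV]; rewrite /tau; case: ifP => tD.
    by rewrite (chainS (subD1set _ _) cD) (subset_trans (subD1set _ _) DV).
  apply/andP; split.
    apply: chainU1 => // B BD; have [BA|BA] := boolP (B \subset A0); last first.
      by rewrite (subset_trans (subsetIl _ _)) // bigcap_inf // inE BD.
    apply/orP; right; rewrite subsetI BA andbT; apply/bigcapsP => A.
    rewrite inE => /andP[AD nA]; have /orP[//|AB] := chainP _ cD B A BD AD.
    by rewrite (subset_trans AB BA) in nA.
  rewrite subUset sub1set DV andbT /t.
  have [->|up0] := eqVneq (up D) set0; first by rewrite big_set0 setTI.
  apply: capV; apply: (subsetP DV).
  have sup : up D \subset D by apply/subsetP => A; rewrite inE => /andP[].
  exact: (subsetP sup) (chain_bigcap (chainS sup cD) up0).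
have Ptau D : is_chain (tau D) && (tau D \subset V) = is_chain D && (D \subset V).
  by apply/idP/idP => /PtauW //; rewrite tauK.
set S := \sum_(D | _) _; suff : S = - S.
  by move/eqP; rewrite -subr_eq0 opprK -mulr2n mulrn_eq0 /= => /eqP.
rewrite {1}/S (reindex_inj (inv_inj tauK)) (eq_bigl _ _ Ptau) /= -sumrN.
apply: eq_bigr => D _; rewrite /tau; case: ifP => tD.
  by rewrite [in RHS](cardsD1 (t D)) tD exprS mulN1r opprK.
by rewrite cardsU1 tD exprS mulN1r.
Qed.

End ChainEuler.

Lemma setD_subset (T : finType) (A B D : {set T}) :
  A :\: D \subset B -> A :\: D \subset B :\: D.
Proof.
move=> /subsetP AB; apply/subsetP => x xA; rewrite inE AB // andbT.
by move: xA; rewrite inE => /andP[].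
Qed.

(** * Nested matroids defined by bounds along a chain *)

Section ChainMatroid.
Variables (E : finType) (C : {set {set E}}) (c : {set E} -> nat).
Hypothesis chainC : is_chain C.
Implicit Types (A B D G I J : {set E}).

Definition chain_indep : {set {set E}} := [set I | [forall A in C, #|I :&: A| <= c A]%N].

Lemma chain_indepP I : reflect {in C, forall A, #|I :&: A| <= c A}%N (I \in chain_indep).
Proof. by rewrite inE; apply: forall_inP. Qed.

Lemma chain_indep0 : set0 \in chain_indep.
Proof. by apply/chain_indepP => A _; rewrite set0I cards0. Qed.

Lemma chain_indepS I J : I \subset J -> J \in chain_indep -> I \in chain_indep.
Proof.
move=> IJ /chain_indepP h; apply/chain_indepP => A AC.
by apply: leq_trans (h A AC); apply/subset_leq_card/setSI.
Qed.

(** As [C] is a chain, this union is the largest member whose bound [I] attains, or empty if there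
    is none. *)
Definition tight I := cover [set A in C | #|I :&: A| == c A].

Lemma tightP I : tight I = set0 \/ tight I \in C /\ #|I :&: tight I| = c (tight I).
Proof.
set T := [set A in C | #|I :&: A| == c A].
have cT : is_chain T by apply: chainS chainC; apply/subsetP => A; rewrite inE => /andP[].
have [T0|T0] := eqVneq T set0; first by left; rewrite /tight -/T T0 /cover big_set0.
by have := chain_cover cT T0; rewrite inE => /andP[TC /eqP Tc]; right.
Qed.

Lemma chain_indepU1 x I : I \in chain_indep -> x \notin tight I -> x |: I \in chain_indep.
Proof.
move=> /chain_indepP iI xt; apply/chain_indepP => A AC; rewrite setIUl.
have [xA|xA] := boolP (x \in A); last first.
  by rewrite (_ : [set x] :&: A = set0) ?set0U ?iI //; apply/eqP; rewrite setI_eq0 disjoints1.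
have lt : (#|I :&: A| < c A)%N.
  rewrite ltn_neqAle iI // andbT; apply: contraNN xt => tA.
  by apply/bigcupP; exists A; rewrite // inE AC.
by rewrite (setIidPl _) ?sub1set // cardsU1; case: (_ \notin _); rewrite // ltnW.
Qed.

Lemma chain_indep_aug I J : I \in chain_indep -> J \in chain_indep -> (#|I| < #|J|)%N ->
  exists2 x, x \in J :\: I & x |: I \in chain_indep.
Proof.
move=> iI iJ IJ; set D := tight I.
have leD : (#|J :&: D| <= #|I :&: D|)%N.
  have [D0|[DC cD]] := tightP I; first by rewrite /D D0 !setI0 cards0.
  by rewrite cD; apply: (chain_indepP _ iJ).
have /subsetPn[x] : ~~ (J :\: D \subset I).
  apply: contraL IJ => JDI; rewrite -leqNgt -(cardsID D J) -(cardsID D I) leq_add //.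
  exact/subset_leq_card/setD_subset.
rewrite inE => /andP[xD xJ] xI; exists x; first by rewrite inE xI.
exact: chain_indepU1.
Qed.

Definition chain_matroid : matroid E :=
  Matroid chain_indep0 chain_indepS chain_indep_aug.

Lemma rk_chain_le A : A \in C -> (rk chain_matroid A <= c A)%N.
Proof.
move=> AC; have [I [/chain_indepP iI IA <-]] := rk_basis chain_matroid A.
by rewrite -(setIidPl IA) iI.
Qed.

(** Take [D] to be the tight set of a basis of [B]. Any element outside [D] could still be added, so
    the basis contains all of [B :\: D], and it attains the bound of [D]. *)
Lemma rk_chain_ge B : exists D, (D = set0 \/ D \in C /\ rk chain_matroid D = c D) /\
  (rk chain_matroid D + #|B :\: D| <= rk chain_matroid B)%N.
Proof.
have [I [iI IB cI]] := rk_basis chain_matroid B.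
have BD : B :\: tight I \subset I.
  apply/subsetP => x; rewrite inE => /andP[xt xB]; apply: contraT => xI.
  have xIB : x |: I \subset B by rewrite subUset sub1set xB.
  have := rk_max (chain_indepU1 iI xt : x |: I \in indep chain_matroid) xIB.
  by rewrite cardsU1 xI cI add1n ltnn.
exists (tight I); rewrite -cI -(cardsID (tight I) I).
have le : (#|B :\: tight I| <= #|I :\: tight I|)%N.
  exact/subset_leq_card/setD_subset.
have [t0|[tC ct]] := tightP I.
  by split; [left|rewrite t0 rk0 setD0 in le *; rewrite setI0 cards0].
have rkt : rk chain_matroid (tight I) = c (tight I).
  apply/eqP; rewrite eqn_leq rk_chain_le // -ct rk_max ?subsetIr //.
  by apply: indepS iI; apply: subsetIl.
by split; [right|rewrite rkt -ct leq_add2l].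
Qed.

(** A circuit violates the bound of some [A] and, by minimality, lies inside it. A basis of [G]
    extending the circuit minus one element already fills [A], so no element of [A] can be outside
    the flat [G]. *)
Lemma circuit_flat D G : circuit chain_matroid D -> flat chain_matroid G -> D \subset G ->
  exists2 A, A \in C & D \subset A /\ A \subset G.
Proof.
move=> /minsetP[nD minD] fG DG.
have [A AC ltA] : exists2 A, A \in C & (c A < #|D :&: A|)%N.
  by move: nD; rewrite inE => /forall_inPn[A AC]; rewrite -ltnNge; exists A.
have DA : D \subset A.
  have nDA : D :&: A \notin indep chain_matroid.
    by apply/negP => /chain_indepP/(_ A AC); rewrite -setIA setIid leqNgt ltA.
  by rewrite -(minD _ nDA (subsetIl _ _)) subsetIr.
rewrite (setIidPl DA) in ltA.
exists A => //; split=> //; apply/subsetP => x xA; apply: contraT => xG.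
have [d dD] : exists d, d \in D by apply/set0Pn; rewrite -card_gt0; lia.
have iDd : D :\ d \in indep chain_matroid.
  apply: contraT => /minD/(_ (subsetDl _ _)) DE.
  by have := dD; rewrite -DE !inE eqxx.
have DdG : D :\ d \subset G by apply: subset_trans DG; apply: subsetDl.
have [I [iI DI IG cI]] := rk_basis_ext iDd DdG.
have := implyP (forallP fG x) xG; rewrite -cI.
have [J [iJ JxG <-]] := rk_basis chain_matroid (x |: G).
move=> /(indep_aug iI iJ)[y]; rewrite inE => /andP[yI yJ] iyI.
have yx : y = x.
  have := subsetP JxG y yJ; rewrite !inE => /orP[/eqP//|yG].
  have yIG : y |: I \subset G by rewrite subUset sub1set yG.
  by have := rk_max iyI yIG; rewrite cardsU1 yI cI add1n ltnn.
have := chain_indepP _ iyI A AC; rewrite yx setIUl (setIidPl _) ?sub1set //.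
rewrite cardsU1 !inE negb_and -yx yI /= add1n => h.
have le : (#|D :\ d| <= #|I :&: A|)%N.
  by apply: subset_leq_card; rewrite subsetI DI (subset_trans (subsetDl _ _)).
rewrite (cardsD1 d D) dD add1n ltnS in ltA.
by have := leq_trans h (leq_trans ltA le); rewrite ltnn.
Qed.

(** If [G] is not inside [G'], the chain member in [G] around a circuit through a witness is inside
    no member contained in [G'], so it contains all of those, and they cover [G']. *)
Lemma nested_chain_matroid : nested chain_matroid.
Proof.
move=> G G' [fG [S SC GE]] [fG' [S' SC' GE']].
have [//|/subsetPn[x xG xG']] := boolP (G \subset G'); apply/subsetP => y.
move: xG; rewrite GE => /bigcupP[D DS xD].
have DG : D \subset G by rewrite GE; apply: bigcup_sup.
have [A AC [DA AG]] := circuit_flat (SC _ DS) fG DG.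
rewrite GE' => /bigcupP[D' DS' yD'].
have DG' : D' \subset G' by rewrite GE'; apply: bigcup_sup.
have [A' AC' [DA' AG']] := circuit_flat (SC' _ DS') fG' DG'.
rewrite -GE; apply: (subsetP AG).
have /orP[AA|AA] := chainP _ chainC A A' AC AC'; last by apply: (subsetP AA); apply: (subsetP DA').
by rewrite (subsetP AG' x (subsetP AA x (subsetP DA x xD))) in xG'.
Qed.

End ChainMatroid.

Lemma indicP (T : Type) (R : pzRingType) (X : classical_sets.set T) x (b : bool) :
  (X x <-> b) -> numfun.indic X x = b%:R :> R.
Proof.
move=> Xb; rewrite numfun.indicE; congr (_%:R); congr nat_of_bool.
by apply/idP/idP => [/classical_sets.set_mem/Xb|/Xb/classical_sets.mem_set].
Qed.

(** * Symmetrized indicators of base polytopes *)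

Section Symmetrization.
Variables (R : realType) (n : nat).
Implicit Types (M : matroid 'I_n) (x : 'rV[R]_n) (f : 'rV[R]_n -> R).

Definition symmetrize f x : R :=
  n`!%:R^-1 * \sum_(s : 'S_n) f (\row_i x 0 (s i)).

Lemma sym_indicE M x :
  sym_indic (base_polytope M) x = symmetrize (numfun.indic (base_polytope M)) x.
Proof. by []. Qed.

Lemma in_polytope_iso M M' (f : 'I_n -> 'I_n) (x : 'rV[R]_n) : bijective f ->
  (forall A : {set 'I_n}, (f @: A \in indep M') = (A \in indep M)) ->
  in_polytope M' x <-> in_polytope M (\row_i x 0 (f i)).
Proof.
move=> bf fM; have [g gK fK] := bf; have fI := can_inj gK.
have fgS (A : {set 'I_n}) : f @: (g @: A) = A by rewrite -imset_comp (eq_imset _ fK) imset_id.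
have wf A : weight (\row_i x 0 (f i)) A = weight x (f @: A).
  rewrite /weight big_imset /=; last by move=> i j _ _; apply: fI.
  by apply: eq_bigr => i _; rewrite mxE.
have fT : f @: [set: 'I_n] = setT.
  by apply/setP => y; rewrite inE; apply/imsetP; exists (g y).
have rE : rank M' = rank M by rewrite /rank -(isomorphic_rk bf fM) fT.
split=> -[x0 xA xT]; split.
- by move=> i; rewrite mxE.
- by move=> A; rewrite wf -(isomorphic_rk bf fM).
- by rewrite wf fT xT rE.
- by move=> i; have := x0 (g i); rewrite mxE fK.
- by move=> A; rewrite -[A]fgS -wf (isomorphic_rk bf fM).
by rewrite -fT -wf xT rE.
Qed.

(** An isomorphism permutes the coordinates, which only reindexes the sum over the symmetric
    group. *)
Lemma sym_indic_iso M M' x : isomorphic M M' ->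
  sym_indic (base_polytope M) x = sym_indic (base_polytope M') x.
Proof.
move=> [f bf fM]; rewrite /sym_indic; congr (_ * _).
have fI := bij_inj bf; rewrite (reindex_inj (mulgI (perm fI))) /=.
apply: eq_bigr => s _; congr (_%:R); congr nat_of_bool.
have iff : base_polytope M' (\row_i x 0 (s i)) <->
    base_polytope M (\row_i x 0 ((perm fI * s)%g i)).
  apply: iff_trans (base_polytopeP _ _) _; apply: iff_trans (in_polytope_iso _ bf fM) _.
  rewrite (_ : \row_i _ = \row_i x 0 ((perm fI * s)%g i)).
    exact: iff_sym (base_polytopeP _ _).
  by apply/rowP => i; rewrite !mxE permM permE.
apply/idP/idP => /classical_sets.set_mem/iff/classical_sets.mem_set //.
Qed.

Lemma symmetrize_sum (I : finType) (P : pred I) (a : I -> R) (F : I -> 'rV[R]_n -> R) x :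
  symmetrize (fun y => \sum_(i | P i) a i * F i y) x =
  \sum_(i | P i) a i * symmetrize (F i) x.
Proof.
rewrite /symmetrize exchange_big /= mulr_sumr; apply: eq_bigr => i _.
by rewrite -mulr_sumr mulrCA.
Qed.

End Symmetrization.

Section ChainPolytope.
Variables (R : realType) (n : nat) (M : matroid 'I_n).
Implicit Types (x : 'rV[R]_n) (A B : {set 'I_n}) (C D : {set {set 'I_n}}).
Local Notation rk := (rk M).

Definition hypersimplex (r : nat) x : bool :=
  [forall i, 0 <= x 0 i <= 1] && (weight x setT == r%:R).

Lemma rank_chain_matroid C (cC : is_chain C) : setT \in C ->
  rank (chain_matroid rk cC) = rank M.
Proof.
move=> TC; apply/eqP; rewrite eqn_leq rk_chain_le //=.
have [I [iI _ cI]] := rk_basis M setT; rewrite /rank -cI rk_max ?subsetT //.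
apply/chain_indepP => A _; apply: rk_max; last exact: subsetIr.
by apply: indepS iI; apply: subsetIl.
Qed.

(** By [rk_chain_ge] the rank inequality of any [B] follows from that of one member [D] of the chain
    and from the bounds by 1 on the coordinates in [B :\: D]. *)
Lemma chain_polytopeP C (cC : is_chain C) x : setT \in C ->
  base_polytope (chain_matroid rk cC) x <->
  hypersimplex (rank M) x && [forall A in C, weight x A <= (rk A)%:R].
Proof.
move=> TC; apply: iff_trans (base_polytopeP _ _) _; split.
  move=> xP; have [x0 xA xT] := xP.
  apply/andP; split; last first.
    apply/forall_inP => A AC; apply: le_trans (xA A) _; rewrite ler_nat.
    exact: rk_chain_le.
  rewrite /hypersimplex xT rank_chain_matroid // eqxx andbT.
  by apply/forallP => i; rewrite x0 (polytope_le1 _ xP).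
move=> /andP[/andP[/forallP x01 /eqP xT] /forall_inP xC].
split=> [i|B|]; last by rewrite xT rank_chain_matroid.
  by case/andP: (x01 i).
have [D [DC]] := rk_chain_ge rk cC B; rewrite -(ler_nat R) natrD.
apply: le_trans; have leD : weight x B <= weight x D + weight x (B :\: D).
  rewrite /weight (big_setID D) lerD2r /= [leRHS](big_setID B) /= setIC.
  by rewrite lerDl sumr_ge0 // => i _; case/andP: (x01 i).
apply: le_trans leD _; apply: lerD.
  case: DC => [->|[DC ->]]; last exact: xC.
  by rewrite [weight _ _]big_set0 ler0n.
rewrite -sum1_card natr_sum; apply: ler_sum => i _; by case/andP: (x01 i).
Qed.

Lemma base_polytope_hypersimplex x : base_polytope M x <->
  hypersimplex (rank M) x && [forall A, weight x A <= (rk A)%:R].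
Proof.
apply: iff_trans (base_polytopeP _ _) _; split.
  move=> xP; have [x0 xA xT] := xP; rewrite /hypersimplex xT eqxx andbT.
  by apply/andP; split; apply/forallP => // i; rewrite x0 (polytope_le1 _ xP).
move=> /andP[/andP[/forallP x01 /eqP xT] /forallP xA].
by split=> // i; case/andP: (x01 i).
Qed.

(** Strict violations on [D] and valid inequalities on [C] are kept side by side so that members can
    be moved from [D] to [C] one at a time. *)
Definition mixed_cell D C x : bool := [&& hypersimplex (rank M) x,
  [forall A in D, (rk A)%:R < weight x A] & [forall A in C, weight x A <= (rk A)%:R]].

(** At a fixed point of the hypersimplex the sum runs over chains of violated sets. If there are
    none, only the empty chain is left. Otherwise let [A0] be violated most: by submodularity
    [A :&: A0] is violated whenever [A] is, and [sum_chains_contractible] gives 0. *)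
Lemma polytope_cells x : numfun.indic (base_polytope M) x =
  \sum_(D | is_chain D) (-1) ^+ #|D| * (mixed_cell D [set setT] x)%:R :> R.
Proof.
rewrite (indicP R (base_polytope_hypersimplex x)) /mixed_cell.
have [xH|] /= := boolP (hypersimplex (rank M) x); last first.
  by move=> _; rewrite big1 // => D _; rewrite mulr0.
have [/forallP x01 /eqP xT] := andP xH.
pose V := [set A | (rk A)%:R < weight x A].
transitivity (\sum_(D : {set {set 'I_n}} | is_chain D && (D \subset V)) (-1) ^+ #|D| : R); last first.
  rewrite big_mkcondr; apply: eq_bigr => D _.
  have -> : [forall A in [set setT], weight x A <= (rk A)%:R].
    by apply/forall_inP => A; rewrite inE => /eqP->; rewrite xT.
  rewrite andbT (_ : [forall A in D, _] = (D \subset V)).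
    by case: ifP; rewrite ?mulr1 ?mulr0.
  by apply/forall_inP/subsetP => h A /h; rewrite inE.
have [V0|[A1 A1V]] := set_0Vmem V.
  rewrite V0 sum_chains_set0 (_ : [forall A, _]) //; apply/forallP => A.
  by rewrite leNgt; have := in_set0 A; rewrite -V0 inE => ->.
rewrite (_ : [forall A, _] = false); last first.
  by apply/negbTE/forallPn; exists A1; rewrite -ltNge; rewrite inE in A1V.
case: (Order.TotalTheory.arg_maxP (fun A => weight x A - (rk A)%:R) A1V) => A0 A0V maxA0.
rewrite (sum_chains_contractible R (A0 := A0)) // => A.
rewrite !inE => AV; have := weightUI x A A0.
have : (rk (A :|: A0) + rk (A :&: A0))%:R <= (rk A + rk A0)%:R :> R by rewrite ler_nat rk_submod.
have leU : weight x (A :|: A0) - (rk (A :|: A0))%:R <= weight x A0 - (rk A0)%:R.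
  have [UV|] := boolP (A :|: A0 \in V); first exact: maxA0.
  have := A0V : A0 \in V; rewrite inE => A0V'.
  by rewrite inE -leNgt => UV; lra.
rewrite !natrD => h1 h2; lra.
Qed.

End ChainPolytope.

(** * Existence of nested coordinates *)

Section Coordinates.
Variables (R : realType) (n r m : nat) (N : 'I_m -> matroid 'I_n).
Hypothesis repN : nested_representatives r N.
Implicit Types (M : matroid 'I_n) (x : 'rV[R]_n) (f g : 'rV[R]_n -> R).

Definition nested_comb f : Prop := exists c : 'rV[int]_m, forall x,
  f x = \sum_j (c 0 j)%:~R * sym_indic (base_polytope (N j)) x.

Lemma nested_comb_nested M : nested M -> rank M = r ->
  nested_comb (sym_indic (base_polytope M)).
Proof.
case: repN => _ _ repr nM rM; have [j isoj] := repr M nM rM.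
exists (delta_mx 0 j) => x; rewrite (bigD1 j) //= big1 => [|k kj].
  by rewrite mxE !eqxx mul1r addr0; apply: sym_indic_iso.
by rewrite mxE (negPf kj) andbF mul0r.
Qed.

Lemma nested_combB f g : nested_comb f -> nested_comb g ->
  nested_comb (fun x => f x - g x).
Proof.
move=> [c fE] [d gE]; exists (c - d) => x; rewrite fE gE -sumrB.
by apply: eq_bigr => j _; rewrite !mxE intrB mulrBl.
Qed.

Lemma nested_comb_sum (I : finType) (P : pred I) (a : I -> int) (F : I -> 'rV[R]_n -> R) :
  (forall i, P i -> nested_comb (F i)) ->
  nested_comb (fun x => \sum_(i | P i) (a i)%:~R * F i x).
Proof.
move=> FC; have /fin_all_exists[c cE] : forall i, exists c : 'rV[int]_m, P i -> forall x,
    F i x = \sum_j (c 0 j)%:~R * sym_indic (base_polytope (N j)) x.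
  move=> i; have [Pi|nP] := boolP (P i); last by exists 0.
  by have [c cE] := FC i Pi; exists c.
exists (\sum_(i | P i) a i *: c i) => x.
under eq_bigr => i Pi do rewrite (cE i Pi) mulr_sumr.
rewrite exchange_big; apply: eq_bigr => j _ /=.
rewrite summxE raddf_sum mulr_suml; apply: eq_bigr => i _.
by rewrite mxE /= intrM mulrA.
Qed.

Lemma nested_comb_ext f g : (forall x, f x = g x) -> nested_comb f -> nested_comb g.
Proof. by move=> fg [c cE]; exists c => x; rewrite -fg cE. Qed.

Lemma symmetrizeB f g x : symmetrize (fun y => f y - g y) x = symmetrize f x - symmetrize g x.
Proof. by rewrite /symmetrize sumrB mulrBr. Qed.

Lemma eq_symmetrize f g x : (forall y, f y = g y) -> symmetrize f x = symmetrize g x.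
Proof. by move=> fg; congr (_ * _); apply: eq_bigr => s _. Qed.

(** Induction on [D]: a strict violation at [A] is no condition at [A] minus the valid inequality at
    [A]. With [D] empty the cell is the base polytope of a chain matroid, which is nested of rank
    [r]. *)
Lemma nested_comb_cell M (D C : {set {set 'I_n}}) : rank M = r -> setT \in C -> is_chain (D :|: C) ->
  nested_comb (symmetrize (fun x => (mixed_cell M D C x)%:R)).
Proof.
move=> rM; have [k] := ubnP #|D|; elim: k D C => // k IHk D C ltD TC cDC.
have [D0|[A AD]] := set_0Vmem D.
  have cC : is_chain C by apply: chainS cDC; rewrite subsetUr.
  apply: nested_comb_ext _ (nested_comb_nested (@nested_chain_matroid _ C (rk M) cC) (etrans (rank_chain_matroid M cC TC) rM)).
  move=> x; rewrite sym_indicE; apply: eq_symmetrize => y.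
  apply: indicP; apply: iff_trans (chain_polytopeP M cC y TC) _.
  rewrite /mixed_cell D0 (_ : [forall A in set0, _]) //.
  by apply/forall_inP => A; rewrite inE.
have ltA : (#|D :\ A| < k)%N by rewrite (cardsD1 A) AD ltnS in ltD.
have c1 : is_chain (D :\ A :|: C) by apply: chainS cDC; rewrite setSU ?subD1set.
have DAC : D :\ A :|: (A |: C) = D :|: C by rewrite setUCA setUA setD1K.
apply: nested_comb_ext _ (nested_combB (IHk (D :\ A) C ltA TC c1)
  (IHk (D :\ A) (A |: C) ltA _ _)); rewrite ?DAC ?inE ?TC ?orbT //.
move=> x; rewrite -symmetrizeB; apply: eq_symmetrize => y.
rewrite /mixed_cell -{3}(setD1K AD).
have allU (B : {set 'I_n}) (T : {set {set 'I_n}}) (p : pred {set 'I_n}) :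
    [forall A in B |: T, p A] = p B && [forall A in T, p A].
  apply/forall_inP/andP => [h|[pB /forall_inP h] A'].
    by split; [apply: h; rewrite setU11|apply/forall_inP => X XT; apply: h; rewrite inE XT orbT].
  by rewrite !inE => /orP[/eqP->|/h].
rewrite !allU ltNge; case: (hypersimplex _ _); case: (_ <= _) => //=;
  rewrite ?andbF ?subr0 ?subrr //.
Qed.

Lemma nested_comb_polytope M : rank M = r -> nested_comb (sym_indic (base_polytope M)).
Proof.
move=> rM; pose a (D : {set {set 'I_n}}) : int := (-1) ^+ #|D|.
apply: nested_comb_ext _ (nested_comb_sum (P := @is_chain _)
  (F := fun D => symmetrize (fun x => (mixed_cell M D [set setT] x)%:R)) a _).
  move=> x; rewrite sym_indicE -symmetrize_sum; apply: eq_symmetrize => y.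
  rewrite polytope_cells; apply: eq_bigr => D _; congr (_ * _).
  by rewrite /a rmorphXn /= rmorphN1.
move=> D cD; apply: nested_comb_cell; rewrite ?set11 //.
rewrite setUC; apply: chainU1 => // B _; by rewrite subsetT orbT.
Qed.

(** Since integer coordinates exist, the [xget] in [nested_coords] returns a solution and not its
    default 0. *)
Lemma nested_coordsP M : rank M = r -> forall x,
  sym_indic (base_polytope M) x =
  \sum_j (nested_coords R N M 0 j)%:~R * sym_indic (base_polytope (N j)) x.
Proof.
move=> rM; rewrite /nested_coords.
exact: (classical_sets.xgetPex 0 (nested_comb_polytope rM)).
Qed.

End Coordinates.

(** * The linear functional *)

Section Functional.
Variables (R : realType) (r : nat).

Definition low (E : finType) (M : matroid E) h s : R := #|low_sets M h s|%:R.

(* The number of three-point lines, with penalties for violating sparsity and,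
   among sparse matroids, for having planes with five points. *)
Definition functional (w1 w2 : R) (E : finType) (M : matroid E) : R :=
  low M 2 3 - w2 * (low M 3 5 - 6 * low M 3 6)
  - w1 * \sum_(h < r) low M h.+1 'C(h.+2, 2).+1.

Lemma low_le (E : finType) (M : matroid E) h s : low M h s <= (2 ^ #|E|)%N%:R.
Proof.
rewrite ler_nat -cardsT -card_powerset; apply: subset_leq_card.
by apply/subsetP => A _; rewrite inE subsetT.
Qed.

Lemma functional_iso w1 w2 (E E' : finType) (M : matroid E) (M' : matroid E') :
  isomorphic M M' -> functional w1 w2 M = functional w1 w2 M'.
Proof.
move=> iso; rewrite /functional /low !(low_sets_iso _ _ iso); congr (_ - _ * _).
by apply: eq_bigr => h _; rewrite (low_sets_iso _ _ iso).
Qed.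

Let K := M_K r.+1.
Variable E : finType.
Hypothesis cardE : #|E| = 'C(r.+1, 2).

(** Every count is at most 2^|E|. One unit of penalty at weight [w2] exceeds the number of triples;
    one unit at weight [w1] exceeds in addition all that the term [6 * low M 3 6] can give back. *)
Let w2 : R := (2 ^ #|E|)%N%:R + 1.
Let w1 : R := (2 ^ #|E|)%N%:R + 6 * w2 * (2 ^ #|E|)%N%:R + 1.

Lemma functional_good (E' : finType) (M : matroid E') v1 v2 : sparse M -> no5planes M ->
  functional v1 v2 M = #|triples M|%:R.
Proof.
move=> sM pM; rewrite /functional big1 => [|h _]; last first.
  by rewrite /low low_sets_sparse // cards0.
have [_ [_ /(_ pM) h]] := low_sets_planes sM.
by rewrite /low -h natrM subrr !mulr0 !subr0.
Qed.

Lemma rank_K : rank K = r.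
Proof. by rewrite rank_complete card_ord. Qed.

Lemma functional_K v1 v2 : functional v1 v2 K = 'C(r.+1, 3)%:R.
Proof.
rewrite functional_good; last exact: no5planes_complete; last exact: sparse_complete.
have cE : #|{: complete_edge 'I_r.+1}| = 'C((rank K).+1, 2).
  by rewrite card_edge card_ord rank_K.
have le1 := card_triples (@sparse_complete _) (@no5planes_complete _) cE.
have le2 := card_triples_complete 'I_r.+1.
rewrite rank_K in le1; rewrite card_ord in le2.
by congr (_%:R); apply/eqP; rewrite eqn_leq le1.
Qed.

(** Either some penalty is active and the value is negative, or [M] is sparse without five-point
    planes and the value is its number of triples, for which the bound and the equality case are
    known. *)
Lemma functional_max (M : matroid E) : rank M = r ->
  functional w1 w2 M <= functional w1 w2 K /\
  (functional w1 w2 M = functional w1 w2 K -> isomorphic M K).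
Proof.
move=> rM; rewrite functional_K.
have low0 h s : 0 <= low M h s by rewrite ler0n.
have b0 : 0 <= (2 ^ #|E|)%N%:R :> R by rewrite ler0n.
have c0 : 0 <= 'C(r.+1, 3)%:R :> R by rewrite ler0n.
have lb h s := low_le M h s.
suff : functional w1 w2 M < 0 \/ sparse M /\ no5planes M.
  case=> [neg|[sM pM]].
    by split=> [|e]; [exact: le_trans (ltW neg) c0|move: neg; rewrite e ltNge c0].
  have cE : #|E| = 'C((rank M).+1, 2) by rewrite rM.
  rewrite functional_good //; split; first by rewrite ler_nat -rM card_triples.
  have := complete_of_triples cE sM pM; rewrite rM => h.
  by move/eqP; rewrite eqr_nat => /eqP /h.
pose B : R := (2 ^ #|E|)%N%:R; rewrite -/B in b0 lb.
have w2E : w2 = B + 1 by [].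
have w1E : w1 = B + 6 * w2 * B + 1 by [].
have w2_ge0 : 0 <= w2 by rewrite w2E addr_ge0.
have w1_ge0 : 0 <= w1 by rewrite w1E !addr_ge0 // !mulr_ge0.
have [/existsP[h hP]|/existsPn no] :=
  boolP [exists h : 'I_r, low_sets M h.+1 'C(h.+2, 2).+1 != set0].
  left; rewrite /functional.
  have : 1 <= \sum_(h < r) low M h.+1 'C(h.+2, 2).+1.
    rewrite (bigD1 h) //= ler_wpDr ?sumr_ge0 // /low -[1]/(1%:R) ler_nat.
    by rewrite card_gt0.
  move: (\sum_(h < r) _) => p p1.
  have h1 : w1 <= w1 * p by rewrite ler_peMr.
  have h2 : w2 * (6 * low M 3 6) <= w2 * (6 * B) by rewrite ler_wpM2l // ler_wpM2l.
  have h3 : 0 <= w2 * low M 3 5 by rewrite mulr_ge0.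
  have := lb 2%N 3%N; move: h1; rewrite {1}w1E mulrBr => h1 h4; lra.
have low0E : forall h, (h < rank M)%N -> low_sets M h.+1 'C(h.+2, 2).+1 = set0.
  by move=> h; rewrite rM => hr; apply/eqP; have := no (Ordinal hr); rewrite negbK.
have sM : sparse M by apply: sparse_low_sets => //; rewrite rM.
have [le iffP] := low_sets_planes sM.
have [eq6|neq6] := eqVneq (6 * #|low_sets M 3 6|)%N #|low_sets M 3 5|.
  by right; split=> //; apply/iffP.
left; rewrite /functional big1 => [|h _]; last by rewrite /low low0E ?cards0 // rM.
rewrite mulr0 subr0.
have ge1 : 1 <= low M 3 5 - 6 * low M 3 6.
  have : (6 * #|low_sets M 3 6| < #|low_sets M 3 5|)%N by rewrite ltn_neqAle neq6.
  by rewrite -(ler_nat R) -natr1 natrM /low; lra.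
have h1 : w2 <= w2 * (low M 3 5 - 6 * low M 3 6) by rewrite ler_peMr.
by have := lb 2%N 3%N; move: h1; rewrite {1}w2E => h1 h4; lra.
Qed.

End Functional.

(** * Valuations *)

From mathcomp Require Import all_classical all_reals.
From mathcomp Require Import topology normedtype derive.
Import numFieldNormedType.Exports.
Local Open Scope classical_set_scope.
Local Open Scope ring_scope.

(** * Euler characteristic of compact convex sets *)

Section EulerInterval.
Variables (R : realType) (J : finType).
Implicit Types (a b d : J -> R) (P : pred J).

(* Just to the right of a point [s], only the intervals ending at [s] are lost. *)
Lemma sum_intervals P a b d : (forall j, P j -> a j <= b j) ->
  (forall s : R, \sum_(j | P j) d j * (a j <= s <= b j)%R%:R = 0) -> \sum_(j | P j) d j = 0.
Proof.
move=> ab sum0.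
have ends (s : R) : \sum_(j | P j && (b j == s)) d j = 0.
  pose F (o : option (J + J)) :=
    match o with Some (inl j) => a j | Some (inr j) => b j | None => s + 1 end.
  have FN : s < F None by rewrite /= ltrDl.
  have [o so minF] : exists2 o, s < F o & forall o', s < F o' -> F o <= F o'.
    by case: (Order.TotalTheory.arg_minP (P := fun o => s < F o) F FN) => o; exists o.
  (* No endpoint lies in the half-open interval from [s], excluded, to [u]; so an interval contains
     [u] exactly when it contains [s] and does not end there. The value [s + 1] at [None] ensures
     that something lies beyond [s]. *)
  pose u := (s + F o) / 2; have su : s < u by rewrite /u; lra.
  have ltu o' : s < F o' -> u < F o' by move=> /minF h; rewrite /u; lra.
  transitivity (\sum_(j | P j) d j * (a j <= s <= b j)%R%:R -
                \sum_(j | P j) d j * (a j <= u <= b j)%R%:R); last by rewrite !sum0 subrr.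
  rewrite -sumrB big_mkcondr /=.
  apply: eq_bigr => j Pj; have := ab j Pj.
  have := ltu (Some (inl j)); have := ltu (Some (inr j)); rewrite /= => hb ha abj.
  have [bs|bs|bs] := ltgtP (b j) s.
  - by rewrite (lt_geF (lt_trans bs su)) !andbF mulr0 subrr.
  - rewrite (ltW (hb bs)) !andbT; have [as_|sa] := leP (a j) s.
      by rewrite (le_trans as_ (ltW su)) subrr.
    by rewrite (lt_geF (ha sa)) mulr0 subrr.
  by rewrite -bs abj bs (lt_geF su) andbF mulr1 mulr0 subr0.
(* Intervals are grouped by right endpoint. A real endpoint cannot index a finite sum, so a group is
   labelled by its set of indices. *)
rewrite (partition_big (fun j => [set k | b k == b j]%SET) xpredT) //=.
apply: big1 => S _; have [j /andP[Pj /eqP SE]|no] := pickP (fun j => P j && ([set k | b k == b j]%SET == S)).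
  rewrite -[RHS](ends (b j)); apply: eq_bigl => k; congr (_ && _).
  rewrite -SE; apply/eqP/eqP => [/finset.setP/(_ k)|->//].
  by rewrite !inE eqxx => /esym/eqP.
by rewrite big_pred0.
Qed.

End EulerInterval.

Section EulerConvex.
Variables (R : realType) (n : nat) (J : finType) (K : J -> set 'rV[R]_n) (d : J -> R).
Hypothesis compactK : forall j, compact (K j).
Hypothesis convexK : forall j x y (t : R), 0 <= t <= 1 -> K j x -> K j y ->
  K j (t *: x + (1 - t) *: y).

(** A nonempty compact convex set has Euler characteristic 1. Sections with the first k coordinates
    fixed are treated for decreasing k: when coordinate k is released, its values on the section of
    each set form a compact interval, and [sum_intervals] removes it. *)
Lemma euler_convex : (forall x, \sum_j d j * (`[< K j x >])%:R = 0) ->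
  \sum_(j | `[< K j !=set0 >]) d j = 0.
Proof.
move=> sum0.
pose sec k (t : 'rV[R]_n) j : set 'rV[R]_n :=
  K j `&` [set x | forall i : 'I_n, (i < k)%N -> x 0 i = t 0 i].
have compact_sec k t j : compact (sec k t j).
  apply: compact_closedI => //; set S := (X in closed X).
  have -> : S = \bigcap_(i in [set i : 'I_n | (i < k)%N])
      ((fun x : 'rV[R]_n => x 0 i) @^-1` [set t 0 i]).
    by apply/seteqP; split=> x /= h i /h.
  apply: closed_bigI => i _; apply: preimage_closed; last exact: closed_eq.
  by move=> x _; exact: coord_continuous.
suff H k t : (k <= n)%N -> \sum_(j | `[< sec k t j !=set0 >]) d j = 0.
  rewrite -[RHS](H 0 0 (leq0n n)); apply: eq_bigl => j; apply/asboolP/asboolP => -[x xK].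
    by exists x; split.
  by exists x; case: xK.
move=> kn; have [m mE] : exists m, k = (n - m)%N by exists (n - k)%N; rewrite subKn.
elim: m k t kn mE => [|m IHm] k t kn ->.
  rewrite subn0 -[RHS](sum0 t) [LHS]big_mkcond; apply: eq_bigr => j _.
  suff -> : `[< sec n t j !=set0 >] = `[< K j t >] by case: asboolP; rewrite ?mulr1 ?mulr0.
  apply/asboolP/asboolP => [[x [xK xt]]|tK]; last by exists t; split.
  by suff <- : x = t by []; apply/rowP => i; apply: xt.
have [nm|mn] := leqP n m.
  by rewrite (_ : n - m.+1 = n - m)%N ?IHm ?leq_subr //; lia.
pose k1 := (n - m.+1)%N; have kltn : (k1 < n)%N by rewrite /k1; lia.
pose k0 := Ordinal kltn; rewrite -/k1.
have k1S : k1.+1 = (n - m)%N by rewrite /k1; lia.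
have coordc : continuous (fun x : 'rV[R]_n => x 0 k0) by exact: coord_continuous.
have /fin_all_exists[ab abE] : forall j, exists ab : R * R, sec k1 t j !=set0 ->
    [/\ ab.1 <= ab.2, exists2 x, sec k1 t j x & x 0 k0 = ab.1,
        exists2 x, sec k1 t j x & x 0 k0 = ab.2 &
        forall x, sec k1 t j x -> ab.1 <= x 0 k0 <= ab.2].
  move=> j; have [ne|] := pselect (sec k1 t j !=set0); last by exists (0, 0).
  have cw := @continuous_subspaceT _ _ (sec k1 t j) _ coordc.
  have [p pS pmin] := EVT_min_rV ne (compact_sec _ _ _) cw.
  have [q qS qmax] := EVT_max_rV ne (compact_sec _ _ _) cw.
  rewrite inE in pS; rewrite inE in qS; exists (p 0 k0, q 0 k0) => _ /=; split.
  - by apply: pmin; rewrite inE.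
  - by exists p.
  - by exists q.
  by move=> x xS; rewrite pmin ?qmax // inE.
apply: (@sum_intervals R J _ (fun j => (ab j).1) (fun j => (ab j).2)).
  by move=> j /asboolP/abE[].
move=> s; pose ts : 'rV[R]_n := \row_i if i == k0 then s else t 0 i.
have := IHm k1.+1 ts _ k1S; rewrite k1S leq_subr => /(_ isT); rewrite -k1S.
move=> H0; rewrite -[RHS]H0 [LHS]big_mkcond [RHS]big_mkcond; apply: eq_bigr => j _.
have tsE (x : 'rV[R]_n) : (forall i : 'I_n, (i < k1.+1)%N -> x 0 i = ts 0 i) <->
    (forall i : 'I_n, (i < k1)%N -> x 0 i = t 0 i) /\ x 0 k0 = s.
  split=> [h|[h xs] i].
    split=> [i ik|]; last by rewrite h ?mxE ?eqxx.
    by rewrite h ?mxE 1?ltnW //; case: eqP => // ik0; rewrite ik0 ltnn in ik.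
  rewrite mxE ltnS leq_eqVlt; case: (i =P k0) => [->//|ik] /orP[/eqP ik1|]; last exact: h.
  by case: ik; apply: val_inj.
suff -> : `[< sec k1.+1 ts j !=set0 >] =
    `[< sec k1 t j !=set0 >] && ((ab j).1 <= s <= (ab j).2).
  by case: `[< _ >] => //=; case: ifP; rewrite ?mulr1 ?mulr0.
apply/asboolP/andP => [[x [xK /tsE[xt xs]]]|[/asboolP ne /andP[as_ sb]]].
  have xS : sec k1 t j x by [].
  have ne : sec k1 t j !=set0 by exists x.
  by split; [apply/asboolP|rewrite -xs; have [_ _ _] := abE j ne; apply].
have [leab [p [pK pt] pa] [q [qK qt] qb] _] := abE j ne.
have [ab_eq|ab_neq] := eqVneq (ab j).1 (ab j).2.
  exists p; split=> //; apply/tsE; split=> //; rewrite pa; apply/eqP.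
  by rewrite eq_le as_ ab_eq sb.
have lt_ab : 0 < (ab j).2 - (ab j).1 by rewrite subr_gt0 lt_neqAle ab_neq.
pose l := ((ab j).2 - s) / ((ab j).2 - (ab j).1).
exists (l *: p + (1 - l) *: q); split.
  apply: convexK => //; rewrite /l divr_ge0 ?subr_ge0 ?(ltW lt_ab) //=.
  by rewrite ler_pdivrMr // mul1r lerD2l lerN2.
apply/tsE; split=> [i ik|]; rewrite !mxE.
  by rewrite pt // qt //; ring.
by rewrite pa qb /l; field; rewrite lt0r_neq0.
Qed.

End EulerConvex.

(** * Rank counts as valuative invariants *)

Section Valuative.
Variables (R : realType) (n : nat).
Implicit Types (M : matroid 'I_n) (x y : 'rV[R]_n) (A B : {set 'I_n}) (s : 'S_n).

Definition permuted s x : 'rV[R]_n := \row_i x 0 (s i).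

Lemma weight_permuted s x A : weight (permuted s x) A = weight x (s @: A)%SET.
Proof.
rewrite /weight big_imset /=; last by move=> i j _ _; apply: perm_inj.
by apply: eq_bigr => i _; rewrite mxE.
Qed.

Lemma weight_continuous A : continuous (fun x : 'rV[R]_n => weight x A).
Proof.
apply: continuous_big => [|i _]; [exact: add_continuous|exact: coord_continuous].
Qed.

Definition slice M s A k : set 'rV[R]_n :=
  [set x | in_polytope M (permuted s x) /\ k%:R <= weight x A].

(** All conditions are closed and hold only inside the unit cube. Of the equation for the total
    weight, [S3] is one half; the other half is the rank inequality of the full set. *)
Lemma slice_compact M s A k : compact (slice M s A k).
Proof.
have cube := @rV_compact R n (fun=> `[0, 1]%classic) (fun=> @segment_compact R 0 1).
apply: subclosed_compact cube _; last first.
  move=> x [xP _] i /=; have := polytope_le1 ((s^-1)%g i) xP; have [x0 _ _] := xP.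
  by have := x0 ((s^-1)%g i); rewrite mxE permKV in_itv /= => -> ->.
have cle (B : {set 'I_n}) (a : R) : closed [set x : 'rV[R]_n | weight x B <= a].
  apply: (@preimage_closed _ _ (fun x : 'rV[R]_n => weight x B) [set y | y <= a]); last exact: closed_le.
  by move=> x _; exact: weight_continuous.
have cge (B : {set 'I_n}) (a : R) : closed [set x : 'rV[R]_n | a <= weight x B].
  apply: (@preimage_closed _ _ (fun x : 'rV[R]_n => weight x B) [set y | a <= y]); last exact: closed_ge.
  by move=> x _; exact: weight_continuous.
pose S1 := \bigcap_(i in [set: 'I_n]) [set x : 'rV[R]_n | 0 <= weight x [set i]%SET].
pose S2 := \bigcap_(B in [set: {set 'I_n}]) [set x : 'rV[R]_n | weight x (s @: B)%SET <= (rk M B)%:R].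
pose S3 := [set x : 'rV[R]_n | (rank M)%:R <= weight x [set: 'I_n]%SET].
have -> : slice M s A k = S1 `&` S2 `&` S3 `&` [set x | k%:R <= weight x A].
  have sT : (s @: [set: 'I_n] = [set: 'I_n])%SET.
    by apply/finset.setP => i; rewrite !inE; apply/imsetP; exists ((s^-1)%g i); rewrite ?permKV.
  apply/seteqP; split=> x.
    move=> [[x0 xA xT] xk]; split=> //; split; last by rewrite /S3 /= -xT weight_permuted sT.
    split=> [i _|B _] /=; last by rewrite -weight_permuted.
    by have := x0 ((s^-1)%g i); rewrite mxE permKV weight_set1.
  move=> [[[h1 h2] h3] xk]; split=> //; split=> [i|B|].
  - by rewrite mxE -weight_set1; apply: h1.
  - by rewrite weight_permuted; apply: h2.
  apply/eqP; rewrite eq_le weight_permuted sT h3 andbT -[X in weight x X]sT.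
  exact: h2.
apply: closedI; last exact: cge.
apply: closedI; last exact: cge.
by apply: closedI; apply: closed_bigI => *; [exact: cge|exact: cle].
Qed.

Lemma weight_conv x y (t : R) A :
  weight (t *: x + (1 - t) *: y) A = t * weight x A + (1 - t) * weight y A.
Proof.
rewrite /weight !mulr_sumr -big_split; apply: eq_bigr => i _.
by rewrite !mxE.
Qed.

Lemma slice_convex M s A k x y (t : R) : 0 <= t <= 1 -> slice M s A k x ->
  slice M s A k y -> slice M s A k (t *: x + (1 - t) *: y).
Proof.
move=> /andP[t0 t1] [[x0 xA xT] xk] [[y0 yA yT] yk].
have t1' : 0 <= 1 - t by rewrite subr_ge0.
split; last first.
  have := ler_wpM2l t0 xk; have := ler_wpM2l t1' yk; rewrite /= weight_conv => h1 h2.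
  by apply: le_trans (lerD h2 h1); rewrite -mulrDl addrC subrK mul1r.
split=> [i|B|].
- move: (x0 i) (y0 i); rewrite !mxE => xi yi.
  by rewrite addr_ge0 // mulr_ge0.
- move: (xA B) (yA B); rewrite !weight_permuted weight_conv => xB yB.
  have := ler_wpM2l t0 xB; have := ler_wpM2l t1' yB => h1 h2.
  by apply: le_trans (lerD h2 h1) _; rewrite -mulrDl addrC subrK mul1r.
move: xT yT; rewrite !weight_permuted weight_conv => -> ->; ring.
Qed.

(** The largest weight of a set over the base polytope is its rank, reached at a base that extends a
    basis of the set. *)
Lemma slice_nonempty M s A k :
  slice M s A k !=set0 <-> (k <= rk M (s @^-1: A))%N.
Proof.
have sA : (s @: (s @^-1: A) = A)%SET.
  apply/finset.setP => i; apply/imsetP/idP => [[j + ->]|iA]; first by rewrite inE.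
  by exists ((s^-1)%g i); rewrite ?inE permKV.
split=> [[x [[_ xA _] xk]]|kA].
  rewrite -(ler_nat R); apply: le_trans xk (le_trans _ (xA (s @^-1: A)%SET)).
  by rewrite weight_permuted sA.
have [I [iI IA cI]] := rk_basis M (s @^-1: A)%SET.
have [B [iB IB _ cB]] := rk_basis_ext iI (finset.subsetT _).
pose x : 'rV[R]_n := \row_i ((s^-1)%g i \in B)%:R.
have xE : permuted s x = \row_i (i \in B)%:R.
  by apply/rowP => i; rewrite !mxE permK.
exists x; split.
  apply/base_polytopeP; rewrite xE; apply: conv_hull1; exists B => //.
  by apply/baseP.
rewrite /= -sA -weight_permuted xE weight_indic ler_nat (leq_trans kA) //.
by rewrite -cI subset_leq_card // finset.subsetI IB.
Qed.

(** Multiply the relation by the indicator of the half-space of weight at least [k] on [A] and take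
    Euler characteristics: this relates the numbers of permutations that carry [A] back to a set of
    rank at least [k]. Summed over all [A] of size [l], each permutation contributes the full count,
    and n! cancels. *)
Lemma valuative m (N : 'I_m -> matroid 'I_n) (c : 'I_m -> R) M k l :
  (forall x, sym_indic (base_polytope M) x =
     \sum_j c j * sym_indic (base_polytope (N j)) x) ->
  (rank_count M k l)%:R = \sum_j c j * (rank_count (N j) k l)%:R.
Proof.
move=> symE.
have nf : n`!%:R != 0 :> R by rewrite pnatr_eq0 -lt0n fact_gt0.
(* The relation is brought to one side, [M] entering as [None] with coefficient -1. *)
pose MM (o : option 'I_m) := if o is Some j then N j else M.
pose dd (o : option 'I_m) := if o is Some j then c j else -1.
have one A : \sum_(s : 'S_n) ((k <= rk M (s @^-1: A))%N)%:R =
    \sum_j c j * \sum_(s : 'S_n) ((k <= rk (N j) (s @^-1: A))%N)%:R :> R.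
  pose K (p : option 'I_m * 'S_n) := slice (MM p.1) p.2 A k.
  have := @euler_convex R n _ K (fun p => dd p.1)
    (fun p => @slice_compact _ _ _ _) (fun p x y t => @slice_convex _ _ _ _ x y t).
  have split_opt (F : option 'I_m -> R) : \sum_o F o = F None + \sum_j F (Some j).
    rewrite (bigD1 None) //=; congr (_ + _).
    rewrite (reindex_omap Some id) /=; last by case.
    by apply: eq_bigl => j; rewrite eqxx.
  have total : forall x, \sum_p dd p.1 * (`[< K p x >])%:R = 0.
    move=> x; rewrite -(pair_bigA _ (fun o s => dd o * (`[< K (o, s) x >])%:R)) /=.
    have inner o : \sum_(s : 'S_n) dd o * (`[< K (o, s) x >])%:R =
        dd o * ((k%:R <= weight x A)%R%:R * n`!%:R * sym_indic (base_polytope (MM o)) x).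
      rewrite -mulr_sumr /sym_indic -mulrA mulVKf //; congr (_ * _); rewrite mulr_sumr.
      apply: eq_bigr => s _.
      rewrite (@indicP _ R _ _ `[< in_polytope (MM o) (permuted s x) >]).
        rewrite -natrM mulnb; congr (_%:R); congr nat_of_bool.
        by apply/asboolP/andP => [[h1 h2]|[h2 /asboolP h1]]; split=> //; apply/asboolP.
      apply: iff_trans (base_polytopeP _ _) _.
      by split=> [h|/asboolP//]; apply/asboolP.
    rewrite (eq_bigr _ (fun o _ => inner o)) split_opt /= symE mulr_sumr mulN1r.
    rewrite addrC; apply/eqP; rewrite subr_eq0; apply/eqP; apply: eq_bigr => j _.
    by rewrite mulrCA.
  move=> /(_ total); rewrite big_mkcond /=.
  have asb p : `[< K p !=set0 >] = (k <= rk (MM p.1) (p.2 @^-1: A))%N.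
    by apply/asboolP/idP => /slice_nonempty.
  rewrite (eq_bigr (fun p : option 'I_m * 'S_n => dd p.1 * ((k <= rk (MM p.1) (p.2 @^-1: A))%N)%:R)); last first.
    by move=> p _; rewrite asb; case: ifP; rewrite ?mulr1 ?mulr0.
  rewrite -(pair_bigA _ (fun o (s : 'S_n) => dd o * ((k <= rk (MM o) (s @^-1: A))%N)%:R)) /=.
  under eq_bigr do rewrite -mulr_sumr.
  by rewrite split_opt /= mulN1r addrC => /eqP; rewrite subr_eq0 => /eqP.
have tot M' : \sum_(A : {set 'I_n} | #|A| == l) \sum_(s : 'S_n)
    ((k <= rk M' (s @^-1: A))%N)%:R = n`!%:R * (rank_count M' k l)%:R :> R.
  rewrite exchange_big /= (eq_bigr (fun=> (rank_count M' k l)%:R)); last first.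
    move=> s _; have imK (A : {set 'I_n}) : (s @^-1: (s @: A) = A)%SET.
      by apply/finset.setP => i; rewrite inE mem_imset //; apply: perm_inj.
    have im_inj : injective (fun A : {set 'I_n} => s @: A)%SET.
      by move=> A B /= AB; rewrite -(imK A) AB imK.
    rewrite (reindex_inj im_inj) /rank_count -sum1_card natr_sum big_mkcond [RHS]big_mkcond.
    apply: eq_bigr => A _; rewrite inE imK card_imset; last exact: perm_inj.
    by case: (_ == _) => //=; case: (_ <= _)%N.
  by rewrite sumr_const mulr_natl (_ : #|xpredT| = #|{perm 'I_n}|) ?card_Sn //; apply: eq_card.
apply: (mulfI nf); rewrite -tot (eq_bigr _ (fun A _ => one A)) exchange_big mulr_sumr.
by apply: eq_bigr => j _; rewrite -mulr_sumr tot mulrCA.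
Qed.

End Valuative.

Section FunctionalValuative.
Variable R : realType.

Lemma low_valuative n m (N : 'I_m -> matroid 'I_n) (c : 'I_m -> R) M h s :
  (forall x, sym_indic (base_polytope M) x =
     \sum_j c j * sym_indic (base_polytope (N j)) x) ->
  low R M h s = \sum_j c j * low R (N j) h s.
Proof.
move=> symE; rewrite /low low_setsE natrB ?rank_count_le // !(valuative _ _ symE) -sumrB.
by apply: eq_bigr => j _; rewrite low_setsE natrB ?rank_count_le // mulrBr.
Qed.

Lemma functional_valuative r (w1 w2 : R) n m (N : 'I_m -> matroid 'I_n) (c : 'I_m -> R) M :
  (forall x, sym_indic (base_polytope M) x =
     \sum_j c j * sym_indic (base_polytope (N j)) x) ->
  functional r w1 w2 M = \sum_j c j * functional r w1 w2 (N j).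
Proof.
move=> symE; rewrite /functional !(low_valuative _ _ symE).
under [X in w1 * X]eq_bigr do rewrite (low_valuative _ _ symE).
rewrite exchange_big /= !mulr_sumr -sumrB mulr_sumr -!sumrB.
apply: eq_bigr => j _; rewrite -mulr_sumr; ring.
Qed.

End FunctionalValuative.

Local Close Scope classical_set_scope.
Local Close Scope ring_scope.

(** * Extremality *)

Section Extremality.
Variables (R : realType) (n r m : nat) (N : 'I_m -> matroid 'I_n).
Local Open Scope ring_scope.

(** The symmetrized indicators agree, so both coordinate vectors are chosen from the same solution
    set. *)
Lemma nested_vector_iso M M' : isomorphic M M' -> nested_vector R N M = nested_vector R N M'.
Proof.
move=> iso; congr (map_mx _ (xget _ _)); apply/funext => c; apply/propext.
by split=> h x; [rewrite -(sym_indic_iso x iso)|rewrite (sym_indic_iso x iso)].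
Qed.

(** The gap between the maximum and the value at a convex combination is the weighted sum of the
    gaps at its points. If it vanishes, every point of positive weight is [v]. *)
Lemma conv_hull_vertex (S : 'rV[R]_m -> Prop) (v u : 'rV[R]_m) : S v ->
  (forall x, S x -> \sum_i u 0 i * x 0 i <= \sum_i u 0 i * v 0 i /\
     (\sum_i u 0 i * x 0 i = \sum_i u 0 i * v 0 i -> x = v)) ->
  vertex (conv_hull S) v.
Proof.
move=> Sv maxv; split; first exact: conv_hull1.
exists u => _ [k [w [a [wS a0 a1 ->]]]] neq.
set f := fun x : 'rV[R]_m => \sum_i u 0 i * x 0 i.
have fE : f (\sum_i a i *: w i) = \sum_i a i * f (w i).
  rewrite /f; under [RHS]eq_bigr do rewrite mulr_sumr.
  rewrite exchange_big /=; apply: eq_bigr => j _.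
  rewrite summxE mulr_sumr; apply: eq_bigr => i _.
  by rewrite mxE mulrCA.
have gap : f v - f (\sum_i a i *: w i) = \sum_i a i * (f v - f (w i)).
  rewrite fE -[f v]mul1r -[X in X * _ - _]a1 mulr_suml -sumrB.
  by apply: eq_bigr => i _; rewrite mulrBr mul1r.
have ge0 i : 0 <= a i * (f v - f (w i)).
  by rewrite mulr_ge0 // subr_ge0; case: (maxv _ (wS i)).
rewrite -/(f _) -/(f v) -subr_gt0 gap lt_neqAle sumr_ge0 ?andbT //.
apply: contra_neq neq => /esym/psumr_eq0P h.
have -> : v = \sum_i a i *: v by rewrite -scaler_suml a1 scale1r.
apply: eq_bigr => i _; have /eqP := h (fun i _ => ge0 i) i isT.
rewrite mulf_eq0 subr_eq0 => /orP[/eqP->|/eqP fv]; first by rewrite !scale0r.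
by rewrite (proj2 (maxv _ (wS i)) (esym fv)).
Qed.

End Extremality.

(** The supporting functional has as coefficients the values of [functional] on the nested
    representatives. By [functional_valuative] its value at the vector of [M] is the invariant of
    [M], and a matroid reaching the maximum is isomorphic to [M_K], so it has the same vector. *)
Lemma extremal_complete (R : realType) (r : nat) : extremal R (M_K r.+1).
Proof.
move=> m N M' repN iso; have rK := rank_K r; rewrite rK in repN *.
have cE : #|'I_#|{: complete_edge 'I_r.+1}| | = 'C(r.+1, 2).
  by rewrite card_ord card_edge card_ord.
set n := #|{: complete_edge 'I_r.+1}| in cE N M' repN iso *.
(* These are the weights of [functional_max] for the ground set ['I_n]. *)
pose w2 : R := ((2 ^ #|'I_n|)%N%:R + 1)%R.
pose w1 : R := ((2 ^ #|'I_n|)%N%:R + 6 * w2 * (2 ^ #|'I_n|)%N%:R + 1)%R.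
pose phi (M : matroid 'I_n) := functional r w1 w2 M.
have phiE M : rank M = r -> (\sum_i (\row_j phi (N j)) 0 i * nested_vector R N M 0 i = phi M)%R.
  move=> rM; rewrite /phi (functional_valuative r w1 w2 (c := fun j => ((nested_coords R N M 0 j)%:~R)%R) (nested_coordsP (R := R) repN rM)).
  by apply: eq_bigr => j _; rewrite !mxE mulrC.
have rM' : rank M' = r by rewrite -(isomorphic_rank iso).
have phiM' : phi M' = functional r w1 w2 (M_K r.+1) by rewrite /phi -(functional_iso r w1 w2 iso).
apply: (@conv_hull_vertex _ _ _ _ (\row_j phi (N j))%R); first by exists M'.
move=> _ [M rM <-]; rewrite !phiE // phiM'.
have [le eqM] := functional_max R cE rM; split=> // /eqM isoM.
exact: nested_vector_iso (isomorphic_trans isoM iso).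
Qed.

Theorem theorem5p2 (R : realType) (r : nat) :
  (forall (E : finType) (M : matroid E),
     simple M -> rank M = r -> #|E| = 'C(r.+1, 2) ->
     (forall L : {set E}, line M L -> #|L| \in [:: 2; 3]) ->
     (forall P : {set E}, plane M P -> #|P| \in [:: 3; 4; 6]) ->
     (forall (h : nat) (F : {set E}), 4 <= h <= r -> flat_of_rank M h F ->
        #|F| <= 'C(h.+1, 2)) ->
     let long_lines := [set L : {set E} | line M L & #|L| == 3]%SET in
     #|long_lines| <= 'C(r.+1, 3) /\
     (#|long_lines| = 'C(r.+1, 3) -> isomorphic M (M_K r.+1)))
  /\ extremal R (M_K r.+1).
Proof.
split; last exact: extremal_complete.
move=> E M simpleM <- cE linesM planesM flatsM long_lines.
have sM := sparse_of_flats simpleM linesM planesM flatsM.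
have pM := no5planes_of_planes planesM.
rewrite /long_lines long_lines_triples //.
by split; [exact: card_triples|exact: complete_of_triples].
Qed.
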